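(* Let $k$ be a positive integer. The coordinate ring $\mathbb{C}[\mathrm{SL}_k]$ of the special linear group has a cluster structure whose set of coefficient and cluster variables includes all minors of a $k\times k$ matrix, except for the determinant of the matrix. That is, there is a seed $(\tilde{\mathbf{x}},\tilde B)$ in the field of fractions of $\mathbb{C}[\mathrm{SL}_k]$ such that $\mathcal{A}(\tilde{\mathbf{x}},\tilde B)=\mathbb{C}[\mathrm{SL}_k]$ and, for all $I,J\subset\{1,\dots,k\}$ with $1\le|I|=|J|\le k-1$, the minor $\Delta_{I,J}$ (row set $I$, column set $J$), viewed as a regular function on $\mathrm{SL}_k$, is either a coefficient variable or a cluster variable of $\mathcal{A}(\tilde{\mathbf{x}},\tilde B)$.
   Context: A seed of rank $n$ in a field $\mathcal{F}\supset\mathbb{C}$ is a pair $(\tilde{\mathbf{x}},\tilde B)$ where $\tilde{\mathbf{x}}=(x_1,\dots,x_m)$, $n\le m$, is algebraically independent over $\mathbb{C}$ with $\mathcal{F}=\mathbb{C}(x_1,\dots,x_m)$, and $\tilde B=(b_{ij})$ is an $m\times n$ integer matrix whose top $n\times n$ submatrix is skew-symmetrizable. The elements $x_1,\dots,x_n$ are the cluster variables of the seed and $x_{n+1},\dots,x_m$ are the frozen (coefficient) variables. For $1\le \ell\le n$, the mutation $\mu_\ell$ replaces $x_\ell$ by $x_\ell'$ with $x_\ell x_\ell'=\prod_{b_{i\ell}>0}x_i^{b_{i\ell}}+\prod_{b_{i\ell}<0}x_i^{-b_{i\ell}}$, and $\tilde B$ by $(b'_{ij})$ with $b'_{ij}=-b_{ij}$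 if $i=\ell$ or $j=\ell$, and $b'_{ij}=b_{ij}+\tfrac12(|b_{i\ell}|b_{\ell j}+b_{i\ell}|b_{\ell j}|)$ otherwise. The cluster variables of $\mathcal{A}(\tilde{\mathbf{x}},\tilde B)$ are the cluster variables of all seeds obtained from $(\tilde{\mathbf{x}},\tilde B)$ by finite sequences of mutations, and $\mathcal{A}(\tilde{\mathbf{x}},\tilde B)$ is the $\mathbb{C}$-subalgebra of $\mathcal{F}$ generated by all of them together with the frozen variables (whose inverses are not adjoined). *)

(* Defs.v *)
From HB Require Import structures.
From mathcomp Require Import all_boot all_order all_algebra.
From mathcomp Require Import ring_quotient fraction.
From mathcomp Require Import boolp reals.
From mathcomp Require Import ring complex mpoly.

Set Implicit Arguments.
Unset Strict Implicit.
Unset Printing Implicit Defensive.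

Import Order.TTheory GRing.Theory Num.Theory.
Local Open Scope ring_scope.
Local Open Scope quotient_scope.

Section CoordinateRingSL.
Variables (K : fieldType) (k : nat).
Local Notation P := {mpoly K[k * k]}.

(* The variable x_(i,j) of the polynomial ring in k^2 variables is
   'X_(mxvec_index i j). *)
Definition generic_mx : 'M[P]_k := \matrix_(i, j) 'X_(mxvec_index i j).

Local Notation d := (\det generic_mx).

Definition sl_ideal : {pred P} := [pred p | `[< exists q, p = q * (d - 1) >]].

Lemma sl_idealP p : reflect (exists q, p = q * (d - 1)) (p \in sl_ideal).
Proof. exact: asboolP. Qed.

Lemma sl_idealD p q : p \in sl_ideal -> q \in sl_ideal -> p + q \in sl_ideal.
Proof.
move=> /sl_idealP[a ->] /sl_idealP[b ->]; apply/sl_idealP.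
by exists (a + b); rewrite mulrDl.
Qed.

Lemma sl_idealM p q : q \in sl_ideal -> p * q \in sl_ideal.
Proof.
by move=> /sl_idealP[b ->]; apply/sl_idealP; exists (p * b); rewrite mulrA.
Qed.

Lemma sl_idealX N : d ^+ N - 1 \in sl_ideal.
Proof. by apply/sl_idealP; rewrite subrX1; eexists; rewrite mulrC. Qed.

Lemma det_generic_neq0 : d != 0.
Proof.
apply/eqP => /(congr1 (meval (fun l => mxvec (1%:M : 'M[K]_k) 0 l))).
rewrite -det_map_mx meval0.
have -> : map_mx (meval (fun l => mxvec (1%:M : 'M[K]_k) 0 l)) generic_mx = 1%:M.
  by apply/matrixP => i j; rewrite !mxE mevalXU mxvecE mxE.
by rewrite det1 => /eqP; rewrite oner_eq0.
Qed.

(* Dividing the first row of the generic matrix by its determinant gives a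
   point of SL_k over K(x_11, ..., x_kk); evaluation at this point has kernel
   exactly the ideal of det - 1, so that this ideal is prime. *)
Definition generic_sl_mx : 'M[{fraction P}]_k :=
  \matrix_(i, j) (if i == 0 :> nat then (tofrac d)^-1 * tofrac (generic_mx i j)
                  else tofrac (generic_mx i j)).

Definition generic_eval : P -> {fraction P} :=
  mmap (@tofrac P \o @mpolyC (k * k) K) (fun l => mxvec generic_sl_mx 0 l).

HB.instance Definition _ := GRing.RMorphism.on generic_eval.

Lemma det_generic_sl : \det generic_sl_mx = 1.
Proof.
have dF : tofrac d != 0 by rewrite tofrac_eq0 det_generic_neq0.
pose r : 'rV[{fraction P}]_k :=
  \row_i (if i == 0 :> nat then (tofrac d)^-1 else 1).
have -> : generic_sl_mx = diag_mx r *m map_mx (@tofrac P) generic_mx.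
  apply/matrixP => i j; rewrite mul_diag_mx !mxE.
  by case: ifP => // _; rewrite mul1r.
rewrite det_mulmx det_diag det_map_mx.
have [k0|k_gt0] := posnP k.
  have det0 (T : comNzRingType) m (M : 'M[T]_m) : m = 0%N -> \det M = 1.
    by move=> m0; subst m; rewrite det_mx00.
  by rewrite det0 // rmorph1 mulr1 big1 // => i; have := ltn_ord i; rewrite {2}k0.
rewrite (bigD1 (Ordinal k_gt0)) //= big1 ?mulr1 => [|i i0]; first by rewrite mxE mulVf.
rewrite mxE; case: ifP => // /eqP i_0; case/negP: i0.
by apply/eqP; apply: val_inj.
Qed.

Lemma generic_evalX i j :
  generic_eval (generic_mx i j) = generic_sl_mx i j.
Proof. by rewrite mxE /generic_eval mmapX mmap1U mxvecE. Qed.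

Lemma generic_eval_det : generic_eval d = 1.
Proof.
rewrite -det_map_mx -det_generic_sl; congr (\det _).
by apply/matrixP => i j; rewrite [LHS]mxE; apply: generic_evalX.
Qed.

Lemma clear_add (T : comNzRingType) (a b t1 t2 p1 p2 : T) :
  b * t1 + a * t2 - (p1 + p2) =
  ((t1 - p1) + t1 * (b - 1)) + ((t2 - p2) + t2 * (a - 1)).
Proof. by ring. Qed.

Lemma clear_mul (T : comNzRingType) (t1 t2 p1 p2 : T) :
  t1 * t2 - p1 * p2 = t1 * (t2 - p2) + p2 * (t1 - p1).
Proof. by ring. Qed.

Lemma generic_eval_clear p : exists N t,
  tofrac d ^+ N * generic_eval p = tofrac t /\ t - p \in sl_ideal.
Proof.
pose good p := exists N t,
  tofrac d ^+ N * generic_eval p = tofrac t /\ t - p \in sl_ideal.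
have dF : tofrac d != 0 by rewrite tofrac_eq0 det_generic_neq0.
have I0 : 0 \in sl_ideal by apply/sl_idealP; exists 0; rewrite mul0r.
have goodC c : good c%:MP.
  by exists 0%N, c%:MP; rewrite mul1r subrr /generic_eval mmapC.
have goodD p1 p2 : good p1 -> good p2 -> good (p1 + p2).
  move=> [N1 [t1 [e1 i1]]] [N2 [t2 [e2 i2]]].
  exists (N1 + N2)%N, (d ^+ N2 * t1 + d ^+ N1 * t2); split.
    rewrite !(rmorphD, rmorphM, rmorphXn) /= -e1 -e2 mulrDr exprD.
    by congr (_ + _); rewrite mulrA // [X in X * _ = _]mulrC.
  rewrite clear_add.
  by do 2?apply: sl_idealD => //; apply: sl_idealM; apply: sl_idealX.
have goodM p1 p2 : good p1 -> good p2 -> good (p1 * p2).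
  move=> [N1 [t1 [e1 i1]]] [N2 [t2 [e2 i2]]].
  exists (N1 + N2)%N, (t1 * t2); split.
    by rewrite !rmorphM /= -e1 -e2 exprD mulrACA.
  by rewrite clear_mul; apply: sl_idealD; apply: sl_idealM.
have goodX l : good 'X_l.
  case/mxvec_indexP: l => i j.
  have -> : 'X_(mxvec_index i j) = generic_mx i j by rewrite mxE.
  rewrite /good generic_evalX /generic_sl_mx mxE; case: ifP => _.
    by exists 1%N, (generic_mx i j); rewrite expr1 mulVKf // subrr.
  by exists 0%N, (generic_mx i j); rewrite mul1r subrr.
rewrite -/(good p); elim/mpolyind: p => [|c m p _ _ IH].
  by rewrite -mpolyC0; apply: (@goodC).
apply: (@goodD) => //; rewrite -mul_mpolyC; apply: (@goodM); first exact: (@goodC).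
rewrite mpolyXE_id; apply: (big_ind good) => [||i _]; [exact: (@goodC) | exact: goodM |].
elim: (m i) => [|n IHn]; first exact: (@goodC).
by rewrite exprS; apply: goodM.
Qed.

Lemma sl_ideal_ker p : (p \in sl_ideal) = (generic_eval p == 0).
Proof.
apply/idP/eqP => [/sl_idealP[q ->]|p0].
  by rewrite rmorphM rmorphB rmorph1 /= generic_eval_det subrr mulr0.
have [N [t []]] := generic_eval_clear p.
rewrite p0 mulr0 => /esym/eqP; rewrite tofrac_eq0 => /eqP ->.
by rewrite sub0r => /(sl_idealM (-1)); rewrite mulN1r opprK.
Qed.

Lemma sl_ideal_closed : idealr_closed sl_ideal.
Proof.
split=> [||a u v uI vI].
- by rewrite sl_ideal_ker; apply/eqP; apply: rmorph0.
- by rewrite sl_ideal_ker rmorph1 oner_eq0.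
- by apply: sl_idealD => //; apply: sl_idealM.
Qed.

Lemma sl_ideal_prime : prime_idealr_closed sl_ideal.
Proof. by move=> u v; rewrite !sl_ideal_ker rmorphM mulf_eq0. Qed.

HB.instance Definition _ := isIdealr.Build P sl_ideal sl_ideal_closed.
HB.instance Definition _ :=
  isPrimeIdealrClosed.Build P sl_ideal sl_ideal_prime.

(* The coordinate ring K[SL_k] = K[x_11, ..., x_kk] / (det - 1). *)
Definition sl_ring : Type := {ideal_quot sl_ideal}.

HB.instance Definition _ := GRing.ComNzRing.on sl_ring.

Definition sl_pi : P -> sl_ring := fun p => \pi_{ideal_quot sl_ideal} p.
HB.instance Definition _ := GRing.RMorphism.copy sl_pi
  (\pi_{ideal_quot sl_ideal} : P -> {ideal_quot sl_ideal}).

Definition sl_unit : {pred sl_ring} := [pred x | `[< exists y, y * x = 1 >]].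

Definition sl_inv (x : sl_ring) : sl_ring :=
  if pselect (exists y, y * x = 1) is left ex then projT1 (cid ex) else x.

Lemma sl_mulVr : {in sl_unit, left_inverse 1 sl_inv *%R}.
Proof.
move=> x /asboolP ex; rewrite /sl_inv; case: pselect => // ex'.
by case: cid.
Qed.

Lemma sl_unitP (x y : sl_ring) : y * x = 1 -> x \in sl_unit.
Proof. by move=> yx; apply/asboolP; exists y. Qed.

Lemma sl_inv_out : {in [predC sl_unit], sl_inv =1 id}.
Proof.
move=> x /negP xU; rewrite /sl_inv; case: pselect => // ex.
by case: xU; apply/asboolP.
Qed.

HB.instance Definition _ := GRing.ComNzRing_hasMulInverse.Build sl_ring
  sl_mulVr sl_unitP sl_inv_out.

Lemma sl_idomain : GRing.integral_domain_axiom sl_ring.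
Proof. exact: Quotient.rquot_IdomainAxiom. Qed.

HB.instance Definition _ :=
  GRing.ComUnitRing_isIntegral.Build sl_ring sl_idomain.

Definition sl_coord : 'M[sl_ring]_k := map_mx sl_pi generic_mx.

Lemma det_sl_coord : \det sl_coord = 1.
Proof.
rewrite det_map_mx; apply/eqP; rewrite -subr_eq0 -(rmorph1 sl_pi) -rmorphB /=.
have -> : (0 : sl_ring) = sl_pi 0 by rewrite rmorph0.
rewrite /sl_pi -Quotient.idealrBE subr0; apply/sl_idealP.
by exists 1; rewrite mul1r.
Qed.

Definition sl_field : fieldType := {fraction sl_ring}.

Definition sl_scalar : {rmorphism K -> sl_field} :=
  (@tofrac sl_ring \o (sl_pi \o @mpolyC (k * k) K)).

End CoordinateRingSL.

(* enum_val lists the elements of I and of J in increasing order. *)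
Definition minor (T : comNzRingType) (k : nat) (A : 'M[T]_k)
    (I J : {set 'I_k}) (eqIJ : #|I| = #|J|) : T :=
  \det (mxsub (fun a : 'I_#|I| => enum_val a)
              (fun b : 'I_#|I| => enum_val (cast_ord eqIJ b)) A).

Section ClusterAlgebra.
Variables (K F : fieldType) (iota : {rmorphism K -> F}).

(* The raw data of a pair (x, B); is_seed below singles out the seeds.
   With m = n + p, an extended cluster consists of the n cluster variables
   x (lshift p j) followed by the p frozen variables x (rshift n j). *)
Record labeled_pair (n p : nat) := LabeledPair {
  ext_cluster : 'I_(n + p) -> F;
  ext_mx : 'M[int]_(n + p, n)
}.

Definition alg_independent (m : nat) (x : 'I_m -> F) : Prop :=
  forall f : {mpoly K[m]}, mmap iota x f = 0 -> f = 0.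

Definition generates_field (m : nat) (x : 'I_m -> F) : Prop :=
  forall z : F, exists f g : {mpoly K[m]},
    mmap iota x g != 0 /\ z = mmap iota x f / mmap iota x g.

Definition skew_symmetrizable (n : nat) (B : 'M[int]_n) : Prop :=
  exists s : 'I_n -> int, (forall i, 0 < s i) /\
    (forall i j, s i * B i j = - (s j * B j i)).

Definition is_seed (n p : nat) (S : labeled_pair n p) : Prop :=
  [/\ alg_independent (ext_cluster S),
      generates_field (ext_cluster S)
    & skew_symmetrizable (usubmx (ext_mx S))].

(* The exchange relation is solved for the new variable; x l is nonzero in
   every seed. The integer division by 2 is exact. *)
Definition mutate (n p : nat) (S : labeled_pair n p) (l : 'I_n) :
    labeled_pair n p :=
  let x := ext_cluster S in
  let B := ext_mx S in
  let l' := lshift p l in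
  LabeledPair
    (fun i => if i == l' then
         (\prod_(h | 0 < B h l) x h ^+ `|B h l|%N
          + \prod_(h | B h l < 0) x h ^+ `|B h l|%N) / x l'
       else x i)
    (\matrix_(i, j) if (i == l') || (j == l) then - B i j
       else B i j + ((`|B i l| * B l' j + B i l * `|B l' j|) %/ 2)%Z).

Definition is_cluster_variable (n p : nat) (S : labeled_pair n p) (z : F) :=
  exists (ls : seq 'I_n) (j : 'I_n),
    z = ext_cluster (foldl (@mutate n p) S ls) (lshift p j).

Definition is_frozen_variable (n p : nat) (S : labeled_pair n p) (z : F) :=
  exists j : 'I_p, z = ext_cluster S (rshift n j).

Inductive cluster_algebra (n p : nat) (S : labeled_pair n p) : F -> Prop :=
| ca_scalar c : cluster_algebra S (iota c)
| ca_cluster z : is_cluster_variable S z -> cluster_algebra S z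
| ca_frozen z : is_frozen_variable S z -> cluster_algebra S z
| ca_add y z : cluster_algebra S y -> cluster_algebra S z ->
    cluster_algebra S (y + z)
| ca_mul y z : cluster_algebra S y -> cluster_algebra S z ->
    cluster_algebra S (y * z).

End ClusterAlgebra.

(* Main.v *)
From HB Require Import structures.
Require Import Defs.
From mathcomp Require Import all_boot all_order all_algebra.
From mathcomp Require Import ring_quotient perm fraction mpoly.
From mathcomp Require Import boolp zify ring.

(** The cluster structure is first built on the space of all k x k matrices,
    with the determinant as one more frozen variable; the determinant is set
    to 1 at the end.

    Combinatorics.  A pair of permutations (u, v) of {0, ..., k - 1}, called a
    state, names a flag of minors: for each r, the one with rows u 0, ...,
    u (r - 1) and columns v 0, ..., v (r - 1).  Exchanging two neighbouring
    values of u or of v changes one minor of the flag.  A path is a sequence of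
    exchanges that lead from (identity, reversal) to (reversal, identity), each
    removing one ascent of u or one descent of v, in other words a shuffle of
    two reduced words of the longest permutation.  The minors met on the way
    (the chamber minors) are the variables of a seed, whose quiver is a sum of
    oriented triangles, one for each exchange.  Any two paths are connected by
    commutations and braid moves ([rewr_final], the theorem of Matsumoto and
    Tits).  Some of these moves leave the seed unchanged, and the others are
    a mutation of it ([carries_rewr]), the exchange relation being one of
    two three-term identities between minors ([lewis_carroll], [three_term]).
    Every flag lies on a path, so every minor occurs in a seed
    ([chamber_in_seed]).  Since the entries of the matrix are minors, the
    cluster algebra contains the coordinate ring.

    Regularity.  Conversely every cluster variable z is a polynomial in the
    entries ([cluster_variable_regular]).  The quivers have full rank
    ([quiver_rank]), and the Laurent phenomenon ([laurent_phenomenon]) holds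
    for such seeds: z times a monomial in the initial variables is a polynomial
    in the entries.  The initial variables are minors, hence prime elements
    ([prime_minor]), so that it is enough to find for each of them a
    denominator of z that it does not divide.  For a mutable one, the Laurent
    phenomenon in the seed of another path gives such a denominator: the
    initial path changes all columns before the rows, and the seed of the path
    that changes the rows first has only frozen variables in common with it.  For a frozen one, there are matrices where it vanishes and all
    the other initial variables are 1 ([frozen_zero_point]); mutations are free
    of subtractions and a frozen variable occurs in at most one of the two
    monomials of an exchange, so z has a denominator that is positive there.

    Specialization.  Prescribing nonzero values for the initial minors is always
    possible ([solve_backward]).  This gives the algebraic independence of the
    initial minors other than the determinant on the special linear group, and
    a point of determinant 1 where all of them are 1 and all cluster variables
    are positive; hence no cluster variable vanishes on the group, and the
    mutations of the two seeds correspond to each other ([transfer]). *)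

Set Implicit Arguments.
Unset Strict Implicit.
Unset Printing Implicit Defensive.

Import Order.TTheory GRing.Theory Num.Theory.
Local Open Scope ring_scope.

(** * Signed minors and their three-term relations *)

(** The exchange of the positions r - 1 and r, as a function on all natural
    numbers; rows and columns are listed by functions nat -> nat so that one
    listing gives minors of all sizes. *)
Definition sw (r i : nat) : nat :=
  if i == r then r.-1 else if i == r.-1 then r else i.

Lemma swK r : involutive (sw r).
Proof. by move=> i; rewrite /sw; do !case: eqP => //; lia. Qed.

Lemma sw_inj r : injective (sw r).
Proof. exact: inv_inj (swK r). Qed.

Lemma sw_tperm s n : (0 < s < n)%N ->
  exists2 t : 'S_n, odd_perm t & forall i : 'I_n, sw s i = t i.
Proof.
move=> /andP[s0 sn]; have sn' : (s.-1 < n)%N by lia.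
exists (tperm (Ordinal sn) (Ordinal sn')).
  by rewrite odd_tperm -val_eqE /=; lia.
move=> i; rewrite /sw; case: tpermP => [->|->|] //=.
- by rewrite eqxx.
- by rewrite eqxx; case: eqP.
- by move/eqP; rewrite -val_eqE => /negbTE -> /eqP; rewrite -val_eqE => /negbTE ->.
Qed.

Lemma sum_sw s n (f : nat -> nat) : (0 < s < n)%N ->
  (\sum_(i < n) f (sw s i) = \sum_(i < n) f i)%N.
Proof.
move=> /sw_tperm[t _ tE]; rewrite [RHS](reindex_inj (@perm_inj _ t)) /=.
by apply: eq_bigr => i _; rewrite tE.
Qed.

Lemma sw_out s i : (s < i)%N || (i < s.-1)%N -> sw s i = i.
Proof. by rewrite /sw; do !case: eqP => //; lia. Qed.

(** For e the relation of being larger this is the number of inversions of the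
    word u 0, ..., u (r - 1). *)
Definition pair_count (e : rel nat) (u : nat -> nat) (r : nat) : nat :=
  (\sum_(j < r) \sum_(i < j) e (u i) (u j))%N.

Lemma pair_countS e u r :
  pair_count e u r.+1 = (pair_count e u r + \sum_(i < r) e (u i) (u r))%N.
Proof. by rewrite /pair_count big_ord_recr. Qed.

Lemma eq_pair_count e u u' r : (forall i, (i < r)%N -> u i = u' i) ->
  pair_count e u r = pair_count e u' r.
Proof.
move=> uu; apply: eq_bigr => j _; apply: eq_bigr => i _.
by rewrite !uu //; have := ltn_ord i; have := ltn_ord j; lia.
Qed.

(** Exchanging two neighbours changes the relative order of this pair only. *)
Lemma pair_count_sw e u s r : (0 < s < r)%N ->
  (pair_count e (u \o sw s) r + e (u s.-1) (u s) = pair_count e u r + e (u s) (u s.-1))%N.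
Proof.
elim: r => [|r IH] /andP[s0]; first by [].
rewrite ltnS leq_eqVlt => /predU1P[<-{r IH}|sr].
  case: s s0 => //= s _; rewrite !pair_countS !big_ord_recr /=.
  have E0 : sw s.+1 s.+1 = s by rewrite /sw /= eqxx.
  have E1 : sw s.+1 s = s.+1 by rewrite /sw /=; do !case: eqP => //; lia.
  rewrite E0 E1.
  have Es x : (\sum_(i < s) e (u (sw s.+1 i)) x = \sum_(i < s) e (u i) x)%N.
    by apply: eq_bigr => i _; rewrite sw_out //= ltn_ord orbT.
  rewrite !Es (@eq_pair_count _ _ u s) => [|i si]; last by rewrite /= sw_out //= si orbT.
  ring.
rewrite !pair_countS [(u \o sw s) r]/= (sw_out (s := s) (i := r)) ?sr //.
have -> : (\sum_(i < r) e ((u \o sw s) i) (u r) = \sum_(i < r) e (u i) (u r))%N.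
  by apply: (@sum_sw s r (fun i => e (u i) (u r) : nat)); rewrite s0.
by have := IH _; rewrite s0 sr => /(_ isT); lia.
Qed.

Definition gtr : rel nat := fun x y => (y < x)%N.

Section Minors.
Variable T : comNzRingType.
Implicit Types (A : nat -> nat -> T) (u v : nat -> nat).

Definition fminor A u v r : T := \det (\matrix_(i < r, j < r) A (u i) (v j)).

(** The sign makes the minor independent of the order in which its rows and
    columns are listed, up to the exchanges of [sminor_sw]; it is + when both
    listings are increasing. *)
Definition sminor A u v r : T := (-1) ^+ (pair_count gtr u r + pair_count gtr v r) * fminor A u v r.

Lemma eq_fminor A A' u u' v v' r :
  (forall i j, (i < r)%N -> (j < r)%N -> A (u i) (v j) = A' (u' i) (v' j)) ->
  fminor A u v r = fminor A' u' v' r.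
Proof. by move=> h; congr (\det _); apply/matrixP => i j; rewrite !mxE h. Qed.

Lemma eq_sminor A u u' v v' r :
  (forall i, (i < r)%N -> u i = u' i) -> (forall i, (i < r)%N -> v i = v' i) ->
  sminor A u v r = sminor A u' v' r.
Proof.
move=> hu hv; rewrite /sminor (eq_pair_count _ hu) (eq_pair_count _ hv).
by congr (_ * _); apply: eq_fminor => i j ir jr; rewrite hu // hv.
Qed.

Lemma sminor0 A u v : sminor A u v 0 = 1.
Proof. by rewrite /sminor /pair_count !big_ord0 /fminor det_mx00 mulr1. Qed.

Lemma sminor_tr A u v r : sminor (fun i j => A j i) u v r = sminor A v u r.
Proof.
rewrite /sminor addnC; congr (_ * _); rewrite /fminor -det_tr.
by congr (\det _); apply/matrixP => i j; rewrite !mxE.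
Qed.

Lemma fminor_sw A u v s r : (0 < s < r)%N -> fminor A (u \o sw s) v r = - fminor A u v r.
Proof.
move=> /sw_tperm[t todd tE]; rewrite /fminor.
have -> : \matrix_(i < r, j < r) A ((u \o sw s) i) (v j) =
   row_perm t (\matrix_(i < r, j < r) A (u i) (v j)).
  by apply/matrixP => i j; rewrite !mxE /= tE.
by rewrite row_permE det_mulmx det_perm todd expr1 mulN1r.
Qed.

(** An exchange inside the listing changes the sign of the determinant and the
    parity of the number of inversions; an exchange outside of it changes
    nothing. *)
Lemma sminor_sw A u v s r : (0 < s)%N -> s != r -> u s != u s.-1 ->
  sminor A (u \o sw s) v r = sminor A u v r.
Proof.
move=> s0 sr us; case: (ltngtP s r) sr => // sr _; last first.
  apply: eq_sminor => // i ir /=; rewrite sw_out //; lia.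
rewrite /sminor fminor_sw ?s0 // mulrN -mulNr; congr (_ * _).
have := @pair_count_sw gtr u s r; rewrite s0 sr => /(_ isT); rewrite /gtr.
case: (ltngtP (u s) (u s.-1)) us => // _ _ /=.
  by rewrite addn1 addn0 => <-; rewrite addSn exprS mulN1r.
by rewrite addn1 addn0 => ->; rewrite addSn exprS mulN1r opprK.
Qed.

End Minors.

Lemma det_mx22 (T : comNzRingType) (M : 'M[T]_2) :
  \det M = M 0 0 * M 1 1 - M 0 1 * M 1 0.
Proof.
rewrite (expand_det_row _ 0) !big_ord_recr big_ord0 /= add0r /cofactor !det_mx11.
rewrite !mxE /= expr0 expr1 mul1r mulN1r mulrN.
by congr (M _ _ * M _ _ - M _ _ * M _ _); apply/val_inj.
Qed.

Section Schur.
Variable F : fieldType.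
Variables (A : nat -> nat -> F) (u v : nat -> nat) (q : nat).

(** S is the Schur complement of the leading block: all the minors that extend
    it by one or two rows and columns are its determinant times minors of S, so
    that relations between them reduce to relations between 2 x 2 minors. *)
Lemma fminor_schur : fminor A u v q != 0 -> exists S : nat -> nat -> F, forall u' v',
  (forall i, (i < q)%N -> u' i = u i) -> (forall i, (i < q)%N -> v' i = v i) ->
  fminor A u' v' q.+1 = fminor A u v q * S (u' q) (v' q) /\
  fminor A u' v' q.+2 = fminor A u v q * (S (u' q) (v' q) * S (u' q.+1) (v' q.+1)
     - S (u' q) (v' q.+1) * S (u' q.+1) (v' q)).
Proof.
move=> A0; pose M := \matrix_(i < q, j < q) A (u i) (v j).
have MU : M \in unitmx by rewrite unitmxE unitfE.
pose S x y := A x y - ((\row_(j < q) A x (v j)) *m invmx M *m (\col_(i < q) A (u i) y)) 0 0.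
have key n (a b : 'I_n -> nat) :
   \det (block_mx M (\matrix_(i < q, j < n) A (u i) (b j))
     (\matrix_(i < n, j < q) A (a i) (v j)) (\matrix_(i < n, j < n) A (a i) (b j)))
   = fminor A u v q * \det (\matrix_(i < n, j < n) S (a i) (b j)).
  set B := \matrix_(i < q, j < n) _; set C := \matrix_(i < n, j < q) _.
  set E := \matrix_(i < n, j < n) A _ _.
  have -> : block_mx M B C E = block_mx 1%:M 0 (C *m invmx M) 1%:M *m
      block_mx M B 0 (E - C *m invmx M *m B).
    rewrite mulmx_block !mul1mx !mul0mx !addr0 ?add0r.
    by rewrite -mulmxA mulVmx // mulmx1 addrC subrK.
  rewrite det_mulmx det_lblock !det1 !mul1r det_ublock; congr (_ * \det _).
  apply/matrixP => i j; rewrite !mxE /S; congr (_ - _).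
  rewrite !mxE; apply: eq_bigr => h _; rewrite !mxE; congr (_ * _).
  by apply: eq_bigr => h' _; rewrite !mxE.
exists S => u' v' uu vv.
have mE n : fminor A u' v' (q + n) =
    fminor A u v q * \det (\matrix_(i < n, j < n) S (u' (q + i)%N) (v' (q + j)%N)).
  rewrite -key; congr (\det _); apply/matrixP => i j; rewrite !mxE.
  by case: splitP => i' ei; rewrite !mxE; case: splitP => j' ej;
    rewrite /M ?mxE ei ej ?(uu i') ?(vv j') ?ltn_ord.
split; first by rewrite -addn1 mE det_mx11 !mxE !addn0.
by rewrite -addn2 mE det_mx22 !mxE /= !addn0 !addn1.
Qed.

(** The Schur complement again, its rows and columns being multiplied by the
    signs that count the inversions with the leading block. *)
Lemma sminor_schur : sminor A u v q != 0 -> exists S : nat -> nat -> F, forall u' v',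
  (forall i, (i < q)%N -> u' i = u i) -> (forall i, (i < q)%N -> v' i = v i) ->
  sminor A u' v' q.+1 = sminor A u v q * S (u' q) (v' q) /\
  sminor A u' v' q.+2 = (-1) ^+ ((u' q.+1 < u' q) + (v' q.+1 < v' q))%N *
    (sminor A u v q * (S (u' q) (v' q) * S (u' q.+1) (v' q.+1)
     - S (u' q) (v' q.+1) * S (u' q.+1) (v' q))).
Proof.
rewrite {1}/sminor mulf_eq0 negb_or signr_eq0 /= => /fminor_schur[S HS].
pose cu (w : nat -> nat) x := (\sum_(i < q) gtr (w i) x)%N.
exists (fun x y => (-1) ^+ (cu u x + cu v y) * S x y) => u' v' uu vv.
have [E1 E2] := HS _ _ uu vv.
have cE (w w' : nat -> nat) x : (forall i, (i < q)%N -> w' i = w i) ->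
   (\sum_(i < q) gtr (w' i) x = cu w x)%N.
  by move=> ww; apply: eq_bigr => i _; rewrite ww.
rewrite /sminor E1 E2 !pair_countS !big_ord_recr /=.
rewrite !(cE u u') // !(cE v v') // (eq_pair_count _ uu) (eq_pair_count _ vv).
rewrite -![((_ < _)%N : nat)]/(gtr _ _ : nat).
rewrite !exprD; split; first by ring.
set a := (-1) ^+ cu u (u' q); set b := (-1) ^+ cu u (u' q.+1).
set c := (-1) ^+ cu v (v' q); set d := (-1) ^+ cu v (v' q.+1).
rewrite /gtr; ring.
Qed.

End Schur.

Section Relations.
Variable F : fieldType.
Variables (A : nat -> nat -> F).
Implicit Types u v : nat -> nat.

Lemma sw_below r i : (i < r.-1)%N -> sw r i = i.
Proof. by move=> h; rewrite sw_out // h orbT. Qed.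

(** In terms of the Schur complement S this is the expansion of a 2 x 2
    determinant: S00 S11 = S01 S10 + det S, up to the order of the columns. *)
Lemma lewis_carroll u v q : sminor A u v q != 0 ->
  (u q < u q.+1)%N -> (v q.+1 < v q)%N ->
  sminor A (u \o sw q.+1) v q.+1 * sminor A u (v \o sw q.+1) q.+1 =
  sminor A u v q.+1 * sminor A (u \o sw q.+1) (v \o sw q.+1) q.+1
   + sminor A u v q.+2 * sminor A u v q.
Proof.
move=> D0 uq vq; have [S HS] := sminor_schur D0.
have E (w : nat -> nat) i : (i < q)%N -> (w \o sw q.+1) i = w i.
  by move=> iq; rewrite /= sw_below.
have swq : sw q.+1 q = q.+1 by rewrite /sw /=; do !case: eqP => //; lia.
have [-> ->] := HS u v (fun _ _ => erefl) (fun _ _ => erefl).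
have [-> _] := HS (u \o sw q.+1) v (E u) (fun _ _ => erefl).
have [-> _] := HS u (v \o sw q.+1) (fun _ _ => erefl) (E v).
have [-> _] := HS (u \o sw q.+1) (v \o sw q.+1) (E u) (E v).
rewrite /= swq vq ltnNge ltnW //= add0n expr1; ring.
Qed.

(** In terms of the Schur complement this is the Pluecker relation between the
    minors of three rows a, b, c: with columns 0 and 1,
    S_b0 [a c] = S_a0 [b c] + S_c0 [a b].  The hypotheses on u say that its
    values at q, q + 1, q + 2 are monotone, which makes all signs agree. *)
Lemma three_term u v q : sminor A u v q != 0 ->
  (u q.+1 < u q)%N = (u q.+2 < u q.+1)%N ->
  (u q.+1 < u q)%N = (u q.+2 < u q)%N ->
  let r := q.+1 in
  sminor A (u \o sw r) v r * sminor A (u \o sw r.+1) v r.+1 =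
  sminor A u v r * sminor A (u \o sw r \o sw r.+1) v r.+1 +
  sminor A u v r.+1 * sminor A (u \o sw r \o sw r.+1 \o sw r) v r.
Proof.
move=> D0 uq1 uq2 r; have [S HS] := sminor_schur D0.
have E i : (i < q)%N -> (u \o sw r) i = u i.
  by move=> iq; rewrite /= sw_below.
have E1 i : (i < q)%N -> (u \o sw r.+1) i = u i.
  by move=> iq; rewrite /= sw_below //= ltnW.
have E2 i : (i < q)%N -> (u \o sw r \o sw r.+1) i = u i.
  by move=> iq; rewrite /= (sw_below (r := r.+1)) ?sw_below //= ltnW.
have E3 i : (i < q)%N -> (u \o sw r \o sw r.+1 \o sw r) i = u i.
  by move=> iq; rewrite /= !sw_below //= ltnW.
have s1 : sw r q = q.+1 by rewrite /sw /r /=; do !case: eqP => //; lia.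
have s2 : sw r q.+1 = q by rewrite /sw /r eqxx.
have s3 : sw r.+1 q = q by rewrite /sw /r /=; do !case: eqP => //; lia.
have s4 : sw r.+1 q.+1 = q.+2 by rewrite /sw /r /=; do !case: eqP => //; lia.
have s5 : sw r q.+2 = q.+2 by rewrite /sw /r /=; do !case: eqP => //; lia.
have [-> ->] := HS u v (fun _ _ => erefl) (fun _ _ => erefl).
have [-> _] := HS _ v E (fun _ _ => erefl).
have [_ ->] := HS _ v E1 (fun _ _ => erefl).
have [_ ->] := HS _ v E2 (fun _ _ => erefl).
have [-> _] := HS _ v E3 (fun _ _ => erefl).
rewrite /= !(s1, s2, s3, s4, s5) -uq1 -uq2; ring.
Qed.

End Relations.

(** * Row operations and reordering of minors *)

Definition upd (X : Type) (f : nat -> X) (a : nat) (x : X) : nat -> X :=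
  fun i => if i == a then x else f i.

Lemma updE (X : Type) (f : nat -> X) a x : upd f a x a = x.
Proof. by rewrite /upd eqxx. Qed.

Lemma updN (X : Type) (f : nat -> X) a x i : i != a -> upd f a x i = f i.
Proof. by rewrite /upd => /negbTE->. Qed.

Section MoreMinors.
Variable T : comNzRingType.
Implicit Types (A : nat -> nat -> T) (u v : nat -> nat).

Definition rowop A (a b : nat) (t : T) : nat -> nat -> T :=
  fun i j => A i j + (if i == a then t * A b j else 0).

Definition colop A (a b : nat) (t : T) : nat -> nat -> T :=
  fun i j => A i j + (if j == a then t * A i b else 0).

Definition inj_below u r := forall i j, (i < r)%N -> (j < r)%N -> u i = u j -> i = j.

(** Linearity of the determinant in one row. *)
Lemma fminor_rowop A a b t u v r p : inj_below u r -> (p < r)%N -> u p = a ->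
  fminor (rowop A a b t) u v r = fminor A u v r + t * fminor A (upd u p b) v r.
Proof.
move=> ui pr up; rewrite -[X in X + _]mul1r.
apply: (determinant_multilinear (i0 := Ordinal pr)).
- by apply/rowP => j; rewrite !mxE /rowop /upd up !eqxx mul1r.
- apply/matrixP => i j; rewrite !mxE /rowop.
  case: eqP => [e|]; last by rewrite addr0.
  by have := ui _ _ (ltn_ord _) pr (etrans e (esym up)); rewrite /= /bump; lia.
- apply/matrixP => i j; rewrite !mxE /rowop updN; last first.
    by rewrite /= /bump; lia.
  case: eqP => [e|]; last by rewrite addr0.
  by have := ui _ _ (ltn_ord _) pr (etrans e (esym up)); rewrite /= /bump; lia.
Qed.

Lemma fminor_repeat A u v r p q : (p < r)%N -> (q < r)%N -> p != q -> u p = u q ->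
  fminor A u v r = 0.
Proof.
move=> pr qr pq e; apply: (@determinant_alternate _ _ _ (Ordinal pr) (Ordinal qr)).
  by rewrite -val_eqE.
by move=> j; rewrite !mxE e.
Qed.

(** Linearity in the last row, followed by an expansion along it. *)
Lemma fminor_corner A u v r c : inj_below u r.+1 -> inj_below v r.+1 ->
  fminor (fun i j => A i j + (if (i == u r) && (j == v r) then c else 0)) u v r.+1
  = fminor A u v r.+1 + c * fminor A u v r.
Proof.
move=> ui vi; pose M := \matrix_(i < r, j < r) A (u i) (v j).
pose C : 'M[T]_(r.+1) := \matrix_(i, j) if (i == r :> nat) then (j == r :> nat)%:R
   else A (u i) (v j).
have -> : fminor A u v r = \det C.
  have -> : \det C = \det (block_mx M (\matrix_(i < r, j < 1) A (u i) (v r)) 0 (1%:M : 'M_1)).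
    move: @C; rewrite -addn1 => C; congr (\det _).
    apply/matrixP => i j; rewrite !mxE.
    have lr (h : 'I_r) : (h == r :> nat) = false by have := ltn_ord h; lia.
    by case: splitP => i' ei; rewrite !mxE; case: splitP => j' ej; rewrite /M !mxE ei ej
       ?ord1 ?lr ?addn0 ?eqxx //=; case: eqP; have := ltn_ord j'; lia.
  by rewrite det_ublock det1 mulr1.
rewrite -[X in X + _]mul1r.
apply: (determinant_multilinear (i0 := ord_max)).
- apply/rowP => j; rewrite !mxE /= !eqxx mul1r /=; congr (_ + _).
  case: (eqVneq (j : nat) r) => [->|jr]; first by rewrite eqxx mulr1.
  case: eqP => [/vi e|_]; last by rewrite mulr0.
  by move: jr; rewrite e ?eqxx.
- apply/matrixP => i j; rewrite !mxE /=.
  case: eqP => [/ui e|]; last by rewrite addr0.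
  have ir : (i < r)%N := ltn_ord i.
  have br : bump r i = i by rewrite /bump; lia.
  by have := e; rewrite br => /(_ (leqW ir) (leqnn _)); lia.
- apply/matrixP => i j; rewrite !mxE /=.
  have ir : (i < r)%N := ltn_ord i.
  have br : bump r i = i by rewrite /bump; lia.
  rewrite br ltn_eqF //.
  case: eqP => [/ui e|]; last by rewrite addr0.
  by have := e (leqW ir) (leqnn _); lia.
Qed.

Lemma fminor_perm A u u' v r (t : 'S_r) :
  (forall i : 'I_r, u' i = u (t i)) ->
  fminor A u' v r = (-1) ^+ t * fminor A u v r.
Proof.
move=> uu; rewrite /fminor.
have -> : \matrix_(i < r, j < r) A (u' i) (v j) =
   row_perm t (\matrix_(i < r, j < r) A (u i) (v j)).
  by apply/matrixP => i j; rewrite !mxE /= uu.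
by rewrite row_permE det_mulmx det_perm.
Qed.

(** Both listings being injective, this means that u and u' list the same set
    in their first r places. *)
Definition same_prefix u u' r :=
  forall i, (i < r)%N -> exists2 j, (j < r)%N & u' i = u j.

Lemma same_prefix_perm u u' r : inj_below u' r -> same_prefix u u' r ->
  exists t : 'S_r, forall i : 'I_r, u' i = u (t i).
Proof.
move=> ui h.
have h' (i : 'I_r) : exists j : 'I_r, u' i == u j.
  by have [j jr /eqP e] := h i (ltn_ord i); exists (Ordinal jr).
pose f i := xchoose (h' i).
have fE (i : 'I_r) : u' i = u (f i) by apply/eqP/(xchooseP (h' i)).
have fi : injective f.
  by move=> i j e; apply/val_inj/(ui _ _ (ltn_ord i) (ltn_ord j)); rewrite !fE e.
by exists (perm fi) => i; rewrite permE.
Qed.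

Lemma fminor_tr A u v r : fminor (fun i j => A j i) u v r = fminor A v u r.
Proof.
rewrite /fminor -det_tr.
by congr (\det _); apply/matrixP => i j; rewrite !mxE.
Qed.

Lemma sminor_same_prefix A u u' v v' r : inj_below u' r -> inj_below v' r ->
  same_prefix u u' r -> same_prefix v v' r ->
  exists b : bool, sminor A u' v' r = (-1) ^+ b * sminor A u v r.
Proof.
move=> ui vi /(same_prefix_perm ui)[s sE] /(same_prefix_perm vi)[t tE].
have E : fminor A u' v' r = (-1) ^+ s * ((-1) ^+ t * fminor A u v r).
  rewrite (fminor_perm A v' sE); congr (_ * _).
  by rewrite -!(fminor_tr A) (fminor_perm _ u tE).
exists (odd (pair_count gtr u' r + pair_count gtr v' r + s + t + pair_count gtr u r + pair_count gtr v r)).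
rewrite /sminor E signr_odd !mulrA -!exprD.
congr (_ * _); rewrite -signr_odd -[RHS]signr_odd; congr (_ ^+ nat_of_bool _).
rewrite !oddD; do !case: (odd _) => //.
Qed.

End MoreMinors.

(** * Mutation of pairs of full rank *)

(** Polynomials are generated by constants and variables under sum and product. *)
Lemma mpoly_closure (K : comNzRingType) m (good : {mpoly K[m]} -> Prop) :
  (forall c, good c%:MP) -> (forall i, good 'X_i) ->
  (forall p q, good p -> good q -> good (p + q)) ->
  (forall p q, good p -> good q -> good (p * q)) -> forall p, good p.
Proof.
move=> gC gX gD gM p; elim/mpolyind: p => [|c m' p _ _ IH].
  by rewrite -mpolyC0; apply: (@gC).
apply: (@gD) => //; rewrite -mul_mpolyC; apply: (@gM); first exact: (@gC).
rewrite mpolyXE_id; apply: (big_ind good) => [||i _]; [exact: (@gC) | exact: (@gM) |].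
elim: (m' i) => [|d IHd]; first exact: (@gC).
by rewrite exprS; apply: (@gM).
Qed.

Definition pos_part (a : int) : nat := if 0 < a then `|a|%N else 0%N.

(** The quotient by 2 is an exact one: in terms of positive parts the matrix
    mutation has this subtraction-free form, which is used throughout. *)
Lemma mutation_term (a b : int) :
  ((`|a| * b + a * `|b|) %/ 2)%Z =
  (pos_part a)%:Z * (pos_part b)%:Z - (pos_part (- a))%:Z * (pos_part (- b))%:Z.
Proof.
have E (X c : int) : X = c + c -> (X %/ 2)%Z = c.
  by move=> ->; rewrite (_ : c + c = c * 2) ?mulzK //; ring.
apply: E; rewrite /pos_part !oppr_gt0.
by case: (ltgtP a 0) => [a0|a0|->]; case: (ltgtP b 0) => [b0|b0|->];
  rewrite ?abszE ?normr0 ?(ltr0_norm a0) ?(ltr0_norm b0) ?(gtr0_norm a0)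
    ?(gtr0_norm b0) ?normrN ?(ltr0_norm a0) ?(ltr0_norm b0); ring.
Qed.

Lemma pos_partB (a : int) : (pos_part a)%:Z - (pos_part (- a))%:Z = a.
Proof. by rewrite /pos_part oppr_gt0; case: (ltgtP a 0) => h; lia. Qed.

Section Mutation.
Variables (F : fieldType) (n p : nat).
Implicit Types (S : labeled_pair F n p) (l : 'I_n).
Local Notation N := (n + p)%N.

(** The two monomials of the exchange relation at l, as products over all
    indices. *)
Definition col_plus S l := \prod_(h : 'I_N) ext_cluster S h ^+ pos_part (ext_mx S h l).
Definition col_minus S l := \prod_(h : 'I_N) ext_cluster S h ^+ pos_part (- ext_mx S h l).

Lemma mutate_at S l :
  ext_cluster (mutate S l) (lshift p l) =
  (col_plus S l + col_minus S l) / ext_cluster S (lshift p l).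
Proof.
rewrite /= eqxx; congr ((_ + _) / _).
  rewrite big_mkcond; apply: eq_bigr => h _; rewrite /pos_part.
  by case: ifP.
rewrite big_mkcond; apply: eq_bigr => h _; rewrite /pos_part oppr_gt0 abszN.
by case: ifP.
Qed.

Lemma mutate_off S l i : i != lshift p l ->
  ext_cluster (mutate S l) i = ext_cluster S i.
Proof. by rewrite /= => /negbTE->. Qed.

Lemma mutate_mxE S l i j :
  ext_mx (mutate S l) i j =
  if (i == lshift p l) || (j == l) then - ext_mx S i j
  else ext_mx S i j + ((pos_part (ext_mx S i l))%:Z * (pos_part (ext_mx S (lshift p l) j))%:Z
     - (pos_part (- ext_mx S i l))%:Z * (pos_part (- ext_mx S (lshift p l) j))%:Z).
Proof. by rewrite /= mxE; case: ifP => // _; rewrite mutation_term. Qed.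

Definition skew_top S :=
  forall i j : 'I_n, ext_mx S (lshift p i) j = - ext_mx S (lshift p j) i.

Lemma skew_diag S l : skew_top S -> ext_mx S (lshift p l) l = 0.
Proof. by move=> /(_ l l); lia. Qed.

Lemma skew_mutate S l : skew_top S -> skew_top (mutate S l).
Proof.
move=> sk i j; rewrite !mutate_mxE !(inj_eq (@lshift_inj _ _)) orbC.
case: ifP => [_|_]; first by rewrite sk.
rewrite (sk i j) (sk i l) (sk j l) !opprK; ring.
Qed.

(** The columns of the exchange matrix are linearly independent. *)
Definition full_rank S := forall w : 'I_n -> int,
  (forall i, \sum_j ext_mx S i j * w j = 0) -> forall j, w j = 0.

Lemma pair_ext S S' : ext_cluster S =1 ext_cluster S' ->
  ext_mx S =2 ext_mx S' -> S = S'.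
Proof.
by case: S S' => [x B] [x' B'] /= /funext -> /matrixP ->.
Qed.

Lemma mutateK S l : skew_top S -> ext_cluster S (lshift p l) != 0 ->
  ext_cluster (mutate S l) (lshift p l) != 0 ->
  mutate (mutate S l) l = S.
Proof.
move=> sk x0 x1; have Bll := skew_diag l sk; apply: pair_ext => i; last first.
  move=> j; rewrite !mutate_mxE !eqxx !orbT /=.
  have [il|il] := eqVneq i (lshift p l); first by rewrite opprK.
  by have [->|jl] := eqVneq j l; rewrite /= ?opprK //; ring.
have [->|il] := eqVneq i (lshift p l); last by rewrite !mutate_off.
rewrite mutate_at.
have E h : ext_mx (mutate S l) h l = - ext_mx S h l.
  by rewrite mutate_mxE eqxx orbT.
have -> : col_plus (mutate S l) l = col_minus S l.
  apply: eq_bigr => h _; rewrite E; case: (eqVneq h (lshift p l)) => [->|hl].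
    by rewrite Bll oppr0 !expr0.
  by rewrite mutate_off.
have -> : col_minus (mutate S l) l = col_plus S l.
  apply: eq_bigr => h _; rewrite E opprK; case: (eqVneq h (lshift p l)) => [->|hl].
    by rewrite Bll !expr0.
  by rewrite mutate_off.
apply: (mulIf x1); rewrite divfK // mutate_at mulrC divfK // addrC //.
Qed.

(** A linear relation w between the columns of the mutated matrix gives one
    between the columns of B: only the coefficient of the mutated column
    changes, into c - w l.  The row l of the relation says that the positive and
    the negative parts of the row l contribute the same amount c. *)
Lemma full_rank_mutate S l : skew_top S -> full_rank S -> full_rank (mutate S l).
Proof.
move=> sk fr w hw.
have Bll := skew_diag l sk.
pose c := \sum_j (pos_part (ext_mx S (lshift p l) j))%:Z * w j.
pose w' j := if j == l then c - w l else w j.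
have h0 : \sum_j ext_mx S (lshift p l) j * w j = 0.
  have := hw (lshift p l); under eq_bigr do rewrite mutate_mxE eqxx /= mulNr.
  by rewrite sumrN => /eqP; rewrite oppr_eq0 => /eqP.
have cE : c = \sum_j (pos_part (- ext_mx S (lshift p l) j))%:Z * w j.
  apply/eqP; rewrite -subr_eq0 -sumrB -{2}h0; apply/eqP; apply: eq_bigr => j _.
  by rewrite -mulrBl pos_partB.
have w'0 : forall j, w' j = 0.
  apply: fr => i; have [->|il] := eqVneq i (lshift p l).
    rewrite (bigD1 l) //= Bll mul0r add0r -{2}h0 [RHS](bigD1 l) //= Bll mul0r add0r.
    by apply: eq_bigr => j /negbTE jl; rewrite /w' jl.
  have := hw i; rewrite (bigD1 l) //= mutate_mxE eqxx orbT.
  under eq_bigr => j jl do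
    rewrite mutate_mxE (negbTE il) (negbTE jl) /= mulrDl mulrBl -!mulrA.
  rewrite big_split /= sumrB -!mulr_sumr.
  have -> : \sum_(j | j != l) (pos_part (ext_mx S (lshift p l) j))%:Z * w j = c.
    by rewrite /c [RHS](bigD1 l) //= Bll mul0r add0r.
  have -> : \sum_(j | j != l) (pos_part (- ext_mx S (lshift p l) j))%:Z * w j = c.
    by rewrite cE [RHS](bigD1 l) //= Bll oppr0 mul0r add0r.
  move=> hi; rewrite (bigD1 l) //= /w' eqxx -[RHS]hi.
  rewrite (eq_bigr (fun j => ext_mx S i j * w j)) => [|j /negbTE -> //].
  by have := pos_partB (ext_mx S i l); set a := pos_part _; set b := pos_part _ => <-; ring.
move=> j; have := w'0 j; rewrite /w'; case: eqP => [->|//].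
suff -> : c = 0 by rewrite sub0r => /eqP; rewrite oppr_eq0 => /eqP.
rewrite /c big1 // => j' _; have := w'0 j'; rewrite /w'.
case: eqP => [->|_ ->]; last by rewrite mulr0.
by rewrite Bll mul0r.
Qed.

(** Changing the sign of the matrix exchanges the two monomials and commutes with
    mutations; it reduces a sign condition on one entry to the other one. *)
Definition opposite S := LabeledPair (ext_cluster S) (- ext_mx S).

Lemma mutate_neg S l : mutate (opposite S) l = opposite (mutate S l).
Proof.
apply: pair_ext => [i|i j].
  have [->|il] := eqVneq i (lshift p l); last by rewrite !mutate_off.
  rewrite mutate_at [RHS]mutate_at addrC; congr ((_ + _) / _).
    by apply: eq_bigr => h _; rewrite /= mxE opprK.
  by apply: eq_bigr => h _; rewrite /= mxE.
by rewrite mutate_mxE [RHS]mxE mutate_mxE /= !mxE; case: ifP => // _; rewrite !opprK; ring.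
Qed.

End Mutation.

(** * Algebraic independence and Laurent polynomials *)

Section AlgIndep.
Variables (K F : fieldType) (iota : {rmorphism K -> F}).

Lemma indep_neq0 m (x : 'I_m -> F) i : alg_independent iota x -> x i != 0.
Proof.
move=> ind; apply/eqP => x0.
have /ind/(congr1 (fun q : {mpoly K[m]} => q@_(U_(i)))) : mmap iota x 'X_i = 0 by rewrite mmapX mmap1U.
by rewrite mcoeffXU eqxx mcoeff0 => /eqP; rewrite oner_eq0.
Qed.

(** After multiplication by a power of x l, the value f(x') is a polynomial g in
    x; as the exchange relation is symmetric, g(x') is then f(x) times a power of
    x' l.  If f(x') = 0 then g = 0, hence f(x) = 0. *)
Lemma indep_exchange m (x x' : 'I_m -> F) l (P : {mpoly K[m]}) :
  alg_independent iota x -> (forall i, i != l -> x' i = x i) ->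
  x l * x' l = mmap iota x P -> mmap iota x' P = mmap iota x P ->
  mmap iota x P != 0 -> alg_independent iota x'.
Proof.
move=> ind off at_l PE P0 f f0.
have [xl0 xl0'] : x l != 0 /\ x' l != 0.
  by move: P0; rewrite -at_l mulf_eq0 negb_or => /andP.
suff [d [g [E1 E2]]] : exists d g, mmap iota x g = x l ^+ d * mmap iota x' f /\
    mmap iota x' g = x' l ^+ d * mmap iota x f.
  apply: (ind); move: E1; rewrite f0 mulr0 => /ind g0.
  move: E2; rewrite g0 mmap0 => /esym/eqP; rewrite mulf_eq0 expf_eq0 (negbTE xl0') andbF /=.
  by move/eqP.
elim/mpoly_closure: f {f0} => [c|i|f1 f2 [d1 [g1 [a1 b1]]] [d2 [g2 [a2 b2]]]|f1 f2 [d1 [g1 [a1 b1]]] [d2 [g2 [a2 b2]]]].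
- by exists 0%N, c%:MP; rewrite !mmapC !mul1r.
- have [->|il] := eqVneq i l.
    exists 1%N, P; rewrite PE !mmapX !mmap1U !expr1 at_l; split => //.
    by rewrite -at_l mulrC.
  by exists 0%N, 'X_i; rewrite !mmapX !mmap1U !mul1r off.
- exists (d1 + d2)%N, ('X_l ^+ d2 * g1 + 'X_l ^+ d1 * g2).
  rewrite !(rmorphD, rmorphM, rmorphXn) /= !mmapX !mmap1U a1 a2 b1 b2 !exprD.
  by split; ring.
- exists (d1 + d2)%N, (g1 * g2).
  rewrite !(rmorphD, rmorphM, rmorphXn) /= a1 a2 b1 b2 !exprD.
  by split; ring.
Qed.

Variables (n p : nat).
Implicit Types (S : labeled_pair F n p) (l : 'I_n).

Definition exch_poly S l : {mpoly K[n + p]} :=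
  \prod_h 'X_h ^+ pos_part (ext_mx S h l) + \prod_h 'X_h ^+ pos_part (- ext_mx S h l).

Lemma exch_poly_eval S l (y : 'I_(n + p) -> F) : mmap iota y (exch_poly S l) =
  \prod_h y h ^+ pos_part (ext_mx S h l) + \prod_h y h ^+ pos_part (- ext_mx S h l).
Proof.
rewrite rmorphD !rmorph_prod /=; congr (_ + _); apply: eq_bigr => h _;
  by rewrite rmorphXn /= mmapX mmap1U.
Qed.

(** At the point with all coordinates 1 the value is 2. *)
Lemma exch_poly_neq0 S l : 2%:R != 0 :> K -> exch_poly S l != 0.
Proof.
apply: contraNneq => /(congr1 (meval (fun _ => 1))); rewrite meval0 => <-.
rewrite mevalD !rmorph_prod /= !big1 // => h _; rewrite rmorphXn /= mevalXU expr1n //.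
Qed.

(** The hypotheses under which the Laurent phenomenon is established. *)
Definition regular_seed S :=
  [/\ alg_independent iota (ext_cluster S), skew_top S & full_rank S].

Hypothesis K2 : 2%:R != 0 :> K.

Lemma exch_poly_neq0_eval S l : alg_independent iota (ext_cluster S) ->
  mmap iota (ext_cluster S) (exch_poly S l) != 0.
Proof.
move=> ind; have := exch_poly_neq0 S l K2; by apply: contraNneq => /ind->.
Qed.

Lemma mutate_atE S l : mmap iota (ext_cluster S) (exch_poly S l)
  = col_plus S l + col_minus S l.
Proof. exact: exch_poly_eval. Qed.

Lemma regular_mutate S l : regular_seed S -> regular_seed (mutate S l).
Proof.
case=> ind sk fr; split; [|exact: skew_mutate|exact: full_rank_mutate].
have x0 := indep_neq0 (lshift p l) ind.
apply: (indep_exchange (P := exch_poly S l) (l := lshift p l) ind).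
- exact: mutate_off.
- by rewrite mutate_at mutate_atE mulrC divfK.
- rewrite !exch_poly_eval; congr (_ + _); apply: eq_bigr => h _.
    have [->|hl] := eqVneq h (lshift p l); first by rewrite skew_diag // !expr0.
    by rewrite mutate_off.
  have [->|hl] := eqVneq h (lshift p l); first by rewrite skew_diag // oppr0 !expr0.
  by rewrite mutate_off.
- exact: exch_poly_neq0_eval.
Qed.

Lemma regular_foldl S ls : regular_seed S -> regular_seed (foldl (@mutate F n p) S ls).
Proof. by elim: ls S => //= l ls IH S /(regular_mutate l)/IH. Qed.

Lemma regular_mutateK S l : regular_seed S -> mutate (mutate S l) l = S.
Proof.
move=> rS; have [ind' _ _] := regular_mutate l rS; case: rS => ind sk _.
by apply: mutateK => //; apply: indep_neq0; eassumption.
Qed.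

Lemma foldl_mutateK S ls : regular_seed S ->
  foldl (@mutate F n p) (foldl (@mutate F n p) S ls) (rev ls) = S.
Proof.
elim: ls S => //= l ls IH S rS.
rewrite rev_cons foldl_rcons IH ?regular_mutateK //; exact: regular_mutate.
Qed.

Lemma regular_neg S : regular_seed S -> regular_seed (opposite S).
Proof.
case=> ind sk fr; split=> // [i j|w hw]; first by rewrite /= !mxE sk.
apply: fr => i; have := hw i; under eq_bigr do rewrite mxE mulNr.
by rewrite sumrN => /eqP; rewrite oppr_eq0 => /eqP.
Qed.

End AlgIndep.

Section LaurentRing.
Variables (K F : fieldType) (iota : {rmorphism K -> F}) (m : nat).
Implicit Types (x y : 'I_m -> F).

(** The Laurent polynomials in the x_i, as a subring of F. *)
Inductive laurent x : F -> Prop :=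
| laurent_scalar c : laurent x (iota c)
| laurent_var i : laurent x (x i)
| laurent_inv i : laurent x (x i)^-1
| laurentD a b : laurent x a -> laurent x b -> laurent x (a + b)
| laurentM a b : laurent x a -> laurent x b -> laurent x (a * b).

Lemma laurent1 x : laurent x 1.
Proof. by rewrite -(rmorph1 iota); apply: laurent_scalar. Qed.

Lemma laurent0 x : laurent x 0.
Proof. by rewrite -(rmorph0 iota); apply: laurent_scalar. Qed.

Lemma laurentN x a : laurent x a -> laurent x (- a).
Proof.
move=> ha; rewrite -mulN1r; apply: laurentM => //.
by rewrite -(rmorphN1 iota); apply: laurent_scalar.
Qed.

Lemma laurentB x a b : laurent x a -> laurent x b -> laurent x (a - b).
Proof. by move=> ha /laurentN; apply: laurentD. Qed.

Lemma laurentX x a d : laurent x a -> laurent x (a ^+ d).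
Proof.
move=> ha; elim: d => [|d IH]; first exact: laurent1.
by rewrite exprS; apply: laurentM.
Qed.

Lemma laurent_nat x d : laurent x d%:R.
Proof. by rewrite -(rmorph_nat iota); apply: laurent_scalar. Qed.

Lemma laurent_sum x (I : Type) (r : seq I) (P : pred I) (f : I -> F) :
  (forall i, P i -> laurent x (f i)) -> laurent x (\sum_(i <- r | P i) f i).
Proof. by move=> h; apply: big_ind => // [|a b]; [exact: laurent0|exact: laurentD]. Qed.

Definition unit_laurent x a := [/\ a != 0, laurent x a & laurent x a^-1].

Lemma unit_laurentM x a b : unit_laurent x a -> unit_laurent x b -> unit_laurent x (a * b).
Proof.
case=> a0 la la' [b0 lb lb']; split; first by rewrite mulf_neq0.
  exact: laurentM.
by rewrite invfM; apply: laurentM.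
Qed.

Lemma unit_laurentV x a : unit_laurent x a -> unit_laurent x a^-1.
Proof. by case=> a0 la la'; split; rewrite ?invr_eq0 ?invrK. Qed.

Lemma unit_laurentX x a d : unit_laurent x a -> unit_laurent x (a ^+ d).
Proof.
by case=> a0 la la'; split; rewrite ?expf_neq0 // -?exprVn; apply: laurentX.
Qed.

Lemma unit_laurent_mon x (P : pred 'I_m) (e : 'I_m -> nat) : (forall i, x i != 0) ->
  unit_laurent x (\prod_(i | P i) x i ^+ e i).
Proof.
move=> x0; apply: big_ind => [||i _].
- by split; rewrite ?oner_neq0 ?invr1 //; apply: laurent1.
- exact: unit_laurentM.
- by apply: unit_laurentX; split=> //; [apply: laurent_var | apply: laurent_inv].
Qed.

Definition laurent_dvd x a b := exists2 e, laurent x e & b = a * e.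

(** a is not a zero divisor modulo z in the ring of Laurent polynomials. *)
Definition laurent_coprime x z a :=
  forall c, laurent x c -> laurent_dvd x z (a * c) -> laurent_dvd x z c.

Lemma laurent_coprimeM x z a b : laurent x b -> laurent_coprime x z a ->
  laurent_coprime x z b -> laurent_coprime x z (a * b).
Proof. by move=> lb ca cb c lc; rewrite -mulrA => /ca-/(_ (laurentM lb lc))/cb; apply. Qed.

Lemma laurent_coprimeX x z a d : laurent x a -> laurent_coprime x z a ->
  laurent_coprime x z (a ^+ d).
Proof.
move=> la ca; elim: d => [|d IH]; first by move=> c lc; rewrite mul1r.
by rewrite exprS; apply: laurent_coprimeM => //; apply: laurentX.
Qed.

(** A fraction with the two denominators a and z ^+ d, where a is coprime to z,
    has no denominator. *)
Lemma laurent_coprime_cancel x z a d w : z != 0 -> laurent x z ->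
  laurent_coprime x z a -> laurent x (a * w) -> laurent x (z ^+ d * w) -> laurent x w.
Proof.
move=> z0 lz ca law; elim: d => [|d IH]; first by rewrite mul1r.
rewrite exprS => lzw; apply: IH.
have [|e le] := ca _ lzw.
  by exists (z ^+ d * (a * w)); [apply: laurentM => //; apply: laurentX | ring].
by rewrite -mulrA => /(mulfI z0) ->.
Qed.

(** A Laurent polynomial in y is a polynomial in the y_i and their inverses;
    each of these becomes Laurent in x after multiplication by w. *)
Lemma laurent_change x y w a : laurent x w ->
  (forall i, laurent x (y i)) -> (forall i, laurent x (w * (y i)^-1)) ->
  laurent y a -> exists d, laurent x (w ^+ d * a).
Proof.
move=> lw ly ly'; elim=> [c|i|i|a1 a2 _ [d1 h1] _ [d2 h2]|a1 a2 _ [d1 h1] _ [d2 h2]].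
- by exists 0%N; rewrite mul1r; apply: laurent_scalar.
- by exists 0%N; rewrite mul1r.
- by exists 1%N; rewrite expr1.
- exists (d1 + d2)%N.
  have -> : w ^+ (d1 + d2) * (a1 + a2) =
     w ^+ d2 * (w ^+ d1 * a1) + w ^+ d1 * (w ^+ d2 * a2) by rewrite exprD; ring.
  by apply: laurentD; apply: laurentM => //; apply: laurentX.
- exists (d1 + d2)%N.
  have -> : w ^+ (d1 + d2) * (a1 * a2) =
     (w ^+ d1 * a1) * (w ^+ d2 * a2) by rewrite exprD; ring.
  by apply: laurentM.
Qed.

End LaurentRing.

(** * Gradings of the ring of Laurent polynomials *)

(** M stands for a module over the coefficients in which a is invertible: the
    coefficients of g are recovered one after the other from the top. *)
Lemma coef_two_terms (F : fieldType) (M : F -> Prop) (a b : F) w (g : {poly F}) :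
  (0 < w)%N -> a != 0 -> (forall c, M c -> M (a^-1 * c)) ->
  (forall c, M c -> M (b * c)) -> (forall c d, M c -> M d -> M (c - d)) -> M 0 ->
  (forall i, M ((a *: 'X^w + b%:P) * g)`_i) -> forall i, M g`_i.
Proof.
move=> w0 a0 Ma Mb MB M0 h i.
have [d] : exists d, (size g <= i + d)%N by exists (size g); lia.
elim/ltn_ind: d i => d IH i; case: (leqP (size g) i) => [gi _|ig sz].
  by rewrite nth_default.
have := h (i + w)%N; rewrite mulrDl coefD -scalerAl coefZ coefXnM.
rewrite coefCM ifF ?addnK; last by lia.
move=> /MB/(_ (Mb _ (IH (d - 1)%N _ (i + w)%N _))); rewrite addrK => H.
have /Ma := H ltac:(lia) ltac:(lia).
by rewrite mulKf.
Qed.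

Section Grading.
Variables (K F : fieldType) (iota : {rmorphism K -> F}) (m : nat).
Variables (x : 'I_m -> F) (lambda : 'I_m -> int).
Hypothesis ind : alg_independent iota x.
Variables (FT : fieldType) (inc : {rmorphism {poly F} -> FT}).
Hypothesis inc_inj : injective inc.
Local Notation t := (inc 'X).
Local Notation const c := (inc c%:P).
Local Notation laur := (laurent iota x).

Lemma t_neq0 : t != 0 :> FT.
Proof. by rewrite -(rmorph0 inc) (inj_eq inc_inj) polyX_eq0. Qed.

(** The substitution of x_i t^(lambda i) for the i-th variable; it makes the
    grading of the Laurent polynomials by lambda visible as the degree in t. *)
Definition theta : {mpoly K[m]} -> FT :=
  mmap (inc \o (@polyC F \o iota)) (fun i => const (x i) * t ^ lambda i).

HB.instance Definition _ := GRing.RMorphism.on theta.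

Let mmapM_ : {morph mmap iota x : f g / f * g}. Proof. exact: rmorphM. Qed.
Lemma thetaD : {morph theta : f g / f + g}. Proof. exact: rmorphD. Qed.
Lemma thetaM : {morph theta : f g / f * g}. Proof. exact: rmorphM. Qed.

(** th is the image of c under the embedding of K(x) in F(t) that maps x_i to
    x_i t^(lambda i).  A relation, because K(x) is not given as a type. *)
Definition tlift (c : F) (th : FT) := exists f g,
  [/\ mmap iota x g != 0, theta g != 0, c * mmap iota x g = mmap iota x f
    & th * theta g = theta f].

Lemma tlift_uniq c th th' : tlift c th -> tlift c th' -> th = th'.
Proof.
move=> [f [g [g0 tg0 E1 E2]]] [f' [g' [g0' tg0' E1' E2']]].
apply: (mulIf tg0); apply: (mulIf tg0'); rewrite E2 mulrAC E2'.
rewrite -!thetaM; congr theta; apply/eqP; rewrite -subr_eq0; apply/eqP/ind.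
by rewrite mmapB !mmapM_ -E1 -E1'; ring.
Qed.

Lemma tlift_mpoly f : tlift (mmap iota x f) (theta f).
Proof. by exists f, 1; rewrite !rmorph1 !mulr1 !oner_neq0. Qed.

Lemma tlift_scalar c : tlift (iota c) (const (iota c)).
Proof. by have := tlift_mpoly c%:MP; rewrite mmapC /theta mmapC. Qed.

Lemma tlift_var i : tlift (x i) (const (x i) * t ^ lambda i).
Proof. by have := tlift_mpoly 'X_i; rewrite mmapX mmap1U /theta mmapX mmap1U. Qed.

Lemma tliftD a b tha thb : tlift a tha -> tlift b thb -> tlift (a + b) (tha + thb).
Proof.
move=> [f [g [g0 tg0 E1 E2]]] [f' [g' [g0' tg0' E1' E2']]].
exists (f * g' + f' * g), (g * g').
rewrite thetaD !thetaM mmapD !mmapM_ !mulf_neq0 //; split=> //.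
  by rewrite -E1 -E1'; ring.
by rewrite -E2 -E2'; ring.
Qed.

Lemma tliftM a b tha thb : tlift a tha -> tlift b thb -> tlift (a * b) (tha * thb).
Proof.
move=> [f [g [g0 tg0 E1 E2]]] [f' [g' [g0' tg0' E1' E2']]].
exists (f * f'), (g * g').
rewrite !thetaM !mmapM_ !mulf_neq0 //; split=> //.
  by rewrite -E1 -E1'; ring.
by rewrite -E2 -E2'; ring.
Qed.

Lemma tliftV a th : a != 0 -> th != 0 -> tlift a th -> tlift a^-1 th^-1.
Proof.
move=> a0 th0 [f [g [g0 tg0 E1 E2]]]; exists g, f.
by rewrite -E1 -E2 !mulf_neq0 //; split=> //; rewrite mulKf.
Qed.

(** Homogeneous elements of degree w for the grading by lambda. *)
Definition has_weight (c : F) (w : int) := tlift c (const c * t ^ w).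

Lemma const_neq0 c : (const c != 0) = (c != 0).
Proof. by rewrite -(rmorph0 inc) (inj_eq inc_inj) polyC_eq0. Qed.

Lemma constM a b : const (a * b) = const a * const b.
Proof. by rewrite polyCM rmorphM. Qed.

Lemma constV a : const a^-1 = (const a)^-1.
Proof.
have [->|a0] := eqVneq a 0; first by rewrite invr0 polyC0 rmorph0 invr0.
by apply: (mulfI (_ : const a != 0)); rewrite ?const_neq0 // -constM !divff ?const_neq0 // polyC1 rmorph1.
Qed.

Lemma weight_scalar c : has_weight (iota c) 0.
Proof. by rewrite /has_weight expr0z mulr1; apply: tlift_scalar. Qed.

Lemma weight1 : has_weight 1 0.
Proof. by have := weight_scalar 1; rewrite rmorph1. Qed.

Lemma weightM a b v w : has_weight a v -> has_weight b w -> has_weight (a * b) (v + w).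
Proof.
move=> ha hb; rewrite /has_weight constM (expfzDr _ _ t_neq0) mulrACA.
exact: tliftM.
Qed.

Lemma weightV a v : a != 0 -> has_weight a v -> has_weight a^-1 (- v).
Proof.
move=> a0 ha; rewrite /has_weight constV -invr_expz -invfM.
apply: tliftV => //; rewrite mulf_neq0 ?const_neq0 //; apply: expfz_neq0; exact: t_neq0.
Qed.

Lemma weightX a v d : has_weight a v -> has_weight (a ^+ d) (v * d%:Z).
Proof.
move=> ha; elim: d => [|d IH]; first by rewrite mulr0 expr0; apply: weight1.
by rewrite exprS intS mulrDr mulr1; apply: weightM.
Qed.

Lemma weight_mon (P : pred 'I_m) (e : 'I_m -> nat) :
  has_weight (\prod_(i | P i) x i ^+ e i) (\sum_(i | P i) lambda i * (e i)%:Z).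
Proof.
apply: (big_ind2 has_weight) => [|a v b w|i _]; first exact: weight1.
- exact: weightM.
- by apply: weightX; apply: tlift_var.
Qed.

(** The lift multiplies each variable by a power of t, so the coefficients stay
    Laurent polynomials in x, and t = 1 recovers c.  The factor t ^+ d makes the
    lift a polynomial in t. *)
Lemma laurent_lift c : laur c -> exists d g th,
  [/\ tlift c th, t ^+ d * th = inc g, forall i, laur g`_i & g.[1] = c].
Proof.
elim=> [a|i|i|a b _ [d1 [g1 [th1 [l1 e1 c1 v1]]]] _ [d2 [g2 [th2 [l2 e2 c2 v2]]]]
  |a b _ [d1 [g1 [th1 [l1 e1 c1 v1]]]] _ [d2 [g2 [th2 [l2 e2 c2 v2]]]]].
- exists 0%N, (iota a)%:P, (const (iota a)); split; rewrite ?mul1r ?hornerC //.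
    exact: tlift_scalar.
  by move=> i; rewrite coefC; case: eqP => _; [apply: laurent_scalar|apply: laurent0].
- have [d [e de]] : exists d e : nat, d%:Z + lambda i = e%:Z.
    by exists `|lambda i|%N, (absz (`|lambda i|%N%:Z + lambda i)); lia.
  exists d, (x i *: 'X^e), (const (x i) * t ^ lambda i); split.
  + exact: tlift_var.
  + rewrite mulrCA exprnP -(expfzDr _ _ t_neq0) de -mul_polyC rmorphM rmorphXn //.
  + by move=> j; rewrite coefZ coefXn; case: eqP => _; rewrite ?mulr1 ?mulr0;
      [apply: laurent_var|apply: laurent0].
  + by rewrite hornerZ hornerXn expr1n mulr1.
- have [d [e de]] : exists d e : nat, d%:Z - lambda i = e%:Z.
    by exists `|lambda i|%N, (absz (`|lambda i|%N%:Z - lambda i)); lia.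
  have x0 := indep_neq0 i ind.
  exists d, ((x i)^-1 *: 'X^e), (const (x i)^-1 * t ^ (- lambda i)); split.
  + by apply: weightV => //; apply: tlift_var.
  + rewrite mulrCA exprnP -(expfzDr _ _ t_neq0) de -mul_polyC rmorphM rmorphXn //.
  + by move=> j; rewrite coefZ coefXn; case: eqP => _; rewrite ?mulr1 ?mulr0;
      [apply: laurent_inv|apply: laurent0].
  + by rewrite hornerZ hornerXn expr1n mulr1.
- exists (d1 + d2)%N, ('X^d2 * g1 + 'X^d1 * g2), (th1 + th2); split.
  + exact: tliftD.
  + by rewrite rmorphD !rmorphM !rmorphXn /= -e1 -e2 exprD; ring.
  + move=> i; rewrite coefD !coefXnM.
    by apply: laurentD; case: ifP => _ //; apply: laurent0.
  + by rewrite hornerD !hornerM !hornerXn !expr1n !mul1r v1 v2.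
- exists (d1 + d2)%N, (g1 * g2), (th1 * th2); split.
  + exact: tliftM.
  + by rewrite rmorphM /= -e1 -e2 exprD; ring.
  + by move=> i; rewrite coefM; apply: laurent_sum => j _; apply: laurentM.
  + by rewrite hornerM v1 v2.
Qed.

(** If P divides (a + b) c, then it divides every homogeneous component of the
    product, P being homogeneous.  As the leading component a of a + b is a unit,
    P divides the components of c, by [coef_two_terms]. *)
Lemma graded_coprime P w0 a b w1 w2 :
  has_weight P w0 -> unit_laurent iota x a -> has_weight a w1 -> laur b -> has_weight b w2 ->
  w2 < w1 -> laurent_coprime iota x P (a + b).
Proof.
move=> hP ua ha lb hb w12 c lc [d ld E].
have [n1 [g [th [l1 e1 c1 v1]]]] := laurent_lift lc.
have [n2 [h [th' [l2 e2 c2 v2]]]] := laurent_lift ld.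
have E' : (const a * t ^ w1 + const b * t ^ w2) * th = const P * t ^ w0 * th'.
  apply: (@tlift_uniq (P * d)); last exact: tliftM.
  by rewrite -E; apply: tliftM => //; apply: tliftD.
have [w wE] : exists w : nat, w%:Z = w1 - w2 by exists (absz (w1 - w2)); lia.
(* Powers of t that clear the negative exponents on both sides. *)
have [s [s' sE]] : exists s s' : nat, w2 - w0 + s'%:Z = s%:Z.
  by exists (absz (w2 - w0 + `|w2 - w0|%N%:Z)), `|w2 - w0|%N; lia.
have E2 : (a *: 'X^w + b%:P) * ('X^(n2 + s) * g) = P%:P * ('X^(n1 + s') * h).
  apply: inc_inj; rewrite -mul_polyC.
  rewrite !(rmorphM, rmorphD, rmorphXn) /= -e1 -e2.
  have -> : const a * t ^+ w + const b = (const a * t ^ w1 + const b * t ^ w2) * t ^ (- w2).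
    rewrite mulrDl -!mulrA -!(expfzDr _ _ t_neq0) addrN expr0z mulr1 -wE -exprnP //.
  have -> : t ^+ (n2 + s) = t ^+ n2 * t ^+ s' * t ^ w2 * t ^ (- w0).
    by rewrite !exprnP -!(expfzDr _ _ t_neq0); congr (_ ^ _); lia.
  have tw := mulVf (expfz_neq0 w2 t_neq0); have tw0 := mulVf (expfz_neq0 w0 t_neq0).
  rewrite invr_expz in tw; rewrite invr_expz in tw0.
  transitivity (((const a * t ^ w1 + const b * t ^ w2) * th) * (t ^ (- w2) * t ^ w2) *
     t ^+ n2 * t ^+ s' * t ^ (- w0) * t ^+ n1); first by ring.
  rewrite E' tw mulr1.
  transitivity (const P * (t ^ (- w0) * t ^ w0) * t ^+ n2 * t ^+ s' * t ^+ n1 * th').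
    by ring.
  by rewrite tw0 exprD; ring.
case: ua => a0 la la'.
have M : forall i, laurent_dvd iota x P ('X^(n2 + s) * g)`_i.
  apply: (@coef_two_terms _ _ a b w) => //.
  - lia.
  - by move=> _ [e le ->]; exists (a^-1 * e); [apply: laurentM | ring].
  - by move=> _ [e le ->]; exists (b * e); [apply: laurentM | ring].
  - by move=> _ _ [e le ->] [f lf ->]; exists (e - f); [apply: laurentB | ring].
  - by exists 0; [apply: laurent0 | rewrite mulr0].
  - move=> i; rewrite E2 coefCM; exists ('X^(n1 + s') * h)`_i => //.
    by rewrite coefXnM; case: ifP => _ //; apply: laurent0.
have : laurent_dvd iota x P ('X^(n2 + s) * g).[1].
  rewrite horner_coef; apply: big_ind => [|_ _ [e le ->] [f lf ->]|i _].
  - by exists 0; [apply: laurent0 | rewrite mulr0].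
  - by exists (e + f); [apply: laurentD | ring].
  - by rewrite expr1n mulr1.
by rewrite hornerM hornerXn expr1n mul1r v1.
Qed.

End Grading.

(** * The Laurent phenomenon *)

Section Chain.
Variables (K F : fieldType) (iota : {rmorphism K -> F}) (n p : nat).
Hypothesis K2 : 2%:R != 0 :> K.
Implicit Types (S : labeled_pair F n p).
Local Notation regular := (regular_seed iota).
Local Notation laur S := (laurent iota (ext_cluster S)).

(** Being coprime to z only depends on the class modulo z, and units are coprime
    to everything. *)
Lemma coprime_unit_mod (x : 'I_(n + p) -> F) z a g :
  unit_laurent iota x a -> laurent iota x g -> laurent_coprime iota x z (a + z * g).
Proof.
case=> a0 la la' lg c lc [d ld E]; exists (a^-1 * (d - g * c)).
  by apply: laurentM => //; apply: laurentB => //; apply: laurentM.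
have -> : z * (a^-1 * (d - g * c)) = a^-1 * (z * d - z * g * c) by ring.
by rewrite -E mulrDl addrK mulKf.
Qed.

(** The multiple z' differs from z by the unit w. *)
Lemma coprime_mod (x : 'I_(n + p) -> F) z z' a g w : laurent iota x w -> laurent iota x g ->
  z' = z * w -> w != 0 -> laurent iota x w^-1 ->
  laurent_coprime iota x z' a -> laurent_coprime iota x z (a + z * g).
Proof.
move=> lw lg -> w0 lw' co c lc [d ld E].
have [|e le ->] := co c lc; last by exists (w * e); [apply: laurentM | rewrite mulrA].
exists (w^-1 * (d - g * c)).
  by apply: laurentM => //; apply: laurentB => //; apply: laurentM.
rewrite -mulrA mulVKf // mulrBr -E; ring.
Qed.

Lemma binomial_remainder (x : 'I_(n + p) -> F) a w d :
  laurent iota x a -> laurent iota x w -> exists2 g, laurent iota x g &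
  (a + w) ^+ d.+1 = a ^+ d.+1 + d.+1%:R * a ^+ d * w + w ^+ 2 * g.
Proof.
move=> la lw; elim: d => [|d [g lg E]].
  by exists 0; [exact: laurent0 | rewrite !expr1 expr0; ring].
exists (d.+1%:R * a ^+ d + (a + w) * g).
  apply: laurentD; first by apply: laurentM; [apply: laurent_nat | apply: laurentX].
  by apply: laurentM => //; apply: laurentD.
rewrite exprS E -[d.+2%:R]natr1 [a ^+ d.+2]exprS [a ^+ d.+1]exprS; ring.
Qed.

(** A comparison of exponents: the positive part minus the negative part of the
    hypothesis.  It relates the monomials of three successive exchanges. *)
Lemma prod_posn_rel (I : finType) (P : pred I) (x : I -> F) (b2 b b1 : I -> int) a :
  (forall h, P h -> b2 h = - b h + (pos_part (b1 h))%:Z * a%:Z) ->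
  \prod_(h | P h) x h ^+ pos_part (b2 h) * \prod_(h | P h) x h ^+ pos_part (b h) =
  \prod_(h | P h) x h ^+ pos_part (- b2 h) * \prod_(h | P h) x h ^+ pos_part (- b h) *
  (\prod_(h | P h) x h ^+ pos_part (b1 h)) ^+ a.
Proof.
move=> bE; rewrite -!big_split -prodrXl -big_split /=; apply: eq_bigr => h Ph.
rewrite -exprM -!exprD; congr (_ ^+ _); have := bE h Ph.
have := pos_partB (b2 h); have := pos_partB (b h).
by rewrite -PoszM; move: (pos_part (b1 h) * a)%N => d; lia.
Qed.

Lemma subn2_twice a : (0 < a)%N -> (a + a - 2).+2 = (a + a)%N.
Proof. lia. Qed.

Lemma subn2_pred a : (0 < a)%N -> a != 1%N -> (a - 2).+1 = a.-1.
Proof. lia. Qed.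

(** The computation of v z from the exchange relations of z and u, with the
    power of u expanded to second order in z ^+ a. *)
Lemma third_mutation_identity (s q ua pp xa c ua1 um za g : F) : pp != 0 -> xa != 0 ->
  s * q * ua / pp + s * ((ua + c * ua1 * (um * za) + (um * za) ^+ 2 * g) / xa) =
  s / xa * ua / pp * (pp + q * xa) + s / xa * (c * ua1 * um) * za +
  s / xa * (um * za) ^+ 2 * g.
Proof. by move=> p0 x0; field; rewrite p0 x0. Qed.

Section Step.
Variables (S : labeled_pair F n p) (j k : 'I_n).
Hypothesis rS : regular S.
Hypothesis jk : j != k.
Local Notation x := (ext_cluster S).
Local Notation B := (ext_mx S).
Local Notation jj := (lshift p j).
Local Notation kk := (lshift p k).
Local Notation S1 := (mutate S j).
Local Notation S2 := (mutate S1 k).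
Local Notation S3 := (mutate S2 j).
Local Notation z := (ext_cluster S1 jj).
Local Notation u := (ext_cluster S2 kk).
Local Notation v := (ext_cluster S3 jj).

Let rS1 : regular S1 := regular_mutate K2 j rS.
Let rS2 : regular S2 := regular_mutate K2 k rS1.
Let rS3 : regular S3 := regular_mutate K2 j rS2.

Let x0 i : x i != 0.
Proof. by case: rS => ind _ _; apply: indep_neq0 ind. Qed.

Let z0 : z != 0. Proof. by case: rS1 => ind _ _; apply: indep_neq0 ind. Qed.
Let u0 : u != 0. Proof. by case: rS2 => ind _ _; apply: indep_neq0 ind. Qed.
Let v0 : v != 0. Proof. by case: rS3 => ind _ _; apply: indep_neq0 ind. Qed.

Let jjkk : jj != kk. Proof. by rewrite (inj_eq (@lshift_inj _ _)). Qed.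

Lemma laurent_colsum S' l : ext_cluster S' =1 ext_cluster S ->
  laur S (col_plus S' l + col_minus S' l).
Proof.
move=> E; apply: laurentD.
  rewrite /col_plus; under eq_bigr do rewrite E.
  by case: (unit_laurent_mon iota predT (fun h => pos_part (ext_mx S' h l)) x0).
rewrite /col_minus; under eq_bigr do rewrite E.
by case: (unit_laurent_mon iota predT (fun h => pos_part (- ext_mx S' h l)) x0).
Qed.

Lemma laurent_z : laur S z.
Proof.
rewrite mutate_at; apply: laurentM; last exact: laurent_inv.
exact: laurent_colsum.
Qed.

(** The denominators of w are a power of z in the cluster of S, because of S1,
    and a power of u v, because of S3; they have no common factor. *)
Lemma laurent_chain_of_coprime w : laur S u -> laur S v ->
  laurent_coprime iota x z u -> laurent_coprime iota x z v ->
  laur S1 w -> laur S3 w -> laur S w.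
Proof.
move=> lu lv cu cv l1 l3.
have [d hd] : exists d, laur S (z ^+ d * w).
  apply: (laurent_change laurent_z) l1 => i.
    have [->|ij] := eqVneq i jj; first exact: laurent_z.
    by rewrite mutate_off //; apply: laurent_var.
  have [->|ij] := eqVneq i jj; first by rewrite divff //; apply: laurent1.
  rewrite (mutate_off S ij); apply: laurentM; [exact: laurent_z | exact: laurent_inv].
have off i : i != jj -> i != kk -> ext_cluster S3 i = x i.
  by move=> ij ik; rewrite !mutate_off.
have x3k : ext_cluster S3 kk = u by rewrite mutate_off // eq_sym.
have [d' hd'] : exists d, laur S ((u * v) ^+ d * w).
  apply: (laurent_change (laurentM lu lv)) l3 => i.
    have [->|ij] := eqVneq i jj; first by [].
    have [->|ik] := eqVneq i kk; first by rewrite x3k.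
    by rewrite (off i) //; apply: laurent_var.
  have [->|ij] := eqVneq i jj; first by rewrite mulfK.
  have [->|ik] := eqVneq i kk; first by rewrite x3k mulrC mulKf.
  by rewrite (off i) //; apply: laurentM; [exact: laurentM lu lv | exact: laurent_inv].
apply: (laurent_coprime_cancel z0 laurent_z _ hd' hd).
apply: laurent_coprimeX; first exact: laurentM lu lv.
exact: laurent_coprimeM.
Qed.

Lemma prod_split2 (f : 'I_(n + p) -> F) :
  \prod_h f h = f jj * f kk * \prod_(h | (h != jj) && (h != kk)) f h.
Proof.
rewrite (bigD1 jj) //= (bigD1 kk) /=; last by rewrite eq_sym.
by rewrite mulrA.
Qed.

Local Notation FT := {fraction {poly F}}.
Local Notation inc := (@tofrac {poly F}).

Let inc_inj : injective inc.
Proof. by move=> a b /eqP; rewrite tofrac_eq => /eqP. Qed.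

Let ind : alg_independent iota x. Proof. by case: rS. Qed.
Let sk : skew_top S. Proof. by case: rS. Qed.

Lemma zE : z * x jj = col_plus S j + col_minus S j.
Proof. by rewrite mutate_at divfK. Qed.

Lemma uE : u * x kk = col_plus S1 k + col_minus S1 k.
Proof. by rewrite mutate_at mutate_off 1?eq_sym // divfK. Qed.

Lemma vE : v * z = col_plus S2 j + col_minus S2 j.
Proof. by rewrite mutate_at mutate_off // divfK. Qed.

Section Disconnected.
Hypothesis Bkj : B kk j = 0.

Let Bjk : B jj k = 0. Proof. by rewrite sk Bkj oppr0. Qed.

Let B1k h : ext_mx S1 h k = B h k.
Proof.
rewrite mutate_mxE; have [->|hj] := eqVneq h jj; first by rewrite Bjk oppr0.
by rewrite eq_sym (negbTE jk) /= Bjk oppr0 !mulr0 subrr addr0.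
Qed.

Lemma disconnected_v : v = x jj.
Proof.
apply: (mulIf z0); rewrite vE [RHS]mulrC zE [RHS]addrC.
have B2 h : ext_mx S2 h j = - B h j.
  have E1 i : ext_mx S1 i j = - B i j by rewrite mutate_mxE eqxx orbT.
  rewrite mutate_mxE !E1; case: (eqVneq h kk) => [->|_] /=; first by rewrite Bkj !oppr0.
  by rewrite (negbTE jk) Bkj !oppr0 !mulr0 subrr addr0.
have off h : B h j != 0 -> ext_cluster S2 h = x h.
  move=> Bh; rewrite !mutate_off //; apply: contraNneq Bh => ->; last by rewrite Bkj.
  by rewrite skew_diag.
by congr (_ + _); apply: eq_bigr => h _; rewrite B2 ?opprK;
  (have [->|Bh] := eqVneq (B h j) 0; [rewrite ?oppr0 !expr0 | rewrite off]).
Qed.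

Lemma disconnected_uE : u = (col_plus S k + col_minus S k) / x kk.
Proof.
apply: (mulIf (x0 kk)); rewrite uE divfK //.
have off h : B h k != 0 -> ext_cluster S1 h = x h.
  by move=> Bh; rewrite mutate_off //; apply: contraNneq Bh => ->; rewrite Bjk.
by congr (_ + _); apply: eq_bigr => h _; rewrite B1k;
  (have [->|Bh] := eqVneq (B h k) 0; [rewrite ?oppr0 !expr0 | rewrite off]).
Qed.

(** By the full rank the columns j and k have a nonzero 2 x 2 minor; lambda is
    the corresponding vector, orthogonal to the first column only. *)
Lemma independent_columns : exists lambda : 'I_(n + p) -> int,
  \sum_h lambda h * B h j = 0 /\ \sum_h lambda h * B h k != 0.
Proof.
case: rS => _ _ fr.
have [h0 nz] : exists h0, B h0 k != 0.
  apply/existsP; apply: contraT; rewrite negb_exists => /forallP H.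
  have /(_ k) : forall l, (fun l => (l == k)%:Z) l = 0; last by rewrite eqxx.
  apply: fr => i; rewrite big1 // => l _.
  by case: eqVneq => [->|_]; rewrite ?mulr0 //; have := H i; rewrite negbK => /eqP ->.
have [h1 nz1] : exists h1, B h1 j * B h0 k - B h0 j * B h1 k != 0.
  apply/existsP; apply: contraT; rewrite negb_exists => /forallP H.
  (* If all these 2 x 2 minors vanish, w is a relation between the columns. *)
  pose w l := if l == j then B h0 k else if l == k then - B h0 j else 0.
  have /(_ j) : forall l, w l = 0; last by rewrite /w eqxx => e; rewrite e eqxx in nz.
  apply: fr => i; rewrite (bigD1 j) //= (bigD1 k) 1?eq_sym //= big1 => [|l /andP[lj lk]].
    rewrite /w eqxx [k == j]eq_sym (negbTE jk) eqxx addr0.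
    by have := H i; rewrite negbK => /eqP <-; ring.
  by rewrite /w (negbTE lj) (negbTE lk) mulr0.
exists (fun h => B h0 j * (h == h1)%:Z - B h1 j * (h == h0)%:Z).
have sE l : \sum_h (B h0 j * (h == h1)%:Z - B h1 j * (h == h0)%:Z) * B h l =
    B h0 j * B h1 l - B h1 j * B h0 l.
  under eq_bigr do rewrite mulrBl; rewrite sumrB; congr (_ - _).
    rewrite (bigD1 h1) //= eqxx mulr1 big1 ?addr0 // => h /negbTE ->.
    by rewrite mulr0 mul0r.
  rewrite (bigD1 h0) //= eqxx mulr1 big1 ?addr0 // => h /negbTE ->.
  by rewrite mulr0 mul0r.
rewrite !sE mulrC subrr; split=> //.
by apply: contra_neq nz1 => e; rewrite -[RHS]oppr0 -e; ring.
Qed.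

(** For the grading by a lambda orthogonal to the column j, the binomial z x_j is
    homogeneous while the two terms of u x_k have different degrees. *)
Lemma disconnected_coprime : laurent_coprime iota x z u.
Proof.
have [lam [l0 l1]] := independent_columns.
have W (P : pred _) e := weight_mon iota x lam inc_inj P e.
pose w l := \sum_h lam h * (pos_part (B h l))%:Z.
pose w' l := \sum_h lam h * (pos_part (- B h l))%:Z.
have wB l : w l - w' l = \sum_h lam h * B h l.
  by rewrite -sumrB; apply: eq_bigr => h _; rewrite -mulrBr pos_partB.
have wj : w j = w' j by apply/eqP; rewrite -subr_eq0 wB l0.
have hz : has_weight iota x lam inc (z * x jj) (w j).
  rewrite zE /has_weight polyCD rmorphD mulrDl; apply: tliftD; first exact: W.
  by rewrite wj; apply: W.
have co : laurent_coprime iota x (z * x jj) (col_plus S k + col_minus S k).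
  have Up : unit_laurent iota x (col_plus S k) by apply: unit_laurent_mon.
  have Um : unit_laurent iota x (col_minus S k) by apply: unit_laurent_mon.
  have [_ lp _] := Up; have [_ lm _] := Um.
  have := l1; rewrite -wB; case: (ltgtP (w k) (w' k)) => [lt _|lt _|->]; last by rewrite subrr.
    rewrite addrC; exact: (graded_coprime ind inc_inj hz Um (W _ _) lp (W _ _) lt).
  exact: (graded_coprime ind inc_inj hz Up (W _ _) lm (W _ _) lt).
rewrite disconnected_uE => c lc [d ld E].
have [|e le ->] := co c lc.
  exists (d * x kk / x jj).
    apply: laurentM; last exact: laurent_inv.
    by apply: laurentM => //; apply: laurent_var.
  apply: (mulIf (_ : (x kk)^-1 != 0)); first by rewrite invr_eq0.
  rewrite mulrAC E; field; rewrite ?x0 //.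
by exists (x jj * e); [apply: laurentM => //; apply: laurent_var | rewrite mulrA].
Qed.

(** When b_jk = 0 the mutations at j and k do not interact: v is the variable
    x_j, which is a unit. *)
Lemma disconnected_chain w : laur S1 w -> laur S3 w -> laur S w.
Proof.
apply: laurent_chain_of_coprime.
- rewrite disconnected_uE; apply: laurentM; [exact: laurent_colsum|exact: laurent_inv].
- by rewrite disconnected_v; apply: laurent_var.
- exact: disconnected_coprime.
- rewrite disconnected_v => c lc [d ld E]; exists ((x jj)^-1 * d).
    by apply: laurentM => //; apply: laurent_inv.
  by rewrite mulrCA -E mulKf.
Qed.

End Disconnected.

Section Connected.
Variable a : nat.
Hypotheses (a0 : (0 < a)%N) (BkjE : B kk j = - a%:Z).
Local Notation off := (fun h => (h != jj) && (h != kk)).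
Let Bjk : B jj k = a%:Z. Proof. by rewrite (sk j k) BkjE opprK. Qed.
Let B1jk : ext_mx S1 jj k = - a%:Z. Proof. by rewrite mutate_mxE eqxx /= Bjk. Qed.
Let B1kj : ext_mx S1 kk j = a%:Z.
Proof. by rewrite mutate_mxE eqxx orbT BkjE opprK. Qed.
Let B1kk : ext_mx S1 kk k = 0.
Proof. by apply: skew_diag; case: rS1. Qed.
Let B2kj : ext_mx S2 kk j = - a%:Z. Proof. by rewrite mutate_mxE eqxx /= B1kj. Qed.
Let B2jj : ext_mx S2 jj j = 0.
Proof. by apply: skew_diag; case: rS2. Qed.
Let posn0 : pos_part 0 = 0%N. Proof. by []. Qed.
Let posna : pos_part a%:Z = a. Proof. by rewrite /pos_part; case: ifP => h; lia. Qed.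
Let posnNa : pos_part (- a%:Z) = 0%N. Proof. by rewrite /pos_part; case: ifP => h; lia. Qed.

Let B2hj h : off h ->
  ext_mx S2 h j = - B h j + (pos_part (ext_mx S1 h k))%:Z * a%:Z.
Proof.
case/andP=> hj hk; rewrite mutate_mxE (negbTE hk) (negbTE jk) /= B1kj posna posnNa.
have -> : ext_mx S1 h j = - B h j by rewrite mutate_mxE eqxx orbT.
by rewrite mulr0 subr0.
Qed.

Let pa := \prod_(h | off h) x h ^+ pos_part (B h j).
Let qa := \prod_(h | off h) x h ^+ pos_part (- B h j).
Let Up := \prod_(h | off h) x h ^+ pos_part (ext_mx S1 h k).
Let Um := \prod_(h | off h) x h ^+ pos_part (- ext_mx S1 h k).
Let rr := \prod_(h | off h) x h ^+ pos_part (ext_mx S2 h j).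
Let ss := \prod_(h | off h) x h ^+ pos_part (- ext_mx S2 h j).

Let zC : z * x jj = pa + qa * x kk ^+ a.
Proof.
rewrite zE /col_plus /col_minus !prod_split2 skew_diag // oppr0 BkjE opprK.
by rewrite posn0 posna posnNa !expr0 !mul1r mulrC.
Qed.

Let uC : u * x kk = Up + Um * z ^+ a.
Proof.
rewrite uE /col_plus /col_minus !prod_split2 B1jk B1kk opprK oppr0.
rewrite posn0 posna posnNa !expr0 !mul1r mulr1; congr (_ + _).
  by apply: eq_bigr => h /andP[hj hk]; rewrite mutate_off.
rewrite mulrC; congr (_ * _).
by apply: eq_bigr => h /andP[hj hk]; rewrite mutate_off.
Qed.

Let vC : v * z = rr + ss * u ^+ a.
Proof.
rewrite vE /col_plus /col_minus !prod_split2 B2kj B2jj opprK oppr0.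
rewrite posn0 posna posnNa !expr0 !mul1r; congr (_ + _).
  by apply: eq_bigr => h /andP[hj hk]; rewrite !mutate_off.
rewrite mulrC; congr (_ * _).
by apply: eq_bigr => h /andP[hj hk]; rewrite !mutate_off.
Qed.

Let rel : rr * pa = ss * qa * Up ^+ a.
Proof. exact: prod_posn_rel B2hj. Qed.

Let unit_off (e : 'I_(n + p) -> nat) :
  unit_laurent iota x (\prod_(h | off h) x h ^+ e h).
Proof. exact: unit_laurent_mon. Qed.

Let lam (h : 'I_(n + p)) : int := (h == jj)%:Z.

Let weight_off e : has_weight iota x lam inc (\prod_(h | off h) x h ^+ e h) 0.
Proof.
have := weight_mon iota x lam inc_inj off e.
have -> // : \sum_(h | off h) lam h * (e h)%:Z = 0.
by rewrite big1 // => h /andP[/negbTE hj _]; rewrite /lam hj mul0r.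
Qed.

Let weightM0 b c : has_weight iota x lam inc b 0 -> has_weight iota x lam inc c 0 ->
  has_weight iota x lam inc (b * c) 0.
Proof. by move=> hb hc; have := weightM inc_inj hb hc; rewrite addr0. Qed.

Let weightV0 b : b != 0 -> has_weight iota x lam inc b 0 ->
  has_weight iota x lam inc b^-1 0.
Proof. by move=> b0 hb; have := weightV inc_inj b0 hb; rewrite oppr0. Qed.

Let weightX0 b d : has_weight iota x lam inc b 0 ->
  has_weight iota x lam inc (b ^+ d) 0.
Proof. by move=> hb; have := weightX inc_inj d hb; rewrite mul0r. Qed.

Let unit_k : unit_laurent iota x (x kk).
Proof. by split=> //; [apply: laurent_var|apply: laurent_inv]. Qed.

Let unit_j : unit_laurent iota x (x jj).
Proof. by split=> //; [apply: laurent_var|apply: laurent_inv]. Qed.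

Let weight_k : has_weight iota x lam inc (x kk) 0.
Proof.
by have := tlift_var iota x lam inc kk; rewrite /lam eq_sym (negbTE jjkk).
Qed.

Let weight_j : has_weight iota x lam inc (x jj) 1.
Proof. by have := tlift_var iota x lam inc jj; rewrite /lam eqxx. Qed.

Let laurent_u : laur S u.
Proof.
rewrite -(mulfK (x0 kk) u) uC; apply: laurentM; last exact: laurent_inv.
case: (unit_off (fun h => pos_part (ext_mx S1 h k))) => _ l1 _.
case: (unit_off (fun h => pos_part (- ext_mx S1 h k))) => _ l2 _.
by apply: laurentD => //; apply: laurentM => //; apply: laurentX; apply: laurent_z.
Qed.

(** The expansion of u^a to second order in z^a is enough, since v z only matters
    modulo z^2. *)
Let uaE : exists2 g, laur S g & u ^+ a * x kk ^+ a =
  Up ^+ a + a%:R * Up ^+ a.-1 * (Um * z ^+ a) + (Um * z ^+ a) ^+ 2 * g.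
Proof.
have [_ l1 _] : unit_laurent iota x Up by apply: unit_off.
have [_ l2 _] : unit_laurent iota x Um by apply: unit_off.
have lw : laur S (Um * z ^+ a).
  by apply: laurentM => //; apply: laurentX; apply: laurent_z.
have [g lg E] := binomial_remainder a.-1 l1 lw.
by exists g; rewrite // -exprMn uC; move: E; rewrite (prednK a0).
Qed.

(** Modulo z, the variable v is the sum of a term of degree 1 in x_j and a term
    of degree 0, where the former is a unit.  The constant term of v z vanishes
    modulo z by [rel]; the second order remainder of u^a contributes a multiple of
    z, and the first order one is the term c2 when a = 1, and a multiple of z
    when a > 1. *)
Let v_mod_z : exists c1 c2 g, [/\ unit_laurent iota x c1,
  has_weight iota x lam inc c1 0, laur S c2 /\ has_weight iota x lam inc c2 0,
  laur S g & v = c1 * x jj + c2 + z * g].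
Proof.
have up : unit_laurent iota x pa by apply: unit_off.
have uU : unit_laurent iota x Up by apply: unit_off.
have uM : unit_laurent iota x Um by apply: unit_off.
have us : unit_laurent iota x ss by apply: unit_off.
have wp : has_weight iota x lam inc pa 0 by apply: weight_off.
have wU : has_weight iota x lam inc Up 0 by apply: weight_off.
have wM : has_weight iota x lam inc Um 0 by apply: weight_off.
have ws : has_weight iota x lam inc ss 0 by apply: weight_off.
have [p0 lp lp'] := up; have [U0 lU lU'] := uU; have [M0 lM lM'] := uM.
have [s0 ls ls'] := us; have lz := laurent_z.
have lk' := laurent_inv iota x kk.
have [g lg gE] := uaE.
pose e := ss / x kk ^+ a.
have xa0 : x kk ^+ a != 0 by rewrite expf_neq0.
have ue : unit_laurent iota x e.
  by apply: unit_laurentM => //; apply: unit_laurentV; apply: unit_laurentX.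
have [e0 le le'] := ue.
have we : has_weight iota x lam inc e 0.
  exact: (weightM0 ws (weightV0 xa0 (weightX0 a weight_k))).
pose c := e * (a%:R * Up ^+ a.-1 * Um).
have lc : laur S c.
  do 2!(apply: laurentM => //); apply: laurentM; [exact: laurent_nat|exact: laurentX].
have wc : has_weight iota x lam inc c 0.
  have wa : has_weight iota x lam inc a%:R 0.
    by have := weight_scalar iota x lam inc a%:R; rewrite rmorph_nat.
  exact: (weightM0 we (weightM0 (weightM0 wa (weightX0 _ wU)) wM)).
pose g' := e * Um ^+ 2 * g * z ^+ (a + a - 2).
have lg' : laur S g'.
  apply: laurentM; last exact: laurentX.
  by do 2!(apply: laurentM => //); apply: laurentX.
have vE' : v = (e * Up ^+ a / pa) * x jj + c * z ^+ a.-1 + z * g'.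
  apply: (mulIf z0); rewrite vC -(mulfK xa0 (u ^+ a)) gE.
  have -> : rr = ss * qa * Up ^+ a / pa by rewrite -rel mulfK.
  rewrite [RHS]mulrDl [X in _ = X + _]mulrDl.
  have -> : e * Up ^+ a / pa * x jj * z = e * Up ^+ a / pa * (pa + qa * x kk ^+ a).
    by rewrite -zC; ring.
  have -> : c * z ^+ a.-1 * z = c * z ^+ a by rewrite -mulrA -exprSr prednK.
  rewrite /g'.
  have -> : z * (e * Um ^+ 2 * g * z ^+ (a + a - 2)) * z = e * (Um * z ^+ a) ^+ 2 * g.
    have -> : (Um * z ^+ a) ^+ 2 = Um ^+ 2 * (z * z ^+ (a + a - 2) * z).
      rewrite exprMn; congr (_ * _); rewrite -exprS -exprSr expr2 -exprD.
      by rewrite subn2_twice.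
    by ring.
  exact: third_mutation_identity.
have uc1 : unit_laurent iota x (e * Up ^+ a / pa).
  apply: unit_laurentM; last exact: unit_laurentV.
  by apply: unit_laurentM => //; apply: unit_laurentX.
have wc1 : has_weight iota x lam inc (e * Up ^+ a / pa) 0.
  exact: (weightM0 (weightM0 we (weightX0 a wU)) (weightV0 p0 wp)).
have [a1|a1] := eqVneq a 1%N.
  exists (e * Up ^+ a / pa), c, g'; split; [exact: uc1|exact: wc1|by split|exact: lg'|].
  by rewrite vE' {2}a1 expr0 mulr1.
exists (e * Up ^+ a / pa), 0, (c * z ^+ (a - 2) + g').
split; [exact: uc1|exact: wc1| | |].
- split; first exact: laurent0.
  by have := weight_scalar iota x lam inc 0; rewrite rmorph0.
- by apply: laurentD; [apply: laurentM; [exact: lc | exact: laurentX] | exact: lg'].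
- rewrite addr0 mulrDr addrA vE' -(subn2_pred a0 a1) exprS; ring.
Qed.

(** Modulo z, the variable u is the monomial Up / x_k, a unit; and v is coprime to
    z by the grading by the degree in x_j, for which z x_j is homogeneous of
    degree 0. *)
Lemma connected_chain w : laur S1 w -> laur S3 w -> laur S w.
Proof.
have [c1 [c2 [g [uc1 wc1 [lc2 wc2] lg E]]]] := v_mod_z.
have lz := laurent_z.
have uc1x : unit_laurent iota x (c1 * x jj) by apply: unit_laurentM.
have [_ lc1x _] := uc1x.
apply: laurent_chain_of_coprime => //.
- by rewrite E; apply: laurentD; [exact: laurentD | exact: laurentM].
- have -> : u = Up / x kk + z * (Um * z ^+ a.-1 / x kk).
    apply: (mulIf (x0 kk)); rewrite uC mulrDl divfK // mulrA divfK //.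
    by rewrite mulrCA -exprS prednK.
  apply: coprime_unit_mod.
    by apply: unit_laurentM; [exact: unit_off|exact: unit_laurentV].
  apply: laurentM; last exact: laurent_inv.
  apply: laurentM; last exact: laurentX.
  by case: (unit_off (fun h => pos_part (- ext_mx S1 h k))).
- rewrite E; have [xj0 lxj lxj'] := unit_j.
  apply: (coprime_mod lxj lg (erefl (z * x jj)) xj0 lxj').
  have hz : has_weight iota x lam inc (z * x jj) 0.
    rewrite zC /has_weight polyCD rmorphD mulrDl; apply: tliftD; first exact: weight_off.
    exact: (weightM0 (weight_off _) (weightX0 a weight_k)).
  have hx := weightM inc_inj wc1 weight_j.
  exact: (graded_coprime ind inc_inj hz uc1x hx lc2 wc2).
Qed.

End Connected.

End Step.

(** The sign of the entry b_kj is reduced to one case by [opposite]. *)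
Lemma laurent_chain S j k w : regular S -> j != k ->
  let S1 := mutate S j in let S3 := mutate (mutate S1 k) j in
  laur S1 w -> laur S3 w -> laur S w.
Proof.
move=> rS jk S1 S3 l1 l3.
case: (ltgtP (ext_mx S (lshift p k) j) 0) => B.
- apply: (@connected_chain S j k rS jk `|ext_mx S (lshift p k) j|%N) => //; lia.
- change (laur (opposite S) w).
  apply: (@connected_chain (opposite S) j k _ jk `|ext_mx S (lshift p k) j|%N).
  + exact: regular_neg.
  + lia.
  + by rewrite /= mxE gtz0_abs.
  + by rewrite mutate_neg.
  + by rewrite !mutate_neg.
- exact: (disconnected_chain rS jk B).
Qed.

(** By induction on the number of mutations.  A sequence that starts with j and k
    is compared with the one that starts with j, k, j, j: the induction hypothesis
    applies from the second and from the fourth cluster of this chain, and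
    [laurent_chain] brings the result back to the first one. *)
Theorem laurent_phenomenon S ls i : regular S ->
  laur S (ext_cluster (foldl (@mutate F n p) S ls) i).
Proof.
have [N] := ubnP (size ls); elim: N S ls => // N IH S [|j [|k ls]] sz rS.
- exact: laurent_var.
- change (laur S (ext_cluster (mutate S j) i)).
  have [->|ij] := eqVneq i (lshift p j); last by rewrite mutate_off //; apply: laurent_var.
  exact: laurent_z.
change (laur S (ext_cluster (foldl (@mutate F n p) (mutate (mutate S j) k) ls) i)).
have {}sz : (size ls + 2 <= N)%N by move: sz => /=; lia.
have [<-|jk] := eqVneq j k.
  by rewrite (regular_mutateK K2 j rS); apply: IH => //; lia.
have rS1 := regular_mutate K2 j rS; have rS2 := regular_mutate K2 k rS1.
have rS3 := regular_mutate K2 j rS2.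
(* Read from the fourth cluster, the sequence is the mutation j followed by ls. *)
apply: (laurent_chain rS jk).
  by apply: (IH _ (k :: ls)) => //=; lia.
have := IH (mutate (mutate (mutate S j) k) j) (j :: ls) _ rS3.
by rewrite [foldl _ _ _]/(foldl _ _ ls) (regular_mutateK K2 j rS2); apply => /=; lia.
Qed.

End Chain.

(** * Pairs of permutations and words of exchanges *)

(** The component true lists the rows, the component false the columns. *)
Definition state := bool -> nat -> nat.
(** The letter (b, r) exchanges the positions r - 1 and r of the component b. *)
Definition letter := (bool * nat)%type.

(** The orders for which the pairs are to be exchanged: a path makes the rows
    decreasing and the columns increasing. *)
Definition asc (b : bool) : rel nat := fun x y => if b then (x < y)%N else (y < x)%N.

Lemma asc_asym b x y : asc b x y -> asc b y x = false.
Proof. by case: b => /=; lia. Qed.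

Lemma asc_total b x y : x != y -> ~~ asc b x y -> asc b y x.
Proof. by case: b => /=; lia. Qed.

Lemma asc_trans b x y z : asc b x y -> asc b y z -> asc b x z.
Proof. by case: b => /=; lia. Qed.

Definition move_st (st : state) (a : letter) : state :=
  fun c => if c == a.1 then st c \o sw a.2 else st c.

Lemma sw_lt k r i : (0 < r < k)%N -> (i < k)%N -> (sw r i < k)%N.
Proof. by rewrite /sw => h1 h2; case: (i == r); case: (i == r.-1); lia. Qed.

Lemma sw_ge k r i : (0 < r < k)%N -> (k <= i)%N -> sw r i = i.
Proof. by move=> h1 h2; apply: sw_out; lia. Qed.

Section Words.
Variable k : nat.

Definition applicable (st : state) (a : letter) : bool :=
  (0 < a.2 < k)%N && asc a.1 (st a.1 a.2.-1) (st a.1 a.2).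

Fixpoint valid (st : state) (w : seq letter) : bool :=
  if w is a :: w' then applicable st a && valid (move_st st a) w' else true.

Definition endst : state -> seq letter -> state := foldl move_st.

Definition final (st : state) := forall a, ~~ applicable st a.

(** A pair of permutations of {0, ..., k - 1}, extended by the identity. *)
Definition perm_state (st : state) :=
  [/\ forall b, injective (st b), forall b i, (i < k)%N -> (st b i < k)%N
    & forall b i, (k <= i)%N -> st b i = i].

Lemma valid_cat st w1 w2 : valid st (w1 ++ w2) = valid st w1 && valid (endst st w1) w2.
Proof. by elim: w1 st => //= a w1 IH st; rewrite IH andbA. Qed.

Lemma endst_cat st w1 w2 : endst st (w1 ++ w2) = endst (endst st w1) w2.
Proof. exact: foldl_cat. Qed.

Lemma perm_move st a : (0 < a.2 < k)%N -> perm_state st -> perm_state (move_st st a).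
Proof.
case: a => c r /= rk [inj lt out]; split=> b; rewrite /move_st /=; case: (b == c).
- by apply: inj_comp => //; apply: sw_inj.
- exact: inj.
- by move=> i ik; apply: lt; apply: sw_lt.
- exact: lt.
- by move=> i ki; rewrite /= (sw_ge rk ki) out.
- exact: out.
Qed.

Lemma perm_end st w : valid st w -> perm_state st -> perm_state (endst st w).
Proof.
elim: w st => //= a w IH st /andP[/andP[ak _] vw] ps.
by apply: IH => //; apply: perm_move.
Qed.

(** The number of exchanges still to be done (e = true) or already done
    (e = false) on a path. *)
Definition ordered_pairs (e : bool) (st : state) : nat :=
  (pair_count (asc e) (st true) k + pair_count (asc (~~ e)) (st false) k)%N.

Lemma ordered_pairs_drop st a : applicable st a -> ordered_pairs true st = (ordered_pairs true (move_st st a)).+1.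
Proof.
case: a => b r /andP[/= rk ab]; have ba := asc_asym ab.
rewrite /ordered_pairs /move_st; case: b ab ba => /= ab ba.
  by have := pair_count_sw (asc true) (st true) rk; rewrite /= ab ba; lia.
by have := pair_count_sw (asc false) (st false) rk; rewrite /= ab ba; lia.
Qed.

Lemma ordered_pairs_raise st a : applicable st a -> ordered_pairs false (move_st st a) = (ordered_pairs false st).+1.
Proof.
case: a => b r /andP[/= rk ab]; have ba := asc_asym ab.
rewrite /ordered_pairs /move_st; case: b ab ba => /= ab ba.
  by have := pair_count_sw (asc false) (st true) rk; rewrite /= ab ba; lia.
by have := pair_count_sw (asc true) (st false) rk; rewrite /= ab ba; lia.
Qed.

(** Every letter decreases the number of exchanges still to be done. *)
Lemma exhaust (P : pred letter) st : exists w, [/\ valid st w, all P w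
  & forall a, P a -> ~~ applicable (endst st w) a].
Proof.
have [N] := ubnP (ordered_pairs true st); elim: N st => // N IH st lt.
have [[a Pa oka]|no] := pselect (exists2 a, P a & applicable st a).
  have [|w [vw Pw fw]] := IH (move_st st a); first by have := ordered_pairs_drop oka; lia.
  by exists (a :: w); rewrite /= oka Pa.
by exists [::]; split=> // a Pa; apply: contra_notN no => oka; exists a.
Qed.

Lemma sw_comm r s : (r.+1 < s)%N || (s.+1 < r)%N -> sw r \o sw s = sw s \o sw r.
Proof. by move=> h; apply/funext => i /=; rewrite /sw; do !case: eqP => //; lia. Qed.

Lemma sw_braid r : (0 < r)%N -> sw r \o sw r.+1 \o sw r = sw r.+1 \o sw r \o sw r.+1.
Proof. by move=> h; apply/funext => i /=; rewrite /sw /=; do !case: eqP => //; lia. Qed.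

Definition commuting (a b : letter) := [|| (a.1 != b.1) && (a.2 != b.2), (a.2.+1 < b.2)%N
  | (b.2.+1 < a.2)%N].

(** The letters of different colours commute; at the same level this is kept apart,
    because it changes a chamber. *)
Inductive elementary : seq letter -> seq letter -> Prop :=
| elem_comm a b : commuting a b -> elementary [:: a; b] [:: b; a]
| elem_cross b r : elementary [:: (b, r); (~~ b, r)] [:: (~~ b, r); (b, r)]
| elem_braid b r : elementary [:: (b, r); (b, r.+1); (b, r)] [:: (b, r.+1); (b, r); (b, r.+1)]
| elem_braid' b r : elementary [:: (b, r.+1); (b, r); (b, r.+1)] [:: (b, r); (b, r.+1); (b, r)].

Lemma move_comm st a b : commuting a b || (a.1 != b.1) ->
  move_st (move_st st a) b = move_st (move_st st b) a.
Proof.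
case: a b => [a r] [b s]; rewrite /commuting /= => h; apply/funext => c; rewrite /move_st /=.
case: (eqVneq c b) => [->|]; case: (eqVneq _ a) => // e; subst.
move: h; rewrite eqxx /= orbF => h; apply/funext => i /=; congr (st _ _).
by have /(congr1 (fun f => f i)) /= := sw_comm h.
Qed.

Lemma move_braid st b r : (0 < r)%N ->
  endst st [:: (b, r); (b, r.+1); (b, r)] = endst st [:: (b, r.+1); (b, r); (b, r.+1)].
Proof.
move=> r0; apply/funext => c; rewrite /endst /= /move_st /=; case: eqP => // _.
apply/funext => i /=; congr (st c _).
by have /(congr1 (fun f => f i)) := sw_braid r0.
Qed.

Lemma applicable_other st a b : a.1 != b.1 -> applicable (move_st st a) b = applicable st b.
Proof. by rewrite eq_sym /applicable /move_st => /negbTE ->. Qed.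

Lemma applicable_commuting st a b : commuting a b -> applicable (move_st st a) b = applicable st b.
Proof.
have [e|] := eqVneq a.1 b.1; last by move=> /applicable_other.
rewrite /commuting e eqxx /= => h; rewrite /applicable /move_st /= e eqxx /=.
case s0 : (0 < b.2 < k)%N => //=.
by rewrite !sw_out //; move/andP: s0; lia.
Qed.

(** If three consecutive values are in order, the two ways of reversing them are
    both possible. *)
Lemma braid_valid st b r : (0 < r)%N -> (r.+1 < k)%N ->
  asc b (st b r.-1) (st b r) -> asc b (st b r) (st b r.+1) ->
  valid st [:: (b, r); (b, r.+1); (b, r)] && valid st [:: (b, r.+1); (b, r); (b, r.+1)].
Proof.
case: r => // q _ rk /= a1 a2; have a3 := asc_trans a1 a2.
have s1 : sw q.+1 q = q.+1 by rewrite /sw /= eqxx; case: eqP => //; lia.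
have s2 : sw q.+1 q.+1 = q by rewrite /sw eqxx.
have s3 : sw q.+2 q = q by rewrite /sw /=; do !case: eqP => //; lia.
have s4 : sw q.+2 q.+1 = q.+2 by rewrite /sw /= eqxx; case: eqP => //; lia.
have s5 : sw q.+1 q.+2 = q.+2 by rewrite /sw /=; do !case: eqP => //; lia.
have s6 : sw q.+2 q.+2 = q.+1 by rewrite /sw eqxx.
rewrite /applicable /move_st /= eqxx /= rk (ltnW rk) !(s1, s2, s3, s4, s5, s6).
by rewrite a1 a2 a3.
Qed.

Lemma braid_validE st b r :
  valid st [:: (b, r); (b, r.+1); (b, r)] || valid st [:: (b, r.+1); (b, r); (b, r.+1)] ->
  [/\ (0 < r)%N, (r.+1 < k)%N, asc b (st b r.-1) (st b r)
   & asc b (st b r) (st b r.+1)].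
Proof.
case: r => [|q]; first by rewrite /= /applicable /= !andbF.
have s1 : sw q.+1 q = q.+1 by rewrite /sw /= eqxx; case: eqP => //; lia.
have s2 : sw q.+1 q.+1 = q by rewrite /sw eqxx.
have s3 : sw q.+2 q = q by rewrite /sw /=; do !case: eqP => //; lia.
have s4 : sw q.+2 q.+1 = q.+2 by rewrite /sw /= eqxx; case: eqP => //; lia.
have s5 : sw q.+1 q.+2 = q.+2 by rewrite /sw /=; do !case: eqP => //; lia.
have s6 : sw q.+2 q.+2 = q.+1 by rewrite /sw eqxx.
rewrite /= /applicable /move_st /= eqxx /= !(s1, s2, s3, s4, s5, s6) !andbT.
by case/orP => [/and3P[/andP[h1 h2] /andP[h3 h4] /andP[h5 h6]]
  |/and3P[/andP[h1 h2] /andP[h3 h4] /andP[h5 h6]]].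
Qed.

Lemma elem_valid st w w' : elementary w w' -> valid st w ->
  valid st w' /\ endst st w' = endst st w.
Proof.
case=> [a b fab|b r|b r|b r].
- have fba : commuting b a by move: fab; rewrite /commuting eq_sym [b.2 == _]eq_sym orbCA orbC -orbA orbC.
  rewrite /= !andbT (applicable_commuting _ fab) (applicable_commuting _ fba) andbC => ->; split=> //.
  by rewrite (@move_comm _ b a) ?fba.
- rewrite /= !andbT !applicable_other /= ?eqb_negLR //; [|by case: b..].
  by rewrite andbC => ->; split=> //; rewrite (@move_comm _ (b, r)) //= orbC; case: b.
- move=> v; have [|r0 rk a1 a2] := @braid_validE st b r; first by rewrite v.
  by have /andP[_ v'] := braid_valid r0 rk a1 a2; rewrite move_braid.
- move=> v; have [|r0 rk a1 a2] := @braid_validE st b r; first by rewrite v orbT.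
  by have /andP[v' _] := braid_valid r0 rk a1 a2; rewrite move_braid.
Qed.

Inductive rewr : seq letter -> seq letter -> Prop :=
| rewr_refl w : rewr w w
| rewr_step w1 win win' w2 t : elementary win win' -> rewr (w1 ++ win' ++ w2) t ->
    rewr (w1 ++ win ++ w2) t.

Lemma rewr_trans w1 w2 w3 : rewr w1 w2 -> rewr w2 w3 -> rewr w1 w3.
Proof. by move=> h; elim: h w3 => // u1 u u' u2 t e _ IH w3 /IH; apply: rewr_step. Qed.

Lemma rewr_cat u w t : rewr w t -> rewr (u ++ w) (u ++ t).
Proof.
elim=> [w'|w1 win win' w2 t' e _]; first exact: rewr_refl.
by rewrite !(catA u); apply: rewr_step.
Qed.

Lemma rewr_elem win win' w : elementary win win' -> rewr (win ++ w) (win' ++ w).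
Proof. by move=> e; apply: (@rewr_step [::] win win' w _ e (rewr_refl _)). Qed.

(** The argument of Matsumoto and Tits.  If the words start with different letters
    a and b, then the two words of the move between a and b can be started from
    this state; they are continued by the same word to a final state.  The
    induction hypothesis, after a and after b, compares them with the given
    words. *)
Lemma rewr_final st w t : valid st w -> final (endst st w) ->
  valid st t -> final (endst st t) -> rewr w t.
Proof.
have [N] := ubnP (ordered_pairs true st); elim: N st w t => // N IH st [|a w] [|b t] lt.
- by move=> *; apply: rewr_refl.
- by move=> _ fw /= /andP[okb _]; have := fw b; rewrite okb.
- by move=> /= /andP[oka _] _ _ ft; have := ft a; rewrite oka.
move=> /= /andP[oka vw] fw /andP[okb vt] ft.
have IHa x y : valid (move_st st a) x -> final (endst (move_st st a) x) ->
  valid (move_st st a) y -> final (endst (move_st st a) y) -> rewr (a :: x) (a :: y).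
  move=> h1 h2 h3 h4; apply: (@rewr_cat [:: a]); apply: IH h1 h2 h3 h4.
  by have := ordered_pairs_drop oka; lia.
have IHb x y : valid (move_st st b) x -> final (endst (move_st st b) x) ->
  valid (move_st st b) y -> final (endst (move_st st b) y) -> rewr (b :: x) (b :: y).
  move=> h1 h2 h3 h4; apply: (@rewr_cat [:: b]); apply: IH h1 h2 h3 h4.
  by have := ordered_pairs_drop okb; lia.
have [ab|ab] := eqVneq a b; first by subst; apply: IHa.
suff via x y : elementary (a :: x) (b :: y) -> valid st (a :: x) -> rewr (a :: w) (b :: t).
  case: a b ab oka okb {vw vt fw ft IHa IHb} via => [c r] [d s] ab oka okb via.
  have [fab|nfar] := boolP (commuting (c, r) (d, s)).
    apply: via (elem_comm fab) _ => //=; rewrite oka /= applicable_commuting ?okb //.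
  have [cd|cd] := eqVneq c d; last first.
    have ? : d = ~~ c by case: (c) (d) cd => [] [].
    have rs : r = s by move: nfar; rewrite /commuting /= cd; case: eqVneq.
    subst; apply: via (elem_cross c s) _ => /=; rewrite oka applicable_other ?okb //=.
  subst d; move: nfar; rewrite /commuting /= eqxx /= negb_or -!leqNgt => /andP[rs sr].
  have [/andP[/andP[r0 rk] ra] /andP[/andP[s0 sk] sa]] := conj oka okb.
  case: (ltngtP r s) => [lrs|lsr|ers]; last first.
  - by rewrite ers eqxx in ab.
  - have e : r = s.+1 by rewrite /= in rs sr; lia.
    subst r; apply: via (elem_braid' c s) _.
    by have /andP[_ ->] := braid_valid s0 rk sa ra.
  - have e : s = r.+1 by rewrite /= in rs sr; lia.
    subst s; apply: via (elem_braid c r) _.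
    by have /andP[-> _] := braid_valid r0 sk ra sa.
(* z continues the two words of the elementary move to a final state. *)
move=> e v; have [z [vz _ fz]] := exhaust predT (endst st (a :: x)).
have {}fz : final (endst (endst st (a :: x)) z) by move=> c; apply: fz.
have [v' ee] := elem_valid e v.
apply: rewr_trans (IHb (y ++ z) t _ _ vt ft).
- apply: rewr_trans (IHa w (x ++ z) vw fw _ _) _.
  + by move: v => /= /andP[_ v]; rewrite valid_cat v.
  + by move: fz; rewrite -endst_cat.
  + exact: (rewr_elem z e).
- by move: v' => /= /andP[_ v']; rewrite valid_cat v' /=; move: vz; rewrite -ee.
- by move: fz; rewrite -ee -endst_cat.
Qed.

Definition start_st : state :=
  fun b i => if b || (k <= i)%N then i else (k.-1 - i)%N.

Definition final_st : state := fun b => start_st (~~ b).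

Lemma perm_start : perm_state start_st.
Proof.
split=> b; rewrite /start_st.
- move=> i j; case: b => //=; case: (leqP k i) => ki; case: (leqP k j) => kj; lia.
- move=> i ik; have ki : (k <= i)%N = false by lia.
  by rewrite ki orbF; case: b => /=; lia.
- by move=> i ->; rewrite orbT.
Qed.

Lemma perm_mono (f : nat -> nat) : (forall i, (i < k)%N -> (f i < k)%N) ->
  (forall i, (i.+1 < k)%N -> (f i < f i.+1)%N) -> forall i, (i < k)%N -> f i = i.
Proof.
move=> lt mono.
have lo i : (i < k)%N -> (i <= f i)%N.
  by elim: i => // i IH ik; have := IH (ltnW ik); have := mono i ik; lia.
have hi d : (d < k)%N -> (f (k.-1 - d) <= k.-1 - d)%N.
  elim: d => [|d IH] dk; first by have := lt (k.-1 - 0)%N; lia.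
  have := IH (ltnW dk); have := mono (k.-1 - d.+1)%N.
  have -> : (k.-1 - d.+1).+1 = (k.-1 - d)%N by lia.
  lia.
move=> i ik; have := lo i ik; have := hi (k.-1 - i)%N.
have -> : (k.-1 - (k.-1 - i) = i)%N by lia.
lia.
Qed.

Lemma perm_anti (f : nat -> nat) : (forall i, (i < k)%N -> (f i < k)%N) ->
  (forall i, (i.+1 < k)%N -> (f i.+1 < f i)%N) ->
  forall i, (i < k)%N -> f i = (k.-1 - i)%N.
Proof.
move=> lt mono i ik.
have := @perm_mono (fun i => k.-1 - f i)%N _ _ i ik.
have := lt i ik; move=> fi h.
have : (k.-1 - f i)%N = i; last by lia.
apply: h => [j jk|j jk]; first by lia.
by have := mono j jk; have := lt j (ltnW jk); lia.
Qed.

(** A permutation without ascents is the reversal, one without descents the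
    identity. *)
Lemma stuck_component b st : perm_state st ->
  (forall r, ~~ applicable st (b, r)) -> st b = final_st b.
Proof.
case=> inj lt out no; apply/funext => i.
have [ki|ik] := leqP k i; first by rewrite out // /final_st /start_st ki orbT.
have mono j : (j.+1 < k)%N -> asc b (st b j.+1) (st b j).
  move=> jk; have := no j.+1; rewrite /applicable /= jk /= => h.
  apply: asc_total h; apply/eqP => /inj; lia.
rewrite /final_st /start_st leqNgt ik orbF; case: b no mono => /= _ mono.
  by apply: perm_anti (lt true) _ _ ik => j jk; apply: mono.
by apply: perm_mono (lt false) _ _ ik => j jk; apply: mono.
Qed.

Lemma final_stP st : perm_state st -> final st -> st = final_st.
Proof. by move=> ps f; apply/funext => b; apply: stuck_component => // r; apply: f. Qed.

Lemma startP st : perm_state st ->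
  (forall b r, (0 < r < k)%N -> ~~ asc b (st b r) (st b r.-1)) -> st = start_st.
Proof.
case=> inj lt out no; apply/funext => b; apply/funext => i.
have [ki|ik] := leqP k i; first by rewrite out // /start_st ki orbT.
have mono j : (j.+1 < k)%N -> asc b (st b j) (st b j.+1).
  move=> jk; have := no b j.+1; rewrite jk /= => /(_ isT) h.
  apply: asc_total h; apply/eqP => /inj; lia.
rewrite /start_st leqNgt ik orbF; case: b mono => /= mono.
  by apply: perm_mono (lt true) _ _ ik => j jk; apply: mono.
by apply: perm_anti (lt false) _ _ ik => j jk; apply: mono.
Qed.

Lemma move_stK st a : move_st (move_st st a) a = st.
Proof.
apply/funext => c; apply/funext => i; rewrite /move_st; case: eqP => //= _.
by rewrite swK.
Qed.

(** Exchanges are undone as long as there is a pair that has already been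
    exchanged. *)
Lemma reach st : perm_state st -> exists2 w, valid start_st w & endst start_st w = st.
Proof.
have [N] := ubnP (ordered_pairs false st); elim: N st => // N IH st lt ps.
have [[a ak d]|no] := pselect (exists2 a : letter, (0 < a.2 < k)%N &
    asc a.1 (st a.1 a.2) (st a.1 a.2.-1)); last first.
  exists [::] => //; apply/esym/startP => // b r rk.
  by apply/negP => h; apply: no; exists (b, r).
have oka : applicable (move_st st a) a.
  rewrite /applicable ak /move_st eqxx /= /sw eqxx.
  by move/andP: ak => [a0 _]; rewrite ifN ?eqxx //; apply/eqP; lia.
have [||w vw e] := IH (move_st st a).
- by have := ordered_pairs_raise oka; rewrite move_stK; lia.
- exact: perm_move.
exists (w ++ [:: a]); last by rewrite endst_cat e /= move_stK.
by rewrite valid_cat vw e /= oka.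
Qed.

End Words.

(** * The quiver and the chamber minors of a path *)

(** The number is the label of the chamber that the letter opens. *)
Definition dletter := (letter * nat)%type.

(** The skew-symmetric matrix of one arrow from a to b. *)
Definition arrow (a b x y : nat) : int :=
  (x == a)%:Z * (y == b)%:Z - (x == b)%:Z * (y == a)%:Z.

Definition triangle (a b c x y : nat) : int :=
  arrow a b x y + arrow b c x y + arrow c a x y.

(** cur r is the label of the chamber that is open at the level r.  The three
    vertices are the chamber that the letter closes, the one that it opens, and
    the chamber next to them, above for the rows and below for the columns. *)
Definition quiver_step (cur : nat -> nat) (s : dletter) : nat -> nat -> int :=
  let: ((b, r), l) := s in
  if b then triangle (cur r) l (cur r.+1) else triangle l (cur r) (cur r.-1).

Definition cur_step (cur : nat -> nat) (s : dletter) : nat -> nat := upd cur s.1.2 s.2.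

Fixpoint quiver (cur : nat -> nat) (w : seq dletter) (x y : nat) : int :=
  if w is s :: w' then quiver_step cur s x y + quiver (cur_step cur s) w' x y else 0.

Definition end_cur : (nat -> nat) -> seq dletter -> nat -> nat := foldl cur_step.

Definition erase (w : seq dletter) : seq letter := map fst w.
Definition new_labels (w : seq dletter) : seq nat := map snd w.

Lemma quiver_cat cur w1 w2 x y :
  quiver cur (w1 ++ w2) x y = quiver cur w1 x y + quiver (end_cur cur w1) w2 x y.
Proof. by elim: w1 cur => [|s w1 IH] cur /=; rewrite ?add0r // IH addrA. Qed.

Lemma end_cur_cat cur w1 w2 : end_cur cur (w1 ++ w2) = end_cur (end_cur cur w1) w2.
Proof. exact: foldl_cat. Qed.

Lemma triangle_skew a b c x y : triangle a b c x y = - triangle a b c y x.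
Proof. by rewrite /triangle /arrow; ring. Qed.

Lemma quiver_step_skew cur s x y : quiver_step cur s x y = - quiver_step cur s y x.
Proof. by case: s => [[[] r] l] /=; apply: triangle_skew. Qed.

Lemma quiver_skew cur w x y : quiver cur w x y = - quiver cur w y x.
Proof.
by elim: w cur => [|s w IH] cur /=; rewrite ?oppr0 // quiver_step_skew IH opprD.
Qed.

Lemma arrow_out a b x y : x != a -> x != b -> arrow a b x y = 0.
Proof. by rewrite /arrow => /negbTE -> /negbTE ->; rewrite !mul0r subrr. Qed.

Lemma triangle_out a b c x y : x != a -> x != b -> x != c -> triangle a b c x y = 0.
Proof. by move=> *; rewrite /triangle !arrow_out ?addr0. Qed.

Lemma quiver_out cur w x y : (forall r, cur r != x) -> x \notin new_labels w ->
  quiver cur w x y = 0.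
Proof.
elim: w cur => [|[[b r] l] w IH] cur cx //=; rewrite inE negb_or => /andP[xl xw].
rewrite IH // => [|s]; last first.
  by rewrite /cur_step /upd; case: ifP => _; rewrite ?cx // eq_sym.
by rewrite addr0; case: b; rewrite triangle_out // eq_sym.
Qed.

Lemma end_cur_out cur w x : (forall r, cur r != x) -> x \notin new_labels w ->
  forall r, end_cur cur w r != x.
Proof.
elim: w cur => [|[[b r] l] w IH] cur cx //=; rewrite inE negb_or => /andP[xl xw].
apply: IH => // s.
by rewrite /cur_step /upd; case: ifP => _; rewrite ?cx // eq_sym.
Qed.

Definition mutate_fun (B : nat -> nat -> int) (l x y : nat) : int :=
  if (x == l) || (y == l) then - B x y
  else B x y + ((pos_part (B x l))%:Z * (pos_part (B l y))%:Z
     - (pos_part (- B x l))%:Z * (pos_part (- B l y))%:Z).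

(** The column of a vertex with two incoming and two outgoing arrows, as it occurs
    in all exchange relations between neighbouring seeds of paths. *)
Definition column4 (p1 p2 q1 q2 x : nat) : int :=
  (x == p1)%:Z + (x == p2)%:Z - (x == q1)%:Z - (x == q2)%:Z.

Lemma column4_pos p1 p2 q1 q2 z : uniq [:: p1; p2; q1; q2] ->
  pos_part (column4 p1 p2 q1 q2 z) = ((z == p1) + (z == p2))%N /\
  pos_part (- column4 p1 p2 q1 q2 z) = ((z == q1) + (z == q2))%N.
Proof.
rewrite /= !inE !negb_or => /and4P[/and3P[a b c] /andP[d e] f _]; rewrite /column4.
have [->|z1] := eqVneq z p1; first by rewrite (negbTE a) (negbTE b) (negbTE c).
have [->|z2] := eqVneq z p2; first by rewrite (negbTE d) (negbTE e).
have [->|z3] := eqVneq z q1; first by rewrite (negbTE f).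
by case: (eqVneq z q2).
Qed.

Lemma column4_term p1 p2 q1 q2 x y : uniq [:: p1; p2; q1; q2] ->
  (pos_part (column4 p1 p2 q1 q2 x))%:Z * (pos_part (- column4 p1 p2 q1 q2 y))%:Z
   - (pos_part (- column4 p1 p2 q1 q2 x))%:Z * (pos_part (column4 p1 p2 q1 q2 y))%:Z =
  arrow p1 q1 x y + arrow p1 q2 x y + arrow p2 q1 x y + arrow p2 q2 x y.
Proof.
move=> u; have [-> ->] := column4_pos x u; have [-> ->] := column4_pos y u.
by rewrite /arrow !PoszD; ring.
Qed.

Lemma mutate_fun_window (W W' : nat -> nat -> int) l p1 p2 q1 q2 :
  uniq [:: p1; p2; q1; q2] ->
  (forall x y, W x y = - W y x) -> (forall x y, W' x y = - W' y x) ->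
  (forall x, W x l = column4 p1 p2 q1 q2 x) ->
  (forall x, W' x l = - column4 p1 p2 q1 q2 x) ->
  (forall x y, x != l -> y != l -> W' x y = W x y +
     (arrow p1 q1 x y + arrow p1 q2 x y + arrow p2 q1 x y + arrow p2 q2 x y)) ->
  forall x y, W' x y = mutate_fun W l x y.
Proof.
move=> u sk sk' c c' h x y; rewrite /mutate_fun.
have [->|yl] := eqVneq y l; first by rewrite orbT c c'.
have [->|xl] := eqVneq x l; first by rewrite sk' c' sk c opprK.
by rewrite /= h // [W l y]sk !c opprK column4_term.
Qed.

Section Chambers.
Variables (F : comNzRingType) (k : nat) (A : nat -> nat -> F).

Definition chamber (st : state) (r : nat) : F := sminor A (st true) (st false) r.

Definition flags (f : nat -> F) (cur : nat -> nat) (st : state) :=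
  forall r, (r <= k)%N -> f (cur r) = chamber st r.

Fixpoint labelled (f : nat -> F) (st : state) (w : seq dletter) : Prop :=
  if w is (a, l) :: w' then
    f l = chamber (move_st st a) a.2 /\ labelled f (move_st st a) w'
  else True.

Lemma labelled_cat f st w1 w2 : labelled f st (w1 ++ w2) <->
  labelled f st w1 /\ labelled f (endst st (erase w1)) w2.
Proof.
elim: w1 st => [|[a l] w1 IH] st /=; first by tauto.
by rewrite IH; tauto.
Qed.

Lemma eq_labelled f g st w : (forall l, l \in new_labels w -> f l = g l) ->
  labelled f st w -> labelled g st w.
Proof.
elim: w st => [|[a l] w IH] st //= fg [fl lw].
rewrite -fg ?mem_head //; split=> //; apply: IH lw => x xw; apply: fg.
by rewrite inE xw orbT.
Qed.

Lemma chamber_move st a r : perm_state k st -> (0 < a.2)%N -> a.2 != r ->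
  chamber (move_st st a) r = chamber st r.
Proof.
case: a => b s [inj _ _] /= s0 sr; rewrite /chamber /move_st /=.
have ne c : st c s != st c s.-1 by apply/eqP => /inj; lia.
by case: b => /=; [|rewrite -!(sminor_tr A)]; rewrite sminor_sw.
Qed.

Lemma flags_step f cur st a l : perm_state k st -> (0 < a.2)%N ->
  flags f cur st -> f l = chamber (move_st st a) a.2 ->
  flags f (cur_step cur (a, l)) (move_st st a).
Proof.
move=> ps a0 fl e r rk; rewrite /cur_step /= /upd; case: eqP => [->//|/eqP ra].
by rewrite chamber_move 1?eq_sym // fl.
Qed.

Lemma flags_end f cur st w : perm_state k st -> valid k st (erase w) ->
  flags f cur st -> labelled f st w -> flags f (end_cur cur w) (endst st (erase w)).
Proof.
elim: w cur st => [|[a l] w IH] cur st //= ps /andP[oka vw] fl [e lw].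
move: (oka) => /andP[/andP[a0 ak] _].
apply: IH => //; first by apply: perm_move => //; rewrite a0.
by apply: flags_step.
Qed.

End Chambers.

Section Geometry.
Variables (F : fieldType) (k : nat) (A : nat -> nat -> F).
Local Notation chamber := (chamber A).
Hypothesis nondeg : forall st r, perm_state k st -> (r <= k)%N -> chamber st r != 0.

(** The relation [lewis_carroll], for a row and a column exchange at the same
    level. *)
Lemma chamber_cross st b r : perm_state k st -> valid k st [:: (b, r); (~~ b, r)] ->
  chamber (move_st st (b, r)) r * chamber (move_st st (~~ b, r)) r =
  chamber st r * chamber (endst st [:: (b, r); (~~ b, r)]) r
   + chamber st r.+1 * chamber st r.-1.
Proof.
move=> ps /=; rewrite andbT => /andP[ok1]; rewrite applicable_other; last by case: b ok1.
move=> ok2; case: r ok1 ok2 => // q /= ok1 ok2.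
have D0 : chamber st q != 0.
  by apply: nondeg => //; move: ok1; rewrite /applicable /= => /andP[/ltnW/ltnW].
have R : (st true q < st true q.+1)%N /\ (st false q.+1 < st false q)%N.
  by move: ok1 ok2; rewrite /applicable /=; case: (b) => /= /andP[_ ->] /andP[_ ->].
have := @lewis_carroll _ A (st true) (st false) q D0 R.1 R.2.
by case: b ok1 ok2 => _ _ E; rewrite /chamber /endst /move_st /= ?E // mulrC E.
Qed.

(** The relation [three_term], for three exchanges in the same component; for the
    columns, in the transposed matrix. *)
Lemma chamber_braid st b r : perm_state k st ->
  (0 < r)%N -> (r.+1 < k)%N -> asc b (st b r.-1) (st b r) -> asc b (st b r) (st b r.+1) ->
  chamber (endst st [:: (b, r)]) r * chamber (endst st [:: (b, r.+1)]) r.+1 =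
  chamber st r * chamber (endst st [:: (b, r); (b, r.+1)]) r.+1
   + chamber st r.+1 * chamber (endst st [:: (b, r); (b, r.+1); (b, r)]) r.
Proof.
move=> ps; case: r => // q _ rk /= a1 a2; have a3 := asc_trans a1 a2.
have D0 : chamber st q != 0 by apply: nondeg => //; lia.
case: b a1 a2 a3 => /= a1 a2 a3.
  have := @three_term _ A (st true) (st false) q D0.
  by apply; rewrite ltnNge ltnW //= ltnNge ltnW.
have := @three_term _ (fun i j => A j i) (st false) (st true) q.
by rewrite sminor_tr => /(_ D0); rewrite a1 a2 a3 => /(_ erefl erefl) /=; rewrite !(sminor_tr A).
Qed.

End Geometry.

(** * Elementary moves as mutations of labelled paths *)

Section Windows.
Variables (F : fieldType) (k : nat) (A : nat -> nat -> F).
Local Notation flags := (flags k A).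
Local Notation labelled := (labelled A).
Local Notation chamber := (chamber A).
Hypothesis nondeg : forall st r, perm_state k st -> (r <= k)%N -> chamber st r != 0.

(** The chambers opened by w and those open at its beginning have different
    labels. *)
Definition fresh (cur : nat -> nat) (w : seq dletter) : Prop :=
  [/\ uniq (new_labels w), forall r, cur r \notin new_labels w
    & forall r s, (r <= k)%N -> (s <= k)%N -> cur r = cur s -> r = s].

Lemma fresh_step cur s w : fresh cur (s :: w) -> fresh (cur_step cur s) w.
Proof.
case: s => [[b r] l] [/= /andP[lw uw] cw inj]; split=> // [i|i j ik jk].
  rewrite /cur_step /upd /=; case: (i == r) => //.
  by have := cw i; rewrite inE negb_or => /andP[].
have cl i' : cur i' != l by have := cw i'; rewrite inE negb_or => /andP[].
rewrite /cur_step /upd /=; case: eqVneq => [->|ir]; case: eqVneq => [->|jr] //.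
- by move=> /esym/eqP; rewrite (negbTE (cl j)).
- by move=> /eqP; rewrite (negbTE (cl i)).
- exact: inj.
Qed.

Lemma fresh_catr cur w1 w2 : fresh cur (w1 ++ w2) -> fresh (end_cur cur w1) w2.
Proof. by elim: w1 cur => //= s w1 IH cur /fresh_step/IH. Qed.

Lemma fresh_catl cur w1 w2 : fresh cur (w1 ++ w2) -> fresh cur w1.
Proof.
rewrite /fresh /new_labels map_cat cat_uniq => -[/and3P[u _ _] c i]; split=> // r.
by have := c r; rewrite mem_cat negb_or => /andP[].
Qed.

(** y is obtained from f l by an exchange with two quadratic monomials that is
    compatible with the matrices W and W'. *)
Definition exchange_rel (f : nat -> F) (W W' : nat -> nat -> int) (l : nat) (y : F) :=
  exists p1 p2 q1 q2, [/\ uniq [:: p1; p2; q1; q2],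
    y * f l = f p1 * f p2 + f q1 * f q2,
    forall x, W x l = column4 p1 p2 q1 q2 x & forall x z, W' x z = mutate_fun W l x z].

Lemma exchange_window f cur w w' l y p1 p2 q1 q2 : uniq [:: p1; p2; q1; q2] ->
  y * f l = f p1 * f p2 + f q1 * f q2 ->
  (forall x, quiver cur w x l = column4 p1 p2 q1 q2 x) ->
  (forall x, quiver cur w' x l = - column4 p1 p2 q1 q2 x) ->
  (forall x z, x != l -> z != l -> quiver cur w' x z = quiver cur w x z +
     (arrow p1 q1 x z + arrow p1 q2 x z + arrow p2 q1 x z + arrow p2 q2 x z)) ->
  exchange_rel f (quiver cur w) (quiver cur w') l y.
Proof.
move=> u e c c' h; exists p1, p2, q1, q2; split=> //.
by apply: (mutate_fun_window u) => // x z; apply: quiver_skew.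
Qed.

(** The elementary move lifts to the labelled path w: the new path has the same
    labels, leaves the same chambers open, and either has the same quiver and
    variables or differs by a mutation at a chamber l that it closes. *)
Definition lifted f st cur w win' := exists w',
  [/\ erase w' = win', perm_eq (new_labels w') (new_labels w),
      end_cur cur w' = end_cur cur w &
      (labelled f st w' /\ quiver cur w' =2 quiver cur w) \/
      exists l y, [/\ l \in new_labels w, forall r, end_cur cur w r != l, f l != 0,
        exchange_rel f (quiver cur w) (quiver cur w') l y
      & labelled (upd f l y) st w']].

(** The triangles are the same in another order, except for letters of different
    colours at neighbouring levels.  In this case the triangles have a common edge
    with opposite orientations, which cancels, and the two orders give the two
    triangulations of the same square. *)
Lemma lift_comm f st cur (a b : letter) la lb : commuting a b -> perm_state k st ->
  valid k st [:: a; b] -> labelled f st [:: (a, la); (b, lb)] ->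
  lifted f st cur [:: (a, la); (b, lb)] [:: b; a].
Proof.
move=> fab ps v [fa [fb _]].
have fba : commuting b a.
  by move: fab; rewrite /commuting [b.1 == _]eq_sym [b.2 == _]eq_sym => /or3P[]->; rewrite ?orbT.
have ab2 : a.2 != b.2 by move: fab; rewrite /commuting => /or3P[/andP[]|h|h] //; apply/eqP; lia.
have [a0 b0] : (0 < a.2)%N /\ (0 < b.2)%N.
  by move: v; rewrite /= applicable_commuting // => /and3P[/andP[/andP[-> _] _] /andP[/andP[-> _] _] _].
have ak : (0 < a.2 < k)%N by move: v => /= /andP[/andP[]].
have bk : (0 < b.2 < k)%N by move: v; rewrite /= applicable_commuting // => /and3P[_ /andP[]].
exists [:: (b, lb); (a, la)]; split=> //=.
- by rewrite (perm_catC [:: lb] [:: la]).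
- apply/funext => i; rewrite /end_cur /= /cur_step /upd /=.
  by case: (eqVneq i a.2) => // ->; rewrite (negbTE ab2).
left; split.
  split; last split=> //.
    by rewrite fb (@move_comm _ a b) ?fab // (@chamber_move _ k) //; apply: perm_move.
  rewrite fa -(@chamber_move _ k A (move_st st a) b) //; first by rewrite (@move_comm _ a b) ?fab.
    exact: perm_move.
  by rewrite eq_sym.
move=> x y; case: a b fab fba ab2 a0 b0 {v ak bk fa fb} => [c r] [d s].
rewrite /commuting /= => fab fba rs r0 s0.
rewrite /cur_step /= !addr0 /upd.
have e1 : (r == s) = false by apply/negbTE.
have e2 : (s == r) = false by rewrite eq_sym.
case: (eqVneq c d) fab {fba} => [<-{d} fab|cd _].
  have e3 : (r.+1 == s) = false by lia.
  have e4 : (s.+1 == r) = false by lia.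
  have e5 : (r.-1 == s) = false by lia.
  have e6 : (s.-1 == r) = false by lia.
  by case: c {fab}; rewrite ?(e1, e2, e3, e4, e5, e6) addrC.
have {cd} -> : d = ~~ c by case: c d cd => [] [].
have n1 m : (m.+1 == m) = false by lia.
have n2 m : (m == m.+1) = false by lia.
rewrite /triangle /arrow; case: c.
  case: (eqVneq s r.+1) => [->|h1]; first by rewrite /= !eqxx ?(n1, n2); ring.
  have e3 : (r.+1 == s) = false by rewrite eq_sym; apply/negbTE.
  have e4 : (s.-1 == r) = false by lia.
  by rewrite ?(e1, e2, e3, e4); ring.
case: (eqVneq r s.+1) => [->|h1]; first by rewrite /= !eqxx ?(n1, n2); ring.
have e3 : (s.+1 == r) = false by rewrite eq_sym; apply/negbTE.
have e4 : (r.-1 == s) = false by lia.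
by rewrite ?(e1, e2, e3, e4); ring.
Qed.

(** The chamber between the two exchanges is mutated; its neighbours are the
    chambers before and after it, and those above and below. *)
Lemma lift_cross f st cur b r l1 l2 : perm_state k st ->
  valid k st [:: (b, r); (~~ b, r)] -> flags f cur st ->
  labelled f st [:: ((b, r), l1); (~~ b, r, l2)] ->
  fresh cur [:: ((b, r), l1); (~~ b, r, l2)] ->
  lifted f st cur [:: ((b, r), l1); (~~ b, r, l2)] [:: (~~ b, r); (b, r)].
Proof.
move=> ps v fl [f1 [f2 _]] fr.
have vk : (0 < r < k)%N by move: v => /= /andP[/andP[]].
have := chamber_cross nondeg ps v.
case: r vk v fl f1 f2 fr => // q vk v fl f1 f2 [u cn inj] /= E.
have c1 i : (cur i == l1) = false by apply/negbTE; have := cn i; rewrite !inE negb_or => /andP[].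
have c2 i : (cur i == l2) = false by apply/negbTE; have := cn i; rewrite !inE negb_or => /andP[].
have c12 : (l1 == l2) = false by move: u => /=; rewrite inE andbT => /negbTE.
have c21 : (l2 == l1) = false by rewrite eq_sym.
have d1 i : (l1 == cur i) = false by rewrite eq_sym.
have d2 i : (l2 == cur i) = false by rewrite eq_sym.
have cc i j : (i <= k)%N -> (j <= k)%N -> i != j -> (cur i == cur j) = false.
  by move=> ik jk ij; apply/eqP => /inj e; rewrite e ?eqxx in ij.
have n1 m : (m.+1 == m) = false by lia.
have n2 m : (m == m.+1) = false by lia.
have q2k : (q.+2 <= k)%N by lia.
have q1k := ltnW q2k; have qk := ltnW q1k.
have k01 : (cur q == cur q.+1) = false by apply: cc; rewrite // n2.
have k12 : (cur q.+1 == cur q.+2) = false by apply: cc; rewrite // n2.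
have k02 : (cur q == cur q.+2) = false by apply: cc => //; lia.
have k10 : (cur q.+1 == cur q) = false by rewrite eq_sym.
have k21 : (cur q.+2 == cur q.+1) = false by rewrite eq_sym.
have k20 : (cur q.+2 == cur q) = false by rewrite eq_sym.
exists [:: (~~ b, q.+1, l1); (b, q.+1, l2)]; split=> //.
right; exists l1, (chamber (move_st st (~~ b, q.+1)) q.+1); split.
- by rewrite !inE eqxx.
- by move=> i; rewrite /end_cur /cur_step /upd /=; case: (i == q.+1); rewrite ?c21 ?c1.
- by rewrite f1; apply: nondeg => //; apply: perm_move.
- case: (b) f1 f2 E => f1 f2 E.
    apply: (@exchange_window _ _ _ _ _ _ (cur q.+1) l2 (cur q.+2) (cur q)).
    + by rewrite !cons_uniq !inE !(c2, d2, k12, k20, k10).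
    + by rewrite mulrC f1 f2 E !fl.
    + move=> x; rewrite /column4 /cur_step /upd /= /cur_step /upd /= /triangle /arrow.
      by rewrite !(eqxx, n1, n2, c1, c2, c12, c21, d1, d2) /=; ring.
    + move=> x; rewrite /column4 /cur_step /upd /= /cur_step /upd /= /triangle /arrow.
      by rewrite !(eqxx, n1, n2, c1, c2, c12, c21, d1, d2) /=; ring.
    + move=> x y /negbTE xl /negbTE yl.
      rewrite /cur_step /upd /= /cur_step /upd /= /triangle /arrow.
      by rewrite !(eqxx, n1, n2, xl, yl) /=; ring.
  apply: (@exchange_window _ _ _ _ _ _ (cur q.+2) (cur q) (cur q.+1) l2).
  + by rewrite !cons_uniq !inE !(c2, d2, k21, k12, k20, k10, k02, k01).
  + by rewrite mulrC f1 f2 E !fl // addrC.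
  + move=> x; rewrite /column4 /cur_step /upd /= /cur_step /upd /= /triangle /arrow.
    by rewrite !(eqxx, n1, n2, c1, c2, c12, c21, d1, d2) /=; ring.
  + move=> x; rewrite /column4 /cur_step /upd /= /cur_step /upd /= /triangle /arrow.
    by rewrite !(eqxx, n1, n2, c1, c2, c12, c21, d1, d2) /=; ring.
  + move=> x y /negbTE xl /negbTE yl.
    rewrite /cur_step /upd /= /cur_step /upd /= /triangle /arrow.
    by rewrite !(eqxx, n1, n2, xl, yl) /=; ring.
- rewrite /= updE updN ?c21 // f2; split=> //; split=> //.
  by rewrite (@move_comm _ (~~ b, q.+1)) //= orbC; case: (b).
Qed.

(** The bounded chamber of the braid is mutated.  It keeps the label l1;
    the chambers l2 and l3, which stay open, are opened in the other order. *)
Lemma lift_braid f st cur b r l1 l2 l3 : perm_state k st ->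
  valid k st [:: (b, r); (b, r.+1); (b, r)] -> flags f cur st ->
  labelled f st [:: ((b, r), l1); ((b, r.+1), l2); ((b, r), l3)] ->
  fresh cur [:: ((b, r), l1); ((b, r.+1), l2); ((b, r), l3)] ->
  lifted f st cur [:: ((b, r), l1); ((b, r.+1), l2); ((b, r), l3)]
    [:: (b, r.+1); (b, r); (b, r.+1)].
Proof.
move=> ps v fl [f1 [f2 [f3 _]]] fr.
have [|r0 rk a1 a2] := @braid_validE k st b r; first by rewrite v.
have E := chamber_braid nondeg ps r0 rk a1 a2.
have mb := move_braid st b r0.
case: r r0 rk v fl {a1 a2} f1 f2 f3 fr E mb => // q _ rk v fl f1 f2 f3 [u cn inj] E mb.
have c1 i : (cur i == l1) = false by apply/negbTE; have := cn i; rewrite !inE !negb_or => /and3P[].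
have c2 i : (cur i == l2) = false by apply/negbTE; have := cn i; rewrite !inE !negb_or => /and3P[].
have c3 i : (cur i == l3) = false by apply/negbTE; have := cn i; rewrite !inE !negb_or => /and3P[].
have [c12 c13 c23] : [/\ (l1 == l2) = false, (l1 == l3) = false & (l2 == l3) = false].
  by move: u => /=; rewrite !inE negb_or => /and3P[/andP[/negbTE -> /negbTE ->] /negbTE -> _].
have c21 : (l2 == l1) = false by rewrite eq_sym.
have c31 : (l3 == l1) = false by rewrite eq_sym.
have c32 : (l3 == l2) = false by rewrite eq_sym.
have d1 i : (l1 == cur i) = false by rewrite eq_sym.
have d2 i : (l2 == cur i) = false by rewrite eq_sym.
have d3 i : (l3 == cur i) = false by rewrite eq_sym.
have n1 m : (m.+1 == m) = false by lia.
have n2 m : (m == m.+1) = false by lia.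
have n3 m : (m.+2 == m) = false by lia.
have n4 m : (m == m.+2) = false by lia.
have q2k : (q.+2 <= k)%N by lia.
have k12 : (cur q.+1 == cur q.+2) = false by apply/eqP => /inj e; have := e (ltnW q2k) q2k; lia.
have k21 : (cur q.+2 == cur q.+1) = false by rewrite eq_sym.
exists [:: (b, q.+2, l1); (b, q.+1, l3); (b, q.+2, l2)]; split=> //.
- by rewrite /new_labels /= perm_cons (perm_catC [:: l3] [:: l2]).
- apply/funext => i; rewrite /end_cur /= /cur_step /upd /=.
  by case: (eqVneq i q.+2) => [->|_]; rewrite ?n1 //; case: (i == q.+1).
right; exists l1, (chamber (move_st st (b, q.+2)) q.+2); split.
- by rewrite !inE eqxx.
- move=> i; rewrite /end_cur /cur_step /upd /=.
  by case: (i == q.+1); rewrite ?c31 //; case: (i == q.+2); rewrite ?c21 ?c1.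
- by rewrite f1; apply: nondeg; [apply: perm_move => //=; lia | exact: ltnW].
- case: (b) f1 f2 f3 E => f1 f2 f3 E.
    apply: (@exchange_window _ _ _ _ _ _ (cur q.+1) l2 (cur q.+2) l3).
    + by rewrite !cons_uniq !inE !(c2, c3, d2, c23, k12).
    + by rewrite [LHS]mulrC f1 f2 f3 (fl _ q2k) (fl _ (ltnW q2k)); exact: E.
    + move=> x; rewrite /column4 /= /cur_step /upd /= /triangle /arrow.
      by rewrite !(eqxx, n1, n2, n3, n4, c1, c2, c3, c12, c13, c21, c31, d1) /=; ring.
    + move=> x; rewrite /column4 /= /cur_step /upd /= /triangle /arrow.
      by rewrite !(eqxx, n1, n2, n3, n4, c1, c2, c3, c12, c13, c21, c31, d1) /=; ring.
    + move=> x y /negbTE xl /negbTE yl.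
      rewrite /= /cur_step /upd /= /triangle /arrow.
      by rewrite !(eqxx, n1, n2, n3, n4, xl, yl) /=; ring.
  apply: (@exchange_window _ _ _ _ _ _ (cur q.+2) l3 (cur q.+1) l2).
  + by rewrite !cons_uniq !inE !(c2, c3, d3, c32, k21).
  + by rewrite [LHS]mulrC [RHS]addrC f1 f2 f3 (fl _ q2k) (fl _ (ltnW q2k)); exact: E.
  + move=> x; rewrite /column4 /= /cur_step /upd /= /triangle /arrow.
    by rewrite !(eqxx, n1, n2, n3, n4, c1, c2, c3, c12, c13, c21, c31, d1) /=; ring.
  + move=> x; rewrite /column4 /= /cur_step /upd /= /triangle /arrow.
    by rewrite !(eqxx, n1, n2, n3, n4, c1, c2, c3, c12, c13, c21, c31, d1) /=; ring.
  + move=> x y /negbTE xl /negbTE yl.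
    rewrite /= /cur_step /upd /= /triangle /arrow.
    by rewrite !(eqxx, n1, n2, n3, n4, xl, yl) /=; ring.
- have vk : (0 < q.+1 < k)%N by lia.
  have vk2 : (0 < q.+2 < k)%N by lia.
  rewrite /= updE !updN ?c21 ?c31 // f2 f3; split=> //; split.
    transitivity (chamber (endst st [:: (b, q.+2); (b, q.+1); (b, q.+2)]) q.+1).
      by rewrite -mb.
    by rewrite /= (@chamber_move _ k) ?n1 //; apply: perm_move => //; apply: perm_move.
  split=> //.
  transitivity (chamber (endst st [:: (b, q.+1); (b, q.+2); (b, q.+1)]) q.+2).
    by rewrite /= [RHS](@chamber_move _ k) ?n2 //; apply: perm_move => //; apply: perm_move.
  by rewrite mb.
Qed.

Lemma lift_braid' f st cur b r l1 l2 l3 : perm_state k st ->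
  valid k st [:: (b, r.+1); (b, r); (b, r.+1)] -> flags f cur st ->
  labelled f st [:: ((b, r.+1), l1); ((b, r), l2); ((b, r.+1), l3)] ->
  fresh cur [:: ((b, r.+1), l1); ((b, r), l2); ((b, r.+1), l3)] ->
  lifted f st cur [:: ((b, r.+1), l1); ((b, r), l2); ((b, r.+1), l3)]
    [:: (b, r); (b, r.+1); (b, r)].
Proof.
move=> ps v fl [f1 [f2 [f3 _]]] fr.
have [|r0 rk a1 a2] := @braid_validE k st b r; first by rewrite v orbT.
have E := chamber_braid nondeg ps r0 rk a1 a2.
have mb := move_braid st b r0.
case: r r0 rk v fl {a1 a2} f1 f2 f3 fr E mb => // q _ rk v fl f1 f2 f3 [u cn inj] E mb.
have vk : (0 < q.+1 < k)%N by lia.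
have vk2 : (0 < q.+2 < k)%N by lia.
have n1 m : (m.+1 == m) = false by lia.
have n2 m : (m == m.+1) = false by lia.
have n3 m : (m.+2 == m) = false by lia.
have n4 m : (m == m.+2) = false by lia.
have f2' : f l2 = chamber (endst st [:: (b, q.+1); (b, q.+2); (b, q.+1)]) q.+1.
  by rewrite f2 mb /= [RHS](@chamber_move _ k) ?n1 //; apply: perm_move => //; apply: perm_move.
have f3' : f l3 = chamber (endst st [:: (b, q.+1); (b, q.+2)]) q.+2.
  transitivity (chamber (endst st [:: (b, q.+1); (b, q.+2); (b, q.+1)]) q.+2).
    by rewrite mb.
  by rewrite /= (@chamber_move _ k) ?n2 //; apply: perm_move => //; apply: perm_move.
have c1 i : (cur i == l1) = false by apply/negbTE; have := cn i; rewrite !inE !negb_or => /and3P[].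
have c2 i : (cur i == l2) = false by apply/negbTE; have := cn i; rewrite !inE !negb_or => /and3P[].
have c3 i : (cur i == l3) = false by apply/negbTE; have := cn i; rewrite !inE !negb_or => /and3P[].
have [c12 c13 c23] : [/\ (l1 == l2) = false, (l1 == l3) = false & (l2 == l3) = false].
  by move: u => /=; rewrite !inE negb_or => /and3P[/andP[/negbTE -> /negbTE ->] /negbTE -> _].
have c21 : (l2 == l1) = false by rewrite eq_sym.
have c31 : (l3 == l1) = false by rewrite eq_sym.
have c32 : (l3 == l2) = false by rewrite eq_sym.
have d1 i : (l1 == cur i) = false by rewrite eq_sym.
have d2 i : (l2 == cur i) = false by rewrite eq_sym.
have d3 i : (l3 == cur i) = false by rewrite eq_sym.
have q2k : (q.+2 <= k)%N by lia.
have k12 : (cur q.+1 == cur q.+2) = false by apply/eqP => /inj e; have := e (ltnW q2k) q2k; lia.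
have k21 : (cur q.+2 == cur q.+1) = false by rewrite eq_sym.
exists [:: (b, q.+1, l1); (b, q.+2, l3); (b, q.+1, l2)]; split=> //.
- by rewrite /new_labels /= perm_cons (perm_catC [:: l3] [:: l2]).
- apply/funext => i; rewrite /end_cur /= /cur_step /upd /=.
  by case: (eqVneq i q.+2) => [->|_]; rewrite ?n1 //; case: (i == q.+1).
right; exists l1, (chamber (move_st st (b, q.+1)) q.+1); split.
- by rewrite !inE eqxx.
- move=> i; rewrite /end_cur /cur_step /upd /=.
  by case: (i == q.+2); rewrite ?c31 //; case: (i == q.+1); rewrite ?c21 ?c1.
- by rewrite f1; apply: nondeg; [apply: perm_move => //=; lia | exact: ltnW].
- case: (b) f1 f2' f3' E => f1 f2' f3' E.
    apply: (@exchange_window _ _ _ _ _ _ (cur q.+2) l2 (cur q.+1) l3).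
    + by rewrite !cons_uniq !inE !(c2, c3, d2, c23, k21).
    + by rewrite [RHS]addrC f1 f2' f3' (fl _ q2k) (fl _ (ltnW q2k)); exact: E.
    + move=> x; rewrite /column4 /= /cur_step /upd /= /triangle /arrow.
      by rewrite !(eqxx, n1, n2, n3, n4, c1, c2, c3, c12, c13, c21, c31, d1) /=; ring.
    + move=> x; rewrite /column4 /= /cur_step /upd /= /triangle /arrow.
      by rewrite !(eqxx, n1, n2, n3, n4, c1, c2, c3, c12, c13, c21, c31, d1) /=; ring.
    + move=> x y /negbTE xl /negbTE yl.
      rewrite /= /cur_step /upd /= /triangle /arrow.
      by rewrite !(eqxx, n1, n2, n3, n4, xl, yl) /=; ring.
  apply: (@exchange_window _ _ _ _ _ _ (cur q.+1) l3 (cur q.+2) l2).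
  + by rewrite !cons_uniq !inE !(c2, c3, d3, c32, k12).
  + by rewrite f1 f2' f3' (fl _ q2k) (fl _ (ltnW q2k)); exact: E.
  + move=> x; rewrite /column4 /= /cur_step /upd /= /triangle /arrow.
    by rewrite !(eqxx, n1, n2, n3, n4, c1, c2, c3, c12, c13, c21, c31, d1) /=; ring.
  + move=> x; rewrite /column4 /= /cur_step /upd /= /triangle /arrow.
    by rewrite !(eqxx, n1, n2, n3, n4, c1, c2, c3, c12, c13, c21, c31, d1) /=; ring.
  + move=> x y /negbTE xl /negbTE yl.
    rewrite /= /cur_step /upd /= /triangle /arrow.
    by rewrite !(eqxx, n1, n2, n3, n4, xl, yl) /=; ring.
- by rewrite /= updE !updN ?c21 ?c31 // f2' f3'.
Qed.

Lemma lift_elem f st cur w win' : elementary (erase w) win' -> perm_state k st ->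
  valid k st (erase w) -> flags f cur st -> labelled f st w -> fresh cur w ->
  lifted f st cur w win'.
Proof.
move=> e ps v fl lw fr; move ewE: (erase w) e v => ew e.
case: e w lw fr ewE => [a b fab|b r|b r|b r] [|[a1 l1] [|[a2 l2] [|[a3 l3] [|? ?]]]] //=.
- move=> lw fr [e1 e2] v; subst a1 a2; by apply: lift_comm.
- move=> lw fr [e1 e2] v; subst a1 a2; by apply: lift_cross.
- move=> lw fr [e1 e2 e3] v; subst a1 a2 a3; by apply: lift_braid.
- move=> lw fr [e1 e2 e3] v; subst a1 a2 a3; by apply: lift_braid'.
Qed.

End Windows.

(** * Seeds of paths *)

(** The parts of the quiver that do not meet l are not changed by a mutation at
    l. *)
Lemma mutate_fun_add (P W Q : nat -> nat -> int) l x y :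
  (forall z, P z l = 0) -> (forall z, P l z = 0) ->
  (forall z, Q z l = 0) -> (forall z, Q l z = 0) ->
  mutate_fun (fun a b => P a b + (W a b + Q a b)) l x y = P x y + (mutate_fun W l x y + Q x y).
Proof.
move=> Pr Pl Qr Ql; rewrite /mutate_fun.
have [->|xl] := eqVneq x l; first by rewrite Pl Ql !(add0r, addr0).
have [->|yl] := eqVneq y l; first by rewrite /= Pr Qr !(add0r, addr0).
by rewrite /= Pr Qr Pl Ql !(add0r, addr0); ring.
Qed.

Lemma quiver_met cur w x y : quiver cur w x y != 0 ->
  (exists r, cur r = x) \/ x \in new_labels w.
Proof.
move=> q0; have [xw|xw] := boolP (x \in new_labels w); [by right|left].
apply: contrapT => no; move/eqP: q0; apply; apply: quiver_out => // r.
by apply/eqP => e; apply: no; exists r.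
Qed.

Lemma erase_cat w u1 u2 : erase w = u1 ++ u2 ->
  exists w1 w2, [/\ w = w1 ++ w2, erase w1 = u1 & erase w2 = u2].
Proof.
move=> e; exists (take (size u1) w), (drop (size u1) w).
by rewrite cat_take_drop /erase map_take map_drop -/(erase w) e take_size_cat // drop_size_cat.
Qed.

Lemma prod_indicator (F : fieldType) N (f : nat -> F) a :
  \prod_(h < N) f h ^+ (h == a :> nat) = if (a < N)%N then f a else 1.
Proof.
case: ifP => aN.
  rewrite (bigD1 (Ordinal aN)) //= eqxx expr1 big1 ?mulr1 // => h.
  by rewrite -val_eqE /= => /negbTE ->.
by rewrite big1 // => h _; have := ltn_ord h; case: eqP => // ->; rewrite aN.
Qed.

Section Seeds.
Variables (F : fieldType) (k : nat) (A : nat -> nat -> F) (n p : nat).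
Local Notation flags := (flags k A).
Local Notation labelled := (labelled A).
Local Notation chamber := (chamber A).
Local Notation fresh := (fresh k).
Hypothesis nondeg : forall st r, perm_state k st -> (r <= k)%N -> chamber st r != 0.
Variables (cur : nat -> nat) (st : state).
Hypothesis ps : perm_state k st.
Hypothesis cur0 : cur 0 = (n + p)%N.
Hypothesis cur_le : forall r, (cur r <= n + p)%N.

(** The label n + p is reserved for the constant chamber of level 0, which is not
    a variable of the seed; the chambers that are closed by the path are
    mutable. *)
Definition in_range (w : seq dletter) : Prop :=
  (forall l, l \in new_labels w -> (l < n + p)%N) /\
  (forall l, l \in new_labels w -> (forall r, end_cur cur w r != l) -> (l < n)%N).

Definition path_fits (w : seq dletter) :=
  [/\ valid k st (erase w), fresh cur w & in_range w].

(** The variables of the seed are the chamber minors of the path, its matrix is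
    the quiver of the path. *)
Definition carries (S : labeled_pair F n p) (w : seq dletter) := exists f : nat -> F,
  [/\ forall i, ext_cluster S i = f i, forall i j, ext_mx S i j = quiver cur w i j,
      flags f cur st & labelled f st w].

(** The vertices of the exchange relation are met by the path, so they are
    variables of the seed or the constant 1. *)
Lemma carries_exchange (S : labeled_pair F n p) w (f : nat -> F) l y (ln : (l < n)%N) W' :
  (forall i, ext_cluster S i = f i) -> (forall i j, ext_mx S i j = quiver cur w i j) ->
  f (n + p)%N = 1 -> in_range w -> f l != 0 ->
  exchange_rel f (quiver cur w) W' l y ->
  let S' := mutate S (Ordinal ln) in
  (forall i, ext_cluster S' i = upd f l y i) /\ (forall i j, ext_mx S' i j = W' i j).
Proof.
move=> xE BE f1 [rg _] fl0 [p1 [p2 [q1 [q2 [uq ye cE WE]]]]] S'.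
have met x : quiver cur w x l != 0 -> (if (x < n + p)%N then f x else 1) = f x.
  move=> /quiver_met [[r <-]|/rg ->//].
  by have := cur_le r; rewrite leq_eqVlt => /predU1P[->|->//]; rewrite ltnn f1.
have [met1 met2 met3 met4] : [/\ (if (p1 < n + p)%N then f p1 else 1) = f p1,
   (if (p2 < n + p)%N then f p2 else 1) = f p2, (if (q1 < n + p)%N then f q1 else 1) = f q1
   & (if (q2 < n + p)%N then f q2 else 1) = f q2].
  have nz x : (x == p1) || (x == p2) || (x == q1) || (x == q2) -> quiver cur w x l != 0.
    move=> xx; apply/eqP; rewrite cE => c0; have [] := column4_pos x uq.
    rewrite c0 oppr0 (_ : pos_part 0 = 0%N) //.
    by case: (x == p1) (x == p2) (x == q1) (x == q2) xx => [] [] [] [].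
  by split; apply: met; apply: nz; rewrite eqxx ?orbT.
split=> [i|i j]; last by rewrite WE mutate_mxE !BE /mutate_fun -!val_eqE.
have [->|il] := eqVneq i (lshift p (Ordinal ln)); last first.
  by rewrite mutate_off // xE updN //; apply: contraNneq il => e; apply/eqP/val_inj.
rewrite mutate_at updE; apply: (mulIf fl0); rewrite ye xE /= divfK //.
congr (_ + _).
  rewrite /col_plus -met1 -met2 -!prod_indicator -big_split /=.
  by apply: eq_bigr => h _; rewrite xE BE /= cE (column4_pos h uq).1 exprD.
rewrite /col_minus -met3 -met4 -!prod_indicator -big_split /=.
by apply: eq_bigr => h _; rewrite xE BE /= cE (column4_pos h uq).2 exprD.
Qed.

(** The mutation of a window is a mutation of the whole quiver, since the
    mutated chamber is closed inside the window and has no arrows outside. *)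
Lemma carries_elem S u1 win win' u2 w : elementary win win' -> erase w = u1 ++ win ++ u2 ->
  path_fits w -> carries S w -> exists ls w',
  [/\ erase w' = u1 ++ win' ++ u2, path_fits w', perm_eq (new_labels w') (new_labels w)
    & carries (foldl (@mutate F n p) S ls) w'].
Proof.
move=> e /erase_cat[w1 [w23 [-> e1 /erase_cat[w2 [w3 [-> e2 e3]]]]]].
move=> [v fr [rg mt]] [f [xE BE fl lw]].
have eE : erase (w1 ++ w2 ++ w3) = u1 ++ win ++ u2 by rewrite /erase !map_cat -!/(erase _) e1 e2 e3.
rewrite eE in v; move: (v); rewrite valid_cat => /andP[v1]; rewrite valid_cat => /andP[v2 v3].
move: (lw) => /labelled_cat[lw1 /labelled_cat[lw2 lw3]]; rewrite e1 in lw2; rewrite e1 e2 in lw3.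
have fr23 := fresh_catr fr.
have [v2' ee] := elem_valid e v2.
have ps1 := perm_end v1 ps.
have fl1 : flags f (end_cur cur w1) (endst st u1).
  by rewrite -e1; apply: flags_end; rewrite ?e1.
rewrite -e2 in e v2.
have [w2' [e2' pm ec or]] := lift_elem nondeg e ps1 v2 fl1 lw2 (fresh_catl fr23).
pose w' := w1 ++ w2' ++ w3.
have pm' : perm_eq (new_labels w') (new_labels (w1 ++ w2 ++ w3)).
  by rewrite /w' /new_labels !map_cat perm_cat2l perm_cat2r.
have ec' : end_cur cur w' = end_cur cur (w1 ++ w2 ++ w3) by rewrite !end_cur_cat ec.
have eE' : erase w' = u1 ++ win' ++ u2 by rewrite /erase !map_cat -!/(erase _) e1 e2' e3.
have ok' : path_fits w'.
  split.
  - by rewrite eE' valid_cat v1 valid_cat v2' /= ee.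
  - case: fr => uq cw inj; split=> //; first by rewrite (perm_uniq pm').
    by move=> r; rewrite (perm_mem pm').
  - by split=> l; rewrite (perm_mem pm') ?ec'; [apply: rg | apply: mt].
have f1 : f (n + p)%N = 1 by rewrite -cur0 fl // /chamber sminor0.
case: or => [[lw' qE]|[l [y [l2 endl fl0 ex lw']]]].
  exists [::], w'; split=> //; exists f; split=> //.
  - by move=> i j; rewrite BE !quiver_cat ec qE.
  - apply/labelled_cat; rewrite e1; split=> //; apply/labelled_cat; rewrite e2'; split=> //.
    by rewrite ee.
have lin : l \in new_labels (w1 ++ w2 ++ w3).
  by rewrite /new_labels !map_cat !mem_cat -!/(new_labels _) l2 orbT.
have [l1 l3] : l \notin new_labels w1 /\ l \notin new_labels w3.
  case: fr => + _ _; rewrite /new_labels !map_cat -!/(new_labels _) !cat_uniq.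
  move=> /and3P[_ h1 /and3P[_ h2 _]]; split.
    by apply: contra h1 => h; apply/hasP; exists l => //; rewrite mem_cat l2.
  by apply: contra h2 => h; apply/hasP; exists l.
have curl r : cur r != l by case: fr => _ /(_ r) + _; apply: contraNneq => ->.
have endw r : end_cur cur (w1 ++ w2 ++ w3) r != l.
  by rewrite !end_cur_cat; apply: end_cur_out.
have ln : (l < n)%N by apply: mt.
have P0 z : quiver cur w1 l z = 0 by apply: quiver_out.
have Q0 z : quiver (end_cur (end_cur cur w1) w2) w3 l z = 0 by apply: quiver_out.
have P0' z : quiver cur w1 z l = 0 by rewrite quiver_skew P0 oppr0.
have Q0' z : quiver (end_cur (end_cur cur w1) w2) w3 z l = 0 by rewrite quiver_skew Q0 oppr0.
have ex' : exchange_rel f (quiver cur (w1 ++ w2 ++ w3)) (quiver cur w') l y.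
  case: ex => p1 [p2 [q1 [q2 [uq ye cE WE]]]]; exists p1, p2, q1, q2; split=> //.
    by move=> x; rewrite !quiver_cat P0' Q0' add0r addr0 cE.
  move=> x z; rewrite !quiver_cat WE ec -mutate_fun_add //.
  by rewrite /mutate_fun !quiver_cat.
have [xE' BE'] := carries_exchange ln xE BE f1 (conj rg mt) fl0 ex'.
exists [:: Ordinal ln], w'; split=> //; exists (upd f l y); split=> //.
- by move=> r rk; rewrite updN ?fl //; apply: curl.
- apply/labelled_cat; rewrite e1; split.
    by apply: eq_labelled lw1 => x xw; rewrite updN //; apply: contraNneq l1 => <-.
  apply/labelled_cat; rewrite e2'; split=> //; rewrite ee.
  by apply: eq_labelled lw3 => x xw; rewrite updN //; apply: contraNneq l3 => <-.
Qed.

Theorem carries_rewr S w t : rewr (erase w) t -> path_fits w -> carries S w ->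
  exists ls w', [/\ erase w' = t, path_fits w', perm_eq (new_labels w') (new_labels w)
    & carries (foldl (@mutate F n p) S ls) w'].
Proof.
move=> r; move eE: (erase w) r => ew r; elim: r S w eE => [u|u1 win win' u2 t' e _ IH] S w eE applicable cw.
  by exists [::], w.
have [ls [w' [e' ok' pm' cw']]] := carries_elem e eE applicable cw.
have [ls' [w'' [e'' ok'' pm'' cw'']]] := IH _ _ e' ok' cw'.
exists (ls ++ ls'), w''; rewrite foldl_cat; split=> //.
exact: perm_trans pm'' pm'.
Qed.

End Seeds.

(** * Rank of the quiver and labels of the initial path *)

Section Rank.
Implicit Types (v : nat -> int) (cur : nat -> nat) (w : seq dletter).

(** The product of the matrix of an arrow with the vector v, and similarly for
    triangles and quivers. *)
Definition arrow_act v a b x : int := (x == a)%:Z * v b - (x == b)%:Z * v a.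
Definition triangle_act v a b c x : int :=
  arrow_act v a b x + arrow_act v b c x + arrow_act v c a x.

Definition step_act v cur (s : dletter) : nat -> int :=
  let: ((b, r), l) := s in
  if b then triangle_act v (cur r) l (cur r.+1) else triangle_act v l (cur r) (cur r.-1).

Fixpoint quiver_act v cur w (x : nat) : int :=
  if w is s :: w' then step_act v cur s x + quiver_act v (cur_step cur s) w' x else 0.

Lemma sum_indicator M v a : (forall y, (M <= y)%N -> v y = 0) ->
  \sum_(y < M) (y == a :> nat)%:Z * v y = v a.
Proof.
move=> v0; have [Ma|aM] := leqP M a.
  by rewrite v0 // big1 // => y _; have := ltn_ord y; case: eqP => [->|]; rewrite ?mul0r //; lia.
rewrite (bigD1 (Ordinal aM)) //= eqxx mul1r big1 ?addr0 // => h.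
by rewrite -val_eqE /= => /negbTE ->; rewrite mul0r.
Qed.

Lemma arrow_actE M v a b x : (forall y, (M <= y)%N -> v y = 0) ->
  \sum_(y < M) arrow a b x y * v y = arrow_act v a b x.
Proof.
move=> v0; rewrite /arrow_act -(sum_indicator a v0) -(sum_indicator b v0).
by rewrite !mulr_sumr -sumrB; apply: eq_bigr => y _; rewrite /arrow; ring.
Qed.

Lemma triangle_actE M v a b c x : (forall y, (M <= y)%N -> v y = 0) ->
  \sum_(y < M) triangle a b c x y * v y = triangle_act v a b c x.
Proof.
move=> v0; rewrite /triangle_act -!(arrow_actE _ _ _ v0) -!big_split /=.
by apply: eq_bigr => y _; rewrite /triangle; ring.
Qed.

Lemma quiver_actE M v cur w x : (forall y, (M <= y)%N -> v y = 0) ->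
  \sum_(y < M) quiver cur w x y * v y = quiver_act v cur w x.
Proof.
move=> v0; elim: w cur => [|[[b r] l] w IH] cur /=.
  by rewrite big1 // => y _; rewrite mul0r.
under eq_bigr do rewrite mulrDl; rewrite big_split IH /=; congr (_ + _).
by case: b; apply: triangle_actE.
Qed.

Lemma triangle_act_out v a b c x : x != a -> x != b -> x != c -> triangle_act v a b c x = 0.
Proof.
by rewrite /triangle_act /arrow_act => /negbTE -> /negbTE -> /negbTE ->; rewrite !mul0r.
Qed.

Lemma quiver_act0 v cur w x : (forall r, v (cur r) = 0) ->
  (forall l, l \in new_labels w -> v l = 0) -> quiver_act v cur w x = 0.
Proof.
elim: w cur => [|[[b r] l] w IH] cur c0 l0 //=.
have vl : v l = 0 by apply: l0; rewrite inE eqxx.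
rewrite IH ?addr0 => [|s|l' l'w].
- by case: (b); rewrite /triangle_act /arrow_act vl !c0 !mulr0 !subr0.
- by rewrite /cur_step /upd /=; case: (s == r).
- by apply: l0; rewrite inE l'w orbT.
Qed.

(** The matrix is triangular with respect to the order in which the chambers are
    closed: read from the end of the path, the row of a chamber l determines the
    coefficient of the chamber that is closed when l is opened. *)
Lemma quiver_rank k v cur w : fresh k cur w -> (forall s, s \in erase w -> (0 < s.2 < k)%N) ->
  (forall r, v (end_cur cur w r) = 0) ->
  (forall l, l \in new_labels w -> quiver_act v cur w l = 0) ->
  (forall r, v (cur r) = 0) /\ (forall l, l \in new_labels w -> v l = 0).
Proof.
elim: w cur => [|[[b r] l] w IH] cur fr lev end0 act0; first by split.
have /andP[r0 rk] : (0 < r < k)%N by have := lev (b, r); rewrite /= inE eqxx; apply.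
have [/= /andP[lw _] cn inj] := fr.
have cl i : cur i != l by have := cn i; rewrite inE negb_or => /andP[].
have [|||c0 l0] := IH (cur_step cur (b, r, l)) (fresh_step fr).
- by move=> s sw; apply: lev; rewrite /= inE sw orbT.
- exact: end0.
- move=> l' l'w; have := act0 l'; rewrite /= inE l'w orbT => /(_ isT).
  have ll : l' != l by apply: contraNneq lw => <-.
  have cl' i : l' != cur i.
    by have := cn i; rewrite /= inE negb_or => /andP[_]; apply: contraNneq => <-.
  by case: (b); rewrite triangle_act_out // add0r.
have vl : v l = 0 by have := c0 r; rewrite /cur_step /upd /= eqxx.
have vc i : i != r -> v (cur i) = 0.
  by move=> ir; have := c0 i; rewrite /cur_step /upd /= (negbTE ir).
have vr : v (cur r) = 0.
  have lc i : (l == cur i) = false by rewrite eq_sym; apply/negbTE.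
  have := act0 l; rewrite /= inE eqxx => /(_ isT); rewrite quiver_act0 // addr0.
  have vU : v (cur r.+1) = 0 by apply: vc; apply/eqP; lia.
  have vD : v (cur r.-1) = 0 by apply: vc; apply/eqP; lia.
  by case: (b); rewrite /triangle_act /arrow_act !lc eqxx !mul0r !mul1r ?vU ?vD; lia.
split=> [i|x]; first by have [->|ir] := eqVneq i r; [|exact: vc].
by rewrite inE => /predU1P[->|/l0].
Qed.

Lemma full_rank_quiver (F : fieldType) k n p (S : labeled_pair F n p) cur w :
  (forall i j, ext_mx S i j = quiver cur w i j) -> fresh k cur w ->
  (forall s, s \in erase w -> (0 < s.2 < k)%N) ->
  (forall r, (n <= end_cur cur w r)%N) ->
  (forall l, l \in new_labels w -> (l < n + p)%N) ->
  (forall l, (l < n)%N -> l \in new_labels w) ->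
  full_rank S.
Proof.
move=> BE fr lev endn rg mut u hu j.
pose v y := if insub y is Some i then u i else 0.
have vE (i : 'I_n) : v i = u i by rewrite /v valK.
have v0 y : (n <= y)%N -> v y = 0 by rewrite leqNgt => ny; rewrite /v insubN.
have [||_ l0] := @quiver_rank k v cur w fr lev.
- by move=> r; apply: v0.
- move=> l lw; rewrite -(quiver_actE cur w l v0) -{2}(hu (Ordinal (rg l lw))).
  by apply: eq_bigr => y _; rewrite vE BE.
by rewrite -vE; apply/l0/mut.
Qed.

End Rank.

Section Decoration.
Variable k : nat.
Implicit Types (w : seq letter).

Definition levels w : seq nat := map snd w.

(** The number of chambers of the word that are closed again: one for each letter
    that is followed by a letter of the same level. *)
Fixpoint mut_count w : nat :=
  if w is a :: w' then ((a.2 \in levels w') + mut_count w')%N else 0%N.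

Variable n : nat.

(** The labels of the frozen variables: after the mutable ones, those of the
    initial flag, those of the final flag, the determinant, and the constant
    minor of size 0. *)
Definition first_label r := (n + r.-1)%N.
Definition last_label r := (n + k.-1 + r.-1)%N.
Definition det_label := (n + k.-1 + k.-1)%N.
Definition one_label := det_label.+1.

Definition start_cur r : nat :=
  if r == 0%N then one_label else if (r < k)%N then first_label r else det_label.

Lemma start_curP r : [\/ r = 0%N /\ start_cur r = (n + k.-1 + k.-1).+1,
  (0 < r < k)%N /\ start_cur r = (n + r.-1)%N |
  (0 < r)%N && (k <= r)%N /\ start_cur r = (n + k.-1 + k.-1)%N].
Proof.
rewrite /start_cur; case: eqP => [->|/eqP r0]; first by constructor 1.
case: ifP => rk; [constructor 2|constructor 3]; split=> //.
  by rewrite lt0n r0.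
by rewrite lt0n r0 leqNgt rk.
Qed.

(** The chambers that are closed later get the numbers c, c + 1, ...; the last
    chamber of each level gets a frozen label. *)
Fixpoint decorate c w : seq dletter :=
  if w is a :: w' then
    if a.2 \in levels w' then (a, c) :: decorate c.+1 w'
    else (a, last_label a.2) :: decorate c w'
  else [::].

Lemma erase_decorate c w : erase (decorate c w) = w.
Proof. by elim: w c => //= a w IH c; case: ifP => _ /=; rewrite IH. Qed.

Lemma mem_decorate c w l : (l \in new_labels (decorate c w)) =
  (c <= l < c + mut_count w)%N || (l \in map last_label (levels w)).
Proof.
elim: w c => [|a w IH] c /=.
  by rewrite addn0 orbF; apply/esym/negbTE; lia.
case: ifP => aw; rewrite /= inE IH /= inE.
  rewrite addSnnS add1n.
  have [->|lc] := eqVneq l c; first by rewrite leqnn /=; apply/esym; rewrite orbC; case: eqP => //=; lia.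
  rewrite /= ; have [->|ll] := eqVneq l (last_label a.2) => /=.
    by rewrite orbT; apply/orP; right; apply/map_f.
  by congr (_ || _); lia.
by rewrite add0n orbCA.
Qed.

Lemma uniq_decorate c w : (forall s, s \in w -> (0 < s.2 < k)%N) ->
  (c + mut_count w <= n)%N -> uniq (new_labels (decorate c w)).
Proof.
elim: w c => //= a w IH c lev + ; have la := lev a (mem_head _ _).
have lev' s : s \in w -> (0 < s.2 < k)%N by move=> sw; apply: lev; rewrite inE sw orbT.
have last_ge l : l \in map last_label (levels w) -> (n <= l)%N.
  by case/mapP => r _ ->; rewrite /last_label; lia.
case: ifP => aw /= cn; rewrite ?add1n ?add0n in cn; rewrite IH // ?andbT ?mem_decorate; try lia.
  rewrite negb_or; apply/andP; split; first by rewrite ltnn.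
  by apply/negP => /last_ge; lia.
rewrite negb_or; apply/andP; split.
  by apply/negP => /andP[_ h]; rewrite /last_label in h; lia.
apply/mapP => -[r /mapP[s sw ->]] e; have ls := lev' _ sw; move/mapP: aw; apply.
exists s; rewrite // -/(snd a); move: e ls la; rewrite /last_label => e ls la.
by case: a s e ls la {lev lev' last_ge sw} => [? ?] [? ?] /= *; lia.
Qed.

Lemma end_decorate c cur w r :
  end_cur cur (decorate c w) r = if r \in levels w then last_label r else cur r.
Proof.
elim: w c cur => //= a w IH c cur; rewrite inE.
case: ifP => aw; rewrite /end_cur /= -/(end_cur _ _) IH /cur_step /upd /=.
  by have [->|ra] := eqVneq r a.2; rewrite ?aw.
by have [->|ra] := eqVneq r a.2; rewrite ?aw //= eqxx.
Qed.

End Decoration.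

Lemma prefix_stable r st w : (0 < r)%N -> r \notin levels w ->
  (forall i, (st true i < r)%N = (i < r)%N) ->
  forall i, (endst st w true i < r)%N = (i < r)%N.
Proof.
move=> r0; elim: w st => //= a w IH st; rewrite inE negb_or => /andP[ra rw] h.
apply: IH => // i; rewrite /move_st; case: a.1 => //=.
rewrite h; case: a ra => b s /= /eqP rs; rewrite /sw.
case: (eqVneq i s) => [->|_]; first by apply/idP/idP; lia.
by case: (eqVneq i s.-1) => [->|//]; apply/idP/idP; lia.
Qed.

(** The identity can only become the reversal if values cross every level. *)
Lemma all_levels k w : endst (start_st k) w = final_st k ->
  forall r, (0 < r < k)%N -> r \in levels w.
Proof.
move=> e r /andP[r0 rk]; apply: contraT => rw.
have := prefix_stable (st := start_st k) r0 rw (fun i => erefl) 0.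
rewrite e r0 /final_st /start_st /= ifF; last by lia.
by move=> h; exfalso; lia.
Qed.

Section InitialPath.
Variables (k : nat) (w0 : seq letter).
Hypothesis k0 : (0 < k)%N.
Hypothesis v0 : valid k (start_st k) w0.
Hypothesis e0 : endst (start_st k) w0 = final_st k.

Definition mut_number := mut_count w0.
Definition frozen_number := (k.-1 + k.-1)%N.
Definition initial_path := decorate k mut_number 0 w0.
Definition initial_cur := start_cur k mut_number.

Lemma valid_levels (st : state) (w : seq letter) s : valid k st w -> s \in w -> (0 < s.2 < k)%N.
Proof.
elim: w st => //= a w IH st /andP[/andP[ak _] vw]; rewrite inE => /predU1P[->//|].
exact: IH vw.
Qed.

Lemma initial_path_label l : (l \in new_labels initial_path) =
  (l < mut_number)%N || (l \in map (last_label k mut_number) (levels w0)).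
Proof. by rewrite mem_decorate add0n. Qed.

Lemma initial_path_mut l : (l < mut_number)%N -> l \in new_labels initial_path.
Proof. by rewrite initial_path_label => ->. Qed.

Lemma initial_path_last r : (0 < r < k)%N -> last_label k mut_number r \in new_labels initial_path.
Proof.
by move=> rk; rewrite initial_path_label; apply/orP; right; apply/map_f/(all_levels e0).
Qed.

Lemma initial_path_range l : l \in new_labels initial_path -> (l < mut_number + frozen_number)%N.
Proof.
rewrite initial_path_label => /orP[h|/mapP[r /mapP[s sw ->] ->]]; first exact: ltn_addr.
by have := valid_levels v0 sw; rewrite /last_label /frozen_number; move: (s.2) (mut_number) => r1 m h; lia.
Qed.

Lemma initial_path_end r : end_cur initial_cur initial_path r =
  if (0 < r < k)%N then last_label k mut_number r else initial_cur r.
Proof.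
rewrite end_decorate; have [rk|rk] := boolP (0 < r < k)%N; first by rewrite (all_levels e0).
by rewrite ifN //; apply: contra rk => /mapP[s /(valid_levels v0) sk ->].
Qed.

Lemma initial_path_frozen r : (mut_number <= end_cur initial_cur initial_path r)%N.
Proof.
rewrite initial_path_end; case: ifP => rk; rewrite /last_label; first by rewrite -addnA leq_addr.
by rewrite /initial_cur; have [[_ ->]|[_ ->]|[_ ->]] := start_curP k mut_number r; move: (mut_number) => m; lia.
Qed.

Lemma initial_path_fresh : fresh k initial_cur initial_path.
Proof.
split.
- by apply: uniq_decorate => // s; apply: valid_levels v0.
- move=> r; rewrite initial_path_label negb_or; apply/andP; split.
    rewrite -leqNgt /initial_cur; have [[_ ->]|[_ ->]|[_ ->]] := start_curP k mut_number r;
      by move: (mut_number) => m; lia.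
  apply/mapP => -[s /mapP[a /(valid_levels v0) + ->]]; rewrite /initial_cur /last_label.
  move: (a.2) => q qk.
  by have [[h ->]|[h ->]|[h ->]] := start_curP k mut_number r; move: (mut_number) => m e; lia.
- move=> r s rk sk.
  rewrite /initial_cur; have [[h ->]|[h ->]|[h ->]] := start_curP k mut_number r;
  by have [[h' ->]|[h' ->]|[h' ->]] := start_curP k mut_number s; move: (mut_number) => m e; lia.
Qed.

Lemma initial_path_fits : path_fits k mut_number frozen_number.+1 initial_cur (start_st k) initial_path.
Proof.
split; rewrite ?erase_decorate //; first exact: initial_path_fresh.
split=> l lw; first by have := initial_path_range lw; lia.
move=> nl; move: lw; rewrite initial_path_label => /orP[//|/mapP[r /mapP[s /(valid_levels v0) sk ->] e]].
by have := nl s.2; rewrite initial_path_end sk -e eqxx.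
Qed.

Lemma initial_cur_le r : (initial_cur r <= mut_number + frozen_number.+1)%N.
Proof.
by rewrite /initial_cur /frozen_number; have [[h ->]|[h ->]|[h ->]] := start_curP k mut_number r; move: (mut_number) => m; lia.
Qed.

End InitialPath.

(** * Matrices with prescribed chamber minors *)

Definition before (u : nat -> nat) (x y : nat) := exists p q, [/\ (p < q)%N, u p = x & u q = y].

Lemma sw_mono s p q : (p < q)%N -> ~~ ((p == s.-1) && (q == s)) -> (sw s p < sw s q)%N.
Proof.
move=> pq; rewrite /sw negb_and => /orP[/eqP|/eqP]; by do !case: ifP => /eqP; lia.
Qed.

Lemma sw_right r : sw r r = r.-1.
Proof. by rewrite /sw eqxx. Qed.

Lemma sw_left r : (0 < r)%N -> sw r r.-1 = r.
Proof. by rewrite /sw eqxx; case: eqP => //; lia. Qed.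

Section Before.
Variable k : nat.

(** A pair that has been exchanged is never exchanged again. *)
Lemma before_step st a c x y : applicable k st a -> asc c y x ->
  before (st c) x y -> before (move_st st a c) x y.
Proof.
move=> /andP[/andP[a0 ak] oa] cyx [p [q [pq up uq]]]; rewrite /move_st.
case: eqP => [ca|_]; last by exists p, q.
exists (sw a.2 p), (sw a.2 q); rewrite /= !swK; split=> //.
apply: sw_mono => //; apply/negP => /andP[/eqP ps /eqP qs].
by move: oa; rewrite -ca -ps -qs up uq (asc_asym cyx).
Qed.

Lemma before_unstep st a c x y : applicable k st a -> asc c x y ->
  before (move_st st a c) x y -> before (st c) x y.
Proof.
move=> /andP[/andP[a0 ak] oa] cxy; rewrite /move_st; case: eqP => [ca|//] [p [q [pq up uq]]].
exists (sw a.2 p), (sw a.2 q); split=> //.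
apply: sw_mono => //; apply/negP => /andP[/eqP ps /eqP qs].
move: up uq; rewrite /= ps qs /sw eqxx.
have -> : (a.2.-1 == a.2) = false by apply/negbTE; lia.
rewrite eqxx => up uq.
by move: oa; rewrite -ca up uq (asc_asym cxy).
Qed.

(** Dually, a pair that is in order has always been so. *)
Lemma before_unpath st w c x y : valid k st w -> asc c x y ->
  before (endst st w c) x y -> before (st c) x y.
Proof.
elim: w st => //= a w IH st /andP[oka vw] cxy /(IH _ vw cxy).
exact: before_unstep.
Qed.

End Before.

Section Shear.
Variable F : fieldType.
Implicit Types (A : nat -> nat -> F) (u v : nat -> nat).

(** A multiple of the row b is added to the row a.  Any minor with the row a also
    has the row b. *)
Lemma fminor_rowop_before A a b t u v r : injective u -> before u b a ->
  fminor (rowop A a b t) u v r = fminor A u v r.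
Proof.
move=> ui [q [p [qp uq up]]].
case: (ltnP p r) => pr; last first.
  apply: eq_fminor => i j ir jr; rewrite /rowop; case: eqP => [|]; last by rewrite addr0.
  by rewrite -up => /ui; lia.
have qr : (q < r)%N by apply: ltn_trans pr.
have pq : p != q by rewrite gtn_eqF.
have e : upd u p b p = upd u p b q by rewrite updE updN ?uq // ltn_eqF.
have iu : inj_below u r by move=> i j _ _; apply: ui.
by rewrite (fminor_rowop A b t v iu pr up) (fminor_repeat A v pr qr pq e) mulr0 addr0.
Qed.

Lemma fminor_rowop_last A t u v r : injective u -> (0 < r)%N ->
  fminor (rowop A (u r.-1) (u r) t) u v r = fminor A u v r + t * fminor A (u \o sw r) v r.
Proof.
move=> ui r0; rewrite (fminor_rowop _ _ _ _ (p := r.-1)) //; last 2 first.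
- by move=> i j _ _; apply: ui.
- lia.
congr (_ + _ * _); apply: eq_fminor => i j ir jr /=; rewrite /upd /sw.
have -> : (i == r) = false by apply/negbTE; lia.
by case: eqP.
Qed.

Lemma fminor_rowop_next A t u v r : injective u -> (0 < r)%N ->
  fminor (rowop A (u r) (u r.-1) t) (u \o sw r) v r =
  fminor A (u \o sw r) v r + t * fminor A u v r.
Proof.
move=> ui r0; have sr : sw r r = r.-1 by rewrite /sw eqxx.
have sr1 : sw r r.-1 = r by rewrite /sw eqxx; case: eqP => //; lia.
have := @fminor_rowop_last A t (u \o sw r) v r; rewrite /= sr sr1 => -> //.
  congr (_ + _ * _); apply: eq_fminor => i j _ _ /=; rewrite swK //.
by apply: inj_comp => //; apply: sw_inj.
Qed.

Definition shear (c : bool) A a b t := if c then rowop A a b t else colop A a b t.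

Lemma colop_tr A a b t u v r :
  fminor (colop A a b t) u v r = fminor (rowop (fun i j => A j i) a b t) v u r.
Proof. by rewrite -fminor_tr; apply: eq_fminor. Qed.

Definition raw_minor (A : nat -> nat -> F) (st : state) r := fminor A (st true) (st false) r.

Lemma chamber_raw_minor A st r : chamber A st r =
  (-1) ^+ (pair_count gtr (st true) r + pair_count gtr (st false) r) * raw_minor A st r.
Proof. by []. Qed.

Lemma shear_before c A a b t st r : (forall d, injective (st d)) ->
  before (st c) b a -> chamber (shear c A a b t) st r = chamber A st r.
Proof.
move=> inj bf; rewrite !chamber_raw_minor; congr (_ * _); rewrite /raw_minor; case: c bf => bf.
  exact: fminor_rowop_before.
by rewrite colop_tr fminor_rowop_before // fminor_tr.
Qed.

Lemma shear_last A (a : letter) t st : (forall d, injective (st d)) -> (0 < a.2)%N ->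
  raw_minor (shear a.1 A (st a.1 a.2.-1) (st a.1 a.2) t) st a.2 =
  raw_minor A st a.2 + t * raw_minor A (move_st st a) a.2.
Proof.
case: a => c r inj /= r0; rewrite /raw_minor /move_st /=; case: c => /=.
  exact: fminor_rowop_last.
by rewrite colop_tr fminor_rowop_last // !(fminor_tr A).
Qed.

Lemma shear_next A (a : letter) t st : (forall d, injective (st d)) -> (0 < a.2)%N ->
  raw_minor (shear a.1 A (st a.1 a.2) (st a.1 a.2.-1) t) (move_st st a) a.2 =
  raw_minor A (move_st st a) a.2 + t * raw_minor A st a.2.
Proof.
case: a => c r inj /= r0; rewrite /raw_minor /move_st /=; case: c => /=.
  exact: fminor_rowop_next.
by rewrite colop_tr fminor_rowop_next // !(fminor_tr A).
Qed.

Lemma chamber_eq0 A st r : (chamber A st r == 0) = (raw_minor A st r == 0).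
Proof. by rewrite chamber_raw_minor mulf_eq0 signr_eq0. Qed.

End Shear.

Section Solve.
Variables (F : fieldType) (k : nat).
Implicit Types (A : nat -> nat -> F) (c : nat -> F) (st : state).

Lemma shear_labelled col A a b t c st w : perm_state k st -> valid k st (erase w) ->
  asc col a b -> before (st col) b a -> labelled A c st w ->
  labelled (shear col A a b t) c st w.
Proof.
elim: w st => //= -[x l] w IH st ps /andP[okx vw] ab bf [cl lw].
have bf' := before_step okx ab bf.
have ps' : perm_state k (move_st st x) by move: okx => /andP[xk _]; apply: perm_move.
split; last exact: IH.
by case: (ps') => inj _ _; rewrite shear_before.
Qed.

(** A monomial matrix whose successive leading minors have the given quotients. *)
Lemma flags_base c cur st : perm_state k st -> c (cur 0) = 1 ->
  (forall r, (0 < r < k)%N -> c (cur r) != 0) -> exists A, flags k A c cur st.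
Proof.
move=> [inj lt _] c0 cn.
pose e r := pair_count gtr (st true) r + pair_count gtr (st false) r.
pose g r : F := (-1) ^+ e r * c (cur r).
pose d i := g i.+1 / g i.
pose A a b := \sum_(i < k) if (a == st true i) && (b == st false i) then d i else 0.
have AE i j : (i < k)%N -> A (st true i) (st false j) = if i == j then d i else 0.
  move=> ik; rewrite /A (bigD1 (Ordinal ik)) //= big1 => [|h hi].
    by rewrite eqxx /= addr0 (inj_eq (inj false)) eq_sym.
  have hi' : (i == h :> nat) = false by apply/negbTE; rewrite eq_sym.
  by rewrite (inj_eq (inj true)) hi'.
have pg r : (r <= k)%N -> \prod_(i < r) d i = g r.
  elim: r => [|r IH] rk.
    by rewrite big_ord0 /g c0 /e /pair_count !big_ord0 mulr1.
  rewrite big_ord_recr /= IH ?(ltnW rk) // /d mulrC divfK // /g mulf_neq0 ?signr_eq0 //.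
  by case: r {IH} rk => [|r] rk; [rewrite c0 oner_neq0 | apply: cn].
exists A => r rk; rewrite chamber_raw_minor /raw_minor /fminor.
have -> : \matrix_(i < r, j < r) A (st true i) (st false j) = diag_mx (\row_i d i).
  apply/matrixP => i j; rewrite !mxE AE; last exact: leq_trans rk.
  by rewrite -val_eqE; case: eqP => //= ->.
rewrite det_diag (eq_bigr (fun i : 'I_r => d i)) => [|i _]; last by rewrite mxE.
by rewrite pg // /g -/(e r) mulrA -expr2 sqrr_sign mul1r.
Qed.

(** From the end of the path to its beginning.  Undoing an exchange of a and b, a
    multiple of the row b is added to the row a: this does not affect the
    later chambers, where b precedes a, and adjusts the minor of the chamber
    that is now open, in which the multiple occurs linearly with the minor
    of the other chamber as coefficient. *)
Lemma solve_backward c cur st w : perm_state k st -> valid k st (erase w) ->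
  (forall l, l \in new_labels w -> c l != 0) ->
  (exists A, flags k A c (end_cur cur w) (endst st (erase w))) ->
  exists A, flags k A c cur st /\ labelled A c st w.
Proof.
elim: w cur st => [|[x l] w IH] cur st ps /=; first by move=> _ _ [A fA]; exists A.
move=> /andP[okx vw] nz base; have [/andP[x0 xk] ox] := andP okx.
have ps' : perm_state k (move_st st x) by apply: perm_move => //; rewrite x0.
have [|A [fA lA]] := IH (cur_step cur (x, l)) (move_st st x) ps' vw _ base.
  by move=> l' lw; apply: nz; rewrite inE lw orbT.
have cl : c l = chamber A (move_st st x) x.2.
  by rewrite -fA ?(ltnW xk) // /cur_step updE.
have raw0 : raw_minor A (move_st st x) x.2 != 0.
  by rewrite -chamber_eq0 -cl nz ?mem_head.
have [inj _ _] := ps; have [inj' _ _] := ps'.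
pose e := (pair_count gtr (st true) x.2 + pair_count gtr (st false) x.2)%N.
(* the multiple for which the open chamber gets the value c (cur x.2) *)
pose t := ((-1) ^+ e * c (cur x.2) - raw_minor A st x.2) / raw_minor A (move_st st x) x.2.
pose A' := shear x.1 A (st x.1 x.2.-1) (st x.1 x.2) t.
have bf : before (move_st st x x.1) (st x.1 x.2) (st x.1 x.2.-1).
  rewrite /move_st eqxx; exists x.2.-1, x.2.
  by rewrite /= sw_right sw_left //; split=> //; lia.
have same r : chamber A' (move_st st x) r = chamber A (move_st st x) r.
  exact: shear_before.
exists A'; split.
  move=> r rk; have [->|rx] := eqVneq r x.2; last first.
    rewrite -(chamber_move (a := x) _ ps) 1?eq_sym // same -fA // /cur_step updN //.
  by rewrite chamber_raw_minor shear_last // divfK // addrC subrK mulrA -expr2 sqrr_sign mul1r.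
split; first by rewrite same.
exact: shear_labelled.
Qed.

Lemma shear_labelled_past col A a b t c st w : perm_state k st -> valid k st (erase w) ->
  asc col b a -> before (endst st (erase w) col) b a -> labelled A c st w ->
  labelled (shear col A a b t) c st w.
Proof.
elim: w st => //= -[x l] w IH st ps /andP[okx vw] ab bf [cl lw].
have ps' : perm_state k (move_st st x) by move: okx => /andP[xk _]; apply: perm_move.
split; last exact: IH.
have [inj _ _] := ps'; rewrite shear_before //.
exact: before_unpath vw ab bf.
Qed.

(** The same from the beginning of the path to its end.  Here the coefficient is
    the minor of the chamber that is closed, so that the chambers of the final
    flag may have the value 0. *)
Lemma solve_forward c cur st w : perm_state k st -> valid k st (erase w) ->
  (forall w1 s w2, w = w1 ++ s :: w2 -> c (end_cur cur w1 s.1.2) != 0) ->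
  (exists A, flags k A c cur st) ->
  exists A, flags k A c cur st /\ labelled A c st w.
Proof.
move=> ps + + base; elim/last_ind: w => [|w [x l] IH]; first by case: base => A fA; exists A.
rewrite /erase map_rcons -cats1 valid_cat /= andbT -/(erase w) => /andP[vw okx] nz.
have [/andP[x0 xk] ox] := andP okx.
have [|A [fA lA]] := IH vw.
  by move=> w1 s w2 e; apply: (nz w1 s (rcons w2 (x, l))); rewrite e rcons_cat.
pose st' := endst st (erase w).
have ps1 : perm_state k st' by apply: perm_end.
have raw0 : raw_minor A st' x.2 != 0.
  rewrite -chamber_eq0 -(flags_end ps vw fA lA) ?(ltnW xk) //.
  by apply: (nz w (x, l) [::]); rewrite cats1.
have [inj _ _] := ps; have [inj1 _ _] := ps1.
pose e := (pair_count gtr (move_st st' x true) x.2 + pair_count gtr (move_st st' x false) x.2)%N.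
pose t := ((-1) ^+ e * c l - raw_minor A (move_st st' x) x.2) / raw_minor A st' x.2.
pose A' := shear x.1 A (st' x.1 x.2) (st' x.1 x.2.-1) t.
have bf : before (st' x.1) (st' x.1 x.2.-1) (st' x.1 x.2).
  by exists x.2.-1, x.2; split=> //; lia.
exists A'; split.
  move=> r rk; rewrite shear_before ?fA //.
  exact: before_unpath vw ox bf.
rewrite -cats1; apply/labelled_cat; split; first exact: shear_labelled_past.
split=> //; rewrite chamber_raw_minor shear_next // divfK // addrC subrK.
by rewrite mulrA -expr2 sqrr_sign mul1r.
Qed.

End Solve.

(** * Minors of the generic matrix are prime *)

Section MapMinors.
Variables (R S : comNzRingType) (phi : {rmorphism R -> S}).
Implicit Types (A : nat -> nat -> R).

Lemma map_fminor A u v r : phi (fminor A u v r) = fminor (fun i j => phi (A i j)) u v r.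
Proof. by rewrite /fminor -det_map_mx; congr (\det _); apply/matrixP => i j; rewrite !mxE. Qed.

Lemma map_sminor A u v r : phi (sminor A u v r) = sminor (fun i j => phi (A i j)) u v r.
Proof. by rewrite /sminor rmorphM rmorph_sign map_fminor. Qed.

End MapMinors.

Lemma fminor_row0 (R : comNzRingType) (A : nat -> nat -> R) u v r i : (i < r)%N ->
  (forall j, (j < r)%N -> A (u i) (v j) = 0) -> fminor A u v r = 0.
Proof.
move=> ir h; rewrite /fminor (expand_det_row _ (Ordinal ir)) big1 // => j _.
by rewrite mxE h ?mul0r.
Qed.

Section Separation.
Variable K : fieldType.
Implicit Types (u v : nat -> nat).

(** The permutation matrix that matches the i-th row of a minor with its t i-th
    column, and is 0 elsewhere. *)
Definition match_mx u v r (t : 'S_r) (a b : nat) : K :=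
  \sum_(p < r) ((a == u p) && (b == v (t p)))%:R.

Lemma match_minor u v r (t : 'S_r) : injective u -> injective v ->
  fminor (match_mx u v t) u v r != 0.
Proof.
move=> ui vi; rewrite /fminor.
have -> : \matrix_(i < r, j < r) match_mx u v t (u i) (v j) = perm_mx t.
  apply/matrixP => i j; rewrite !mxE /match_mx (bigD1 i) //= big1 => [|h hi].
    rewrite eqxx (inj_eq vi) addr0 /=.
    by rewrite -[in RHS]val_eqE eq_sym.
  have hi' : (i == h :> nat) = false by apply/negbTE; rewrite eq_sym.
  by rewrite (inj_eq ui) hi'.
by rewrite det_perm signr_eq0.
Qed.

Lemma match_mx_row0 u v r (t : 'S_r) a b :
  (forall p : 'I_r, ~~ ((a == u p) && (b == v (t p)))) -> match_mx u v t a b = 0.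
Proof. by move=> h; rewrite /match_mx big1 // => p _; rewrite (negbTE (h p)). Qed.

Lemma prefix_card u v r s : injective u ->
  (forall i, (i < r)%N -> exists2 j, (j < s)%N & u i = v j) -> (r <= s)%N.
Proof.
move=> ui h.
suff : (size (map u (iota 0 r)) <= size (map v (iota 0 s)))%N by rewrite !size_map !size_iota.
apply: uniq_leq_size; first by rewrite (map_inj_uniq ui) iota_uniq.
move=> x /mapP[i]; rewrite mem_iota add0n => /= /h[j js e] ->.
by rewrite e; apply: map_f; rewrite mem_iota.
Qed.

(** A permutation matrix supported on the second minor makes the first one 0 if
    this has a row or a column outside of the second.  Otherwise the second minor
    has a further column, and the permutation is chosen to match the first row
    with it. *)
Lemma minor_separation u v r u' v' r' :
  injective u -> injective v -> injective u' -> injective v' -> (0 < r)%N ->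
  ~ (r = r' /\ same_prefix u' u r /\ same_prefix v' v r) ->
  exists A : nat -> nat -> K, fminor A u v r = 0 /\ fminor A u' v' r' != 0.
Proof.
move=> ui vi ui' vi' r0 no.
have [su|nu] := pselect (forall i, (i < r)%N -> exists2 j, (j < r')%N & u i = u' j); last first.
  have [i ir hi] : exists2 i, (i < r)%N & forall j, (j < r')%N -> u i != u' j.
    apply: contrapT => n; apply: nu => i ir; apply: contrapT => n'.
    apply: n; exists i => // j jr; apply/eqP => e; apply: n'; exists j => //.
  exists (match_mx u' v' (1%g : 'S_r')); split; last exact: match_minor.
  apply: (fminor_row0 ir) => j jr; apply: match_mx_row0 => p.
  by rewrite (negbTE (hi p _)).
have [sv|nv] := pselect (forall i, (i < r)%N -> exists2 j, (j < r')%N & v i = v' j); last first.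
  have [i ir hi] : exists2 i, (i < r)%N & forall j, (j < r')%N -> v i != v' j.
    apply: contrapT => n; apply: nv => i ir; apply: contrapT => n'.
    apply: n; exists i => // j jr; apply/eqP => e; apply: n'; exists j => //.
  exists (match_mx u' v' (1%g : 'S_r')); split; last exact: match_minor.
  rewrite -fminor_tr; apply: (fminor_row0 ir) => j jr; apply: match_mx_row0 => p.
  by rewrite (negbTE (hi _ _)) ?andbF.
have [q0 qr hq] : exists2 q, (q < r')%N & forall j, (j < r)%N -> v' q != v j.
  apply: contrapT => n; apply: no.
  have sv' : forall i, (i < r')%N -> exists2 j, (j < r)%N & v' i = v j.
    move=> i ir; apply: contrapT => n'; apply: n; exists i => // j jr.
    by apply/eqP => e; apply: n'; exists j.
  have er : r = r' by apply/eqP; rewrite eqn_leq (prefix_card ui su) (prefix_card vi' sv').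
  by split=> //; subst r'.
have [p0 pr e0] := su 0%N r0.
exists (match_mx u' v' (tperm (Ordinal pr) (Ordinal qr))); split; last exact: match_minor.
apply: (fminor_row0 r0) => j jr; apply: match_mx_row0 => p.
rewrite e0 (inj_eq ui'); case: (eqVneq p0 p) => //= pp.
have -> : p = Ordinal pr by apply: val_inj.
by rewrite tpermL /= eq_sym hq.
Qed.

End Separation.

Definition dvdr (R : comNzRingType) (a b : R) := exists c, b = c * a.

Definition prime_elt (R : comNzRingType) (a : R) :=
  forall b c, dvdr a (b * c) -> dvdr a b \/ dvdr a c.

(** A prime that does not divide c is cancelled one factor at a time. *)
Lemma prime_elt_exp (R : idomainType) (a b c : R) N : a != 0 -> prime_elt a ->
  ~ dvdr a c -> dvdr (a ^+ N) (b * c) -> dvdr (a ^+ N) b.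
Proof.
move=> a0 pa nc; elim: N b => [|N IH] b; first by exists b; rewrite mulr1.
case=> d e; have [||//] := pa b c.
  by exists (d * a ^+ N); rewrite e exprSr mulrA.
case=> b' eb; have [|d' e'] := IH b'.
  exists d; apply: (mulIf a0).
  by rewrite -[d * _ * a]mulrA -exprSr -e eb; ring.
by exists d'; rewrite eb e' exprSr mulrA.
Qed.

Section Generic.
Variables (K : fieldType) (k : nat).
Local Notation P := {mpoly K[k * k]}.

(** The generic matrix, indexed like the listings of rows and columns. *)
Definition gmx (i j : nat) : P :=
  if (insub i : option 'I_k, insub j : option 'I_k) is (Some a, Some b)
  then generic_mx K k a b else 0.

Lemma gmxE (i j : 'I_k) : gmx i j = generic_mx K k i j.
Proof. by rewrite /gmx !valK. Qed.

Section Eval.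
Variables (L : comNzRingType) (iota : {rmorphism K -> L}) (A : nat -> nat -> L).

Definition mx_eval : P -> L :=
  mmap iota (fun l => mxvec (\matrix_(i < k, j < k) A i j) 0 l).

HB.instance Definition _ := GRing.RMorphism.on mx_eval.

Lemma mx_eval_gmx i j : (i < k)%N -> (j < k)%N -> mx_eval (gmx i j) = A i j.
Proof.
move=> ik jk; rewrite -[i]/(val (Ordinal ik)) -[j]/(val (Ordinal jk)) gmxE mxE.
by rewrite /mx_eval mmapX mmap1U mxvecE mxE.
Qed.

Definition below_k (u : nat -> nat) r := forall i, (i < r)%N -> (u i < k)%N.

Lemma mx_eval_fminor u v r : below_k u r -> below_k v r ->
  mx_eval (fminor gmx u v r) = fminor A u v r.
Proof.
move=> bu bv; rewrite map_fminor; apply: eq_fminor => i j ir jr.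
by rewrite /= mx_eval_gmx ?bu ?bv.
Qed.

End Eval.

Lemma gfminor_neq0 u v r : injective u -> injective v -> below_k u r -> below_k v r ->
  fminor gmx u v r != 0.
Proof.
move=> ui vi bu bv; apply: contraTneq (match_minor K (1%g : 'S_r) ui vi) => e.
by rewrite -(mx_eval_fminor idfun) // e rmorph0 eqxx.
Qed.

Lemma gfminor_ndvd u v r u' v' r' :
  injective u -> injective v -> injective u' -> injective v' -> (0 < r)%N ->
  below_k u r -> below_k v r -> below_k u' r' -> below_k v' r' ->
  ~ (r = r' /\ same_prefix u' u r /\ same_prefix v' v r) ->
  ~ dvdr (fminor gmx u v r) (fminor gmx u' v' r').
Proof.
move=> ui vi ui' vi' r0 bu bv bu' bv' no [c e].
have [A [A0 A1]] := minor_separation K ui vi ui' vi' r0 no.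
move: A1; rewrite -(mx_eval_fminor idfun) // e rmorphM /= mx_eval_fminor // A0 mulr0.
by rewrite eqxx.
Qed.

Section Corner.
Variables (u v : nat -> nat) (r : nat).
Hypotheses (ui : injective u) (vi : injective v).
Hypotheses (bu : below_k u r.+1) (bv : below_k v r.+1).
Local Notation D := (fminor gmx u v r.+1).
Local Notation a := (fminor gmx u v r).
Variables (FP : fieldType) (inc : {rmorphism P -> FP}).
Hypothesis inc_inj : injective inc.

Let a0 : a != 0.
Proof. by apply: gfminor_neq0 => // i ir; [apply: bu | apply: bv]; apply: leqW. Qed.

Let ia0 : inc a != 0. Proof. by rewrite -(rmorph0 inc) (inj_eq inc_inj). Qed.

(** Replacing a corner entry x by x - D / a, where D is the minor and a its
    complementary minor, is a substitution whose kernel is the ideal of D, up to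
    powers of a. *)
Definition corner_mx (i j : nat) : FP :=
  inc (gmx i j) + (if (i == u r) && (j == v r) then - (inc D / inc a) else 0).

Local Notation psi := (mx_eval (inc \o @mpolyC (k * k) K) corner_mx).

Lemma corner_kills : psi D = 0.
Proof.
rewrite mx_eval_fminor // (fminor_corner (fun i j => inc (gmx i j))); last 2 first.
- by move=> i j _ _; apply: ui.
- by move=> i j _ _; apply: vi.
by rewrite -!map_fminor mulNr divfK // addrN.
Qed.

(** Modulo D the substitution is the identity, once the denominators a are
    cleared. *)
Lemma corner_clear p : exists N t, inc a ^+ N * psi p = inc t /\ dvdr D (t - a ^+ N * p).
Proof.
elim/mpoly_closure: p => [c|l|p q [N1 [t1 [e1 [d1 h1]]]] [N2 [t2 [e2 [d2 h2]]]]
  |p q [N1 [t1 [e1 [d1 h1]]]] [N2 [t2 [e2 [d2 h2]]]]].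
- exists 0%N, c%:MP; rewrite mul1r /mx_eval mmapC; split=> //.
  by exists 0; rewrite mul1r subrr mul0r.
- case/mxvec_indexP: l => i j.
  have -> : 'X_(mxvec_index i j) = gmx i j :> P by rewrite gmxE mxE.
  rewrite mx_eval_gmx // /corner_mx; case: ifP => _.
    exists 1%N, (a * gmx i j - D); rewrite expr1; split.
      by rewrite rmorphB rmorphM /= mulrDr mulrN mulrCA divff // mulr1.
    by exists (-1); ring.
  exists 0%N, (gmx i j); rewrite mul1r addr0; split=> //.
  by exists 0; rewrite mul1r subrr mul0r.
- exists (N1 + N2)%N, (a ^+ N2 * t1 + a ^+ N1 * t2).
  rewrite rmorphD /= !(rmorphD, rmorphM, rmorphXn) /= -e1 -e2; split.
    by rewrite exprD; ring.
  exists (a ^+ N2 * d1 + a ^+ N1 * d2); rewrite mulrDl -!mulrA -h1 -h2 exprD; ring.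
- exists (N1 + N2)%N, (t1 * t2).
  rewrite !rmorphM /= -e1 -e2; split; first by rewrite exprD; ring.
  exists (t1 * d2 + a ^+ N2 * q * d1); rewrite mulrDl -!mulrA -h1 -h2 exprD; ring.
Qed.

Lemma corner_kernel p : psi p = 0 -> exists N, dvdr D (a ^+ N * p).
Proof.
move=> p0; have [N [t [e [d h]]]] := corner_clear p; exists N, (- d).
have t0 : t = 0 by apply: inc_inj; rewrite rmorph0 -e p0 mulr0.
by move: h; rewrite t0 sub0r mulNr => <-; rewrite opprK.
Qed.

End Corner.

(** The substitution [corner_mx] has values in a field, so its kernel is prime.
    The kernel is the ideal of D: powers of the complementary minor a can be
    cancelled, because a is prime by induction and does not divide D. *)
Lemma prime_minor u v r : injective u -> injective v -> below_k u r -> below_k v r ->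
  prime_elt (fminor gmx u v r).
Proof.
move=> ui vi; elim: r => [|r IH] bu bv b c.
  by left; exists b; rewrite /fminor det_mx00 mulr1.
have bu' : below_k u r by move=> i ir; apply: bu; apply: leqW.
have bv' : below_k v r by move=> i ir; apply: bv; apply: leqW.
pose inc : {rmorphism P -> {fraction P}} := @tofrac P.
have inc_inj : injective inc by move=> x y /eqP; rewrite tofrac_eq => /eqP.
pose psi := mx_eval (inc \o @mpolyC (k * k) K) (corner_mx u v r inc).
have cancel p : psi p = 0 -> dvdr (fminor gmx u v r.+1) p.
  move=> /(corner_kernel ui vi bu bv inc_inj)[N [q e]].
  case: r {psi inc inc_inj} IH bu bv bu' bv' q e => [|r] IH bu bv bu' bv' q e.
    (* the complementary minor of an entry is 1 *)
    by exists q; rewrite -e /fminor det_mx00 expr1n mul1r.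
  have a0 := gfminor_neq0 ui vi bu' bv'.
  have [||s es] := @prime_elt_exp _ _ q (fminor gmx u v r.+2) N a0 (IH bu' bv').
  - by apply: gfminor_ndvd => // -[]; lia.
  - by exists p; rewrite -e mulrC.
  exists s; apply: (mulfI (expf_neq0 N a0)); rewrite e es; ring.
case=> d e; have : psi b * psi c = 0.
  by rewrite -rmorphM e rmorphM /= corner_kills // mulr0.
by move=> /eqP; rewrite mulf_eq0 => /orP[/eqP/cancel|/eqP/cancel]; [left|right].
Qed.

End Generic.

(** * Labellings, positivity and denominators *)

Section Labelling.
Variable k : nat.

Lemma labelled_val (R : comNzRingType) (A : nat -> nat -> R) f st w l :
  labelled A f st w -> l \in new_labels w ->
  exists u a v, erase w = u ++ a :: v /\ f l = chamber A (endst st (rcons u a)) a.2.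
Proof.
elim: w st => //= -[a l'] w IH st [fl lw]; rewrite inE => /predU1P[->|/IH-/(_ _ lw)].
  by exists [::], a, (erase w).
move=> [u [b [v [e h]]]]; exists (a :: u), b, v; split=> //.
by rewrite /= -/(erase w) e.
Qed.

Lemma labelled_uniq (R : comNzRingType) (A : nat -> nat -> R) f g st w :
  labelled A f st w -> labelled A g st w -> forall l, l \in new_labels w -> f l = g l.
Proof.
elim: w st => //= -[a l'] w IH st [fl lw] [gl lw'] l.
by rewrite inE => /predU1P[->|/(IH _ lw lw')//]; rewrite fl gl.
Qed.

(** Since the labels are different they can receive their values independently. *)
Lemma exists_labelling (R : comNzRingType) (A : nat -> nat -> R) cur st w :
  fresh k cur w -> exists f, flags k A f cur st /\ labelled A f st w.
Proof.
move=> [uw cw inj].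
pose f0 x := if [pick r : 'I_k.+1 | cur r == x] is Some r then chamber A st r else 0.
suff [f [lf ff]] : exists f, labelled A f st w /\ forall x, x \notin new_labels w -> f x = f0 x.
  exists f; split=> // r rk; rewrite ff ?cw // /f0.
  case: pickP => [s /eqP/inj|/(_ (Ordinal (rk : (r < k.+1)%N)))]; last by rewrite eqxx.
  by move=> -> //; rewrite -ltnS.
elim: w st uw {cw inj} f0 => [|[a l] w IH] st; first by move=> _ f0; exists f0.
move=> /= /andP[lw uw] f0; have [f [lf ff]] := IH (move_st st a) uw f0.
exists (upd f l (chamber A (move_st st a) a.2)); split; first split.
- by rewrite updE.
- by apply: eq_labelled lf => x xw; rewrite updN //; apply: contraNneq lw => <-.
- by move=> x; rewrite inE negb_or => /andP[xl xw]; rewrite updN // ff.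
Qed.

Lemma perm_below st r b : perm_state k st -> (r <= k)%N -> below_k k (st b) r.
Proof. by move=> [_ lt _] rk i ir; apply: lt; apply: leq_trans rk. Qed.

Lemma map_flags (R S : comNzRingType) (phi : {rmorphism R -> S}) A f cur st :
  flags k A f cur st -> flags k (fun i j => phi (A i j)) (phi \o f) cur st.
Proof. by move=> fl r rk; rewrite /= fl // /chamber map_sminor. Qed.

Lemma map_labelled (R S : comNzRingType) (phi : {rmorphism R -> S}) A f st w :
  labelled A f st w -> labelled (fun i j => phi (A i j)) (phi \o f) st w.
Proof.
elim: w st => //= -[a l] w IH st [fl lw]; split; last exact: IH.
by rewrite fl /chamber map_sminor.
Qed.

Lemma eq_chamber (R : comNzRingType) (A A' : nat -> nat -> R) st r :
  perm_state k st -> (r <= k)%N ->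
  (forall i j, (i < k)%N -> (j < k)%N -> A i j = A' i j) -> chamber A st r = chamber A' st r.
Proof.
move=> [_ lt _] rk e; rewrite /chamber /sminor; congr (_ * _); apply: eq_fminor => i j ir jr.
by apply: e; apply: lt; apply: leq_trans rk.
Qed.

Lemma eq_flags_mx (R : comNzRingType) (A A' : nat -> nat -> R) f cur st :
  perm_state k st -> (forall i j, (i < k)%N -> (j < k)%N -> A i j = A' i j) ->
  flags k A f cur st -> flags k A' f cur st.
Proof. by move=> ps e fl r rk; rewrite fl //; apply: eq_chamber. Qed.

Lemma eq_labelled_mx (R : comNzRingType) (A A' : nat -> nat -> R) f st w :
  perm_state k st -> valid k st (erase w) ->
  (forall i j, (i < k)%N -> (j < k)%N -> A i j = A' i j) ->
  labelled A f st w -> labelled A' f st w.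
Proof.
move=> + + e; elim: w st => //= -[a l] w IH st ps /andP[/andP[ak _] vw] [fl lw].
have ps' := perm_move ak ps; split; last exact: IH.
by rewrite fl; apply: eq_chamber => //; move/andP: ak => [_ /ltnW].
Qed.

Definition color_word (c : bool) (w : seq letter) := all (fun a => a.1 == c) w.

Lemma color_take c n w : color_word c w -> color_word c (take n w).
Proof. by move=> /allP cw; apply/allP => a /mem_take/cw. Qed.

Lemma endst_other c w st : color_word c w -> endst st w (~~ c) = st (~~ c).
Proof.
elim: w st => //= a w IH st /andP[/eqP ac cw]; rewrite IH // /move_st ac.
by case: c {IH ac cw}.
Qed.

Lemma color_path c st : perm_state k st -> exists w, [/\ valid k st w, color_word c w,
  endst st w c = final_st k c & endst st w (~~ c) = st (~~ c)].
Proof.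
move=> ps; have [w [vw cw no]] := exhaust k (fun a => a.1 == c) st.
exists w; split=> //; last exact: endst_other.
by apply: (@stuck_component k) => [|r]; [apply: perm_end|apply: no].
Qed.

(** First all the exchanges of the component c, then those of the other one. *)
Lemma two_stage_path c : exists w, [/\ valid k (start_st k) w,
  endst (start_st k) w = final_st k &
  forall u v, w = u ++ v -> endst (start_st k) u (~~ c) = start_st k (~~ c) \/
     endst (start_st k) u c = final_st k c].
Proof.
have [w1 [v1 c1 e1 e1']] := color_path c (perm_start k).
have ps1 := perm_end v1 (perm_start k).
have [w2 [v2 c2 e2 e2']] := color_path (~~ c) ps1.
rewrite negbK in e2'.
exists (w1 ++ w2); split.
- by rewrite valid_cat v1.
- by rewrite endst_cat; apply/funext => b; case: c b {v1 c1 v2 c2 ps1} e1 e1' e2 e2' => -[] /= e1 e1' e2 e2';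
    rewrite ?e2 ?e2' ?e1.
move=> u v e; have [s|s] := leqP (size u) (size w1).
  left; apply: endst_other; move/(congr1 (take (size u))): e.
  rewrite (take_size_cat (s1 := u)) // take_cat; move: s; rewrite leq_eqVlt => /predU1P[s|s].
    by rewrite s ltnn subnn take0 cats0 => <-.
  by rewrite s => <-; apply: color_take.
right; move/(congr1 (take (size u))): e.
rewrite (take_size_cat (s1 := u)) // take_cat ltnNge (ltnW s) /= => <-.
rewrite endst_cat -e1.
have := @endst_other (~~ c) _ (endst (start_st k) w1) (color_take (size u - size w1) c2).
by rewrite negbK.
Qed.

End Labelling.

Section Positivity.
Variables (R : idomainType) (K : numDomainType) (phi : {rmorphism R -> K}).
Variables (n p : nat) (i0 : 'I_p).
Local Notation F := {fraction R}.
Implicit Types (S : labeled_pair F n p) (z : F).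

(** phi is only defined on R: the value of a fraction at phi is read off from a
    numerator and a denominator, the latter with a positive value. *)
Definition pos_value z := exists a b, [/\ 0 < phi a, 0 < phi b & z * tofrac b = tofrac a].
Definition nneg_value z := exists a b, [/\ 0 <= phi a, 0 < phi b & z * tofrac b = tofrac a].

Lemma pos_value1 : pos_value 1.
Proof. by exists 1, 1; rewrite rmorph1 mul1r ltr01. Qed.

Lemma pos_nneg z : pos_value z -> nneg_value z.
Proof. by move=> [a [b [a0 b0 e]]]; exists a, b; rewrite ltW. Qed.

Lemma pos_valueM z t : pos_value z -> pos_value t -> pos_value (z * t).
Proof.
move=> [a [b [a0 b0 e]]] [c [d [c0 d0 h]]]; exists (a * c), (b * d).
by rewrite !rmorphM /= !mulr_gt0 //; split=> //; rewrite mulrACA e h.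
Qed.

Lemma nneg_valueM z t : nneg_value z -> nneg_value t -> nneg_value (z * t).
Proof.
move=> [a [b [a0 b0 e]]] [c [d [c0 d0 h]]]; exists (a * c), (b * d).
by rewrite !rmorphM /= mulr_ge0 // mulr_gt0 //; split=> //; rewrite mulrACA e h.
Qed.

Lemma pos_valueD z t : pos_value z -> nneg_value t -> pos_value (z + t).
Proof.
move=> [a [b [a0 b0 e]]] [c [d [c0 d0 h]]]; exists (a * d + c * b), (b * d).
split.
- by rewrite rmorphD !rmorphM; apply: ltr_pwDl; [apply: mulr_gt0 | apply: mulr_ge0 => //; apply: ltW].
- by rewrite rmorphM mulr_gt0.
- by rewrite !(rmorphD, rmorphM) /= -e -h; ring.
Qed.

Lemma pos_neq0 (a : R) : 0 < phi a -> tofrac a != 0 :> F.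
Proof. by rewrite tofrac_eq0; apply: contraTneq => ->; rewrite rmorph0 ltxx. Qed.

Lemma pos_valueV z : pos_value z -> pos_value z^-1.
Proof.
move=> [a [b [a0 b0 e]]]; exists b, a; split=> //.
have z0 : z != 0 by move: (pos_neq0 a0); rewrite -e mulf_eq0 negb_or => /andP[].
by rewrite -e mulKf.
Qed.

Lemma pos_valueX z d : pos_value z -> pos_value (z ^+ d).
Proof.
move=> pz; elim: d => [|d IH]; first exact: pos_value1.
by rewrite exprS; apply: pos_valueM.
Qed.

Lemma nneg_valueX z d : nneg_value z -> nneg_value (z ^+ d).
Proof.
move=> pz; elim: d => [|d IH]; first exact: pos_nneg pos_value1.
by rewrite exprS; apply: nneg_valueM.
Qed.

(** The frozen variable i0 may have the value 0. *)
Definition pos_seed S := (forall i, i != rshift n i0 -> pos_value (ext_cluster S i)) /\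
  nneg_value (ext_cluster S (rshift n i0)).

(** A frozen variable occurs in at most one of the two monomials of an exchange,
    so the other one is positive. *)
Lemma pos_mutate S l : pos_seed S -> pos_seed (mutate S l).
Proof.
case=> px nx.
have nneg i : nneg_value (ext_cluster S i).
  by have [->//|/px/pos_nneg] := eqVneq i (rshift n i0).
have ni0 : rshift n i0 != lshift p l by rewrite eq_rlshift.
have prod_pos (e : 'I_(n + p) -> nat) : e (rshift n i0) = 0%N ->
    pos_value (\prod_h ext_cluster S h ^+ e h).
  move=> e0; apply: big_ind => [||h _]; [exact: pos_value1 | exact: pos_valueM |].
  have [->|/px] := eqVneq h (rshift n i0); first by rewrite e0; apply: pos_value1.
  exact: pos_valueX.
have prod_nneg (e : 'I_(n + p) -> nat) : nneg_value (\prod_h ext_cluster S h ^+ e h).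
  apply: big_ind => [||h _]; [exact: pos_nneg pos_value1 | exact: nneg_valueM |].
  exact: nneg_valueX.
split; last by rewrite mutate_off.
move=> i ii; have [->|il] := eqVneq i (lshift p l); last by rewrite mutate_off //; apply: px.
rewrite mutate_at; apply: pos_valueM; last first.
  by apply: pos_valueV; apply: px; rewrite eq_sym.
have [le0|gt0] := lerP (ext_mx S (rshift n i0) l) 0.
  apply: pos_valueD; last exact: (prod_nneg (fun h => pos_part (- ext_mx S h l))).
  by apply: (prod_pos (fun h => pos_part (ext_mx S h l))); rewrite /pos_part ltNge le0.
rewrite addrC; apply: pos_valueD; last exact: (prod_nneg (fun h => pos_part (ext_mx S h l))).
by apply: (prod_pos (fun h => pos_part (- ext_mx S h l))); rewrite /pos_part oppr_gt0 ltNge ltW.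
Qed.

Lemma pos_foldl S ls : pos_seed S -> pos_seed (foldl (@mutate F n p) S ls).
Proof. by elim: ls S => //= l ls IH S /(pos_mutate l)/IH. Qed.

End Positivity.

Section Denominators.
Variables (R : idomainType) (F : fieldType) (inc : {rmorphism R -> F}).
Hypothesis inc_inj : injective inc.

Let inc_neq0 x : x != 0 -> inc x != 0.
Proof. by rewrite -(rmorph0 inc) (inj_eq inc_inj). Qed.

(** The prime denominators are removed one after the other, each by comparison
    with a denominator y that it does not divide. *)
Lemma remove_primes (xs : seq R) (z : F) N :
  (forall x, x \in xs -> [/\ x != 0, prime_elt x &
     exists2 y, ~ dvdr x y & exists r, z * inc y = inc r]) ->
  (exists r, z * inc (\prod_(x <- xs) x ^+ N) = inc r) -> exists r, z = inc r.
Proof.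
elim: xs => [|x xs IH] H [r e].
  by exists r; rewrite -e big_nil rmorph1 mulr1.
apply: IH => [x' x'xs|]; first by apply: H; rewrite inE x'xs orbT.
have [x0 px [y nxy [s es]]] := H x (mem_head _ _).
rewrite big_cons in e; set b := \prod_(_ <- _) _ in e *.
have E : r * y = s * b * x ^+ N.
  by apply: inc_inj; rewrite !rmorphM /= -e -es rmorphM; ring.
have [|q eq] := @prime_elt_exp _ x r y N x0 px nxy; first by exists (s * b).
exists q; apply: (mulIf (_ : inc (x ^+ N) != 0)); first by rewrite inc_neq0 ?expf_neq0.
by rewrite -rmorphM -eq -e rmorphM; ring.
Qed.

Lemma prime_elt_prod (I : Type) (xs : seq I) (f : I -> R) x N : prime_elt x ->
  ~ dvdr x 1 -> dvdr x (\prod_(i <- xs) f i ^+ N) -> exists i, dvdr x (f i).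
Proof.
move=> px x1; elim: xs => [|i xs IH]; first by rewrite big_nil.
rewrite big_cons => /px[|/IH//]; elim: N {IH} => [|N IH]; first by rewrite expr0.
by rewrite exprS => /px[|/IH//]; exists i.
Qed.

Lemma laurent_denominator (K : fieldType) (iota : {rmorphism K -> F}) (j : {rmorphism K -> R})
   m (X : 'I_m -> R) z :
  (forall c, iota c = inc (j c)) -> (forall i, X i != 0) ->
  laurent iota (fun i => inc (X i)) z ->
  exists N r, z * inc (\prod_i X i ^+ N) = inc r.
Proof.
move=> ji X0; elim=> [c|i|i|a b _ [N1 [r1 e1]] _ [N2 [r2 e2]]|a b _ [N1 [r1 e1]] _ [N2 [r2 e2]]].
- by exists 0%N, (j c); rewrite big1 // rmorph1 mulr1 ji.
- by exists 0%N, (X i); rewrite big1 // rmorph1 mulr1.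
- exists 1%N, (\prod_(h | h != i) X h); rewrite (bigD1 i) //= expr1 rmorphM mulKf ?inc_neq0 //.
- exists (N1 + N2)%N, (r1 * \prod_i X i ^+ N2 + r2 * \prod_i X i ^+ N1).
  under eq_bigr do rewrite exprD; rewrite big_split /= !(rmorphD, rmorphM) /= -e1 -e2.
  by ring.
- exists (N1 + N2)%N, (r1 * r2).
  under eq_bigr do rewrite exprD; rewrite big_split /= !rmorphM /= -e1 -e2.
  by ring.
Qed.

End Denominators.

(** * The initial seed in the field of functions on matrices *)

Lemma mmap_ext (R S : comNzRingType) m (f f' : R -> S) (h h' : 'I_m -> S) q :
  f =1 f' -> h =1 h' -> mmap f h q = mmap f' h' q.
Proof.
move=> ff hh; rewrite /mmap; apply: eq_bigr => e _; rewrite ff; congr (_ * _).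
by apply: eq_bigr => i _; rewrite hh.
Qed.

Lemma rmorph_mmap (K R S : comNzRingType) m (g : {rmorphism R -> S})
   (f : {rmorphism K -> R}) (h : 'I_m -> R) q :
  g (mmap f h q) = mmap (g \o f) (g \o h) q.
Proof.
elim/mpoly_closure: q => [c|i|q1 q2 e1 e2|q1 q2 e1 e2].
- by rewrite !mmapC.
- by rewrite !mmapX !mmap1U.
- by rewrite !mmapD rmorphD e1 e2.
- by rewrite !rmorphM /= e1 e2.
Qed.

Lemma mmap_id (K : comNzRingType) m (q : {mpoly K[m]}) :
  mmap (@mpolyC m K) (fun i => 'X_i) q = q.
Proof.
elim/mpoly_closure: q => [c|i|q1 q2 e1 e2|q1 q2 e1 e2].
- by rewrite !mmapC.
- by rewrite !mmapX !mmap1U.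
- by rewrite !mmapD e1 e2.
- by rewrite !rmorphM /= e1 e2.
Qed.

Lemma mpolyX_neq0 (K : comNzRingType) m (i : 'I_m) : 'X_i != 0 :> {mpoly K[m]}.
Proof.
apply/eqP => /(congr1 (fun q : {mpoly K[m]} => q@_(U_(i)))).
by rewrite mcoeffXU eqxx mcoeff0 => /eqP; rewrite oner_eq0.
Qed.

Lemma final_no k a : ~~ applicable k (final_st k) a.
Proof.
case: a => c r; apply/negP => /andP[/= rk]; rewrite /final_st /start_st.
have -> : (k <= r)%N = false by lia.
have -> : (k <= r.-1)%N = false by lia.
by case: c => /=; lia.
Qed.

Section MatrixSeed.
Variables (K : numFieldType) (k : nat) (w0 : seq letter).
Hypothesis k0 : (0 < k)%N.
Hypothesis v0 : valid k (start_st k) w0.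
Hypothesis e0 : endst (start_st k) w0 = final_st k.

Local Notation P := {mpoly K[k * k]}.
Local Notation start := (start_st k).
Local Notation n := (mut_number w0).
Local Notation p := (frozen_number k).
Local Notation N := (n + p.+1)%N.
Local Notation path := (initial_path k w0).
Local Notation cur := (initial_cur k w0).
Local Notation gmx := (gmx K k).

Variable X : nat -> P.
Hypothesis flX : flags k gmx X cur start.
Hypothesis lbX : labelled gmx X start path.

Let erase_path : erase path = w0. Proof. exact: erase_decorate. Qed.
Let valid_path : valid k start (erase path). Proof. by rewrite erase_path. Qed.

Lemma cur_one : cur 0 = N.
Proof.
rewrite /initial_cur /frozen_number; have [[_ ->]|[h _]|[h _]] := start_curP k n 0; move: (n) => m; lia.
Qed.

Lemma cur_level r : (0 < r < k)%N -> cur r = (n + r.-1)%N.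
Proof.
by move=> rk; rewrite /initial_cur; have [[h _]|[_ ->]|[h _]] := start_curP k n r; move: rk => ?; lia.
Qed.

Lemma cur_det r : (k <= r)%N -> cur r = (n + p)%N.
Proof.
move=> kr; rewrite /initial_cur /frozen_number; have [[h _]|[h _]|[h ->]] := start_curP k n r; rewrite ?addnA //; lia.
Qed.

Lemma label_cases l : (l < N)%N ->
  l \in new_labels path \/ exists2 r, (0 < r <= k)%N & l = cur r.
Proof.
move=> lN; have [ln|nl] := ltnP l n; first by left; apply: initial_path_mut.
have [lk|kl] := ltnP l (n + k.-1).
  right; exists (l - n).+1; first by lia.
  by rewrite cur_level; move: (n) nl lk lN => m ? ? ?; lia.
have [ld|dl] := ltnP l (n + p).
  left; have -> : l = last_label k n (l - n - k.-1).+1.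
    by rewrite /last_label; move: (n) nl kl ld => m ? ? ?; lia.
  apply: initial_path_last => //; move: (n) nl kl ld; rewrite /frozen_number => m ? ? ?; lia.
right; exists k; first by rewrite k0 leqnn.
by rewrite cur_det //; move: (n) dl lN => m ? ?; lia.
Qed.

Section Evaluate.
Variables (L : comNzRingType) (iota : {rmorphism K -> L}) (A : nat -> nat -> L).
Local Notation ev := (mx_eval iota A).

Lemma eval_flags : flags k A (ev \o X) cur start.
Proof.
apply: (eq_flags_mx (perm_start k)) (map_flags ev flX) => i j ik jk.
exact: mx_eval_gmx.
Qed.

Lemma eval_labelled : labelled A (ev \o X) start path.
Proof.
apply: (eq_labelled_mx (perm_start k) valid_path) (map_labelled ev lbX) => i j ik jk.
exact: mx_eval_gmx.
Qed.

Lemma eval_unique c : flags k A c cur start -> labelled A c start path ->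
  forall l, (l < N)%N -> ev (X l) = c l.
Proof.
move=> fc lc l /label_cases[lw|[r /andP[_ rk] ->]].
  exact: (labelled_uniq eval_labelled lc).
by rewrite fc // -(eval_flags rk).
Qed.

End Evaluate.

Lemma solve_back_labels (L : fieldType) (iota : {rmorphism K -> L}) c :
  c N = 1 -> (forall l, l \in new_labels path -> c l != 0) ->
  exists A, forall l, (l < N)%N -> mx_eval iota A (X l) = c l.
Proof.
move=> c1 cn.
have pe := perm_end v0 (perm_start k).
have [|A [fA lA]] := @solve_backward _ k c cur start path (perm_start k) valid_path cn.
  apply: flags_base; first by rewrite erase_path.
    by rewrite (initial_path_end v0 e0) /= cur_one.
  by move=> r rk; rewrite (initial_path_end v0 e0) rk; apply/cn/initial_path_last.
by exists A => l lN; apply: eval_unique.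
Qed.

Lemma end_cur_high (cu : nat -> nat) w r : (forall s, s \in erase w -> (0 < s.2 < k)%N) ->
  (k <= r)%N -> end_cur cu w r = cu r.
Proof.
move=> + kr; elim: w cu => //= -[a l] w IH cu lev.
have ak := lev a (mem_head _ _).
rewrite /end_cur /= -/(end_cur _ _) IH => [|s sw]; last by apply: lev; rewrite inE sw orbT.
by rewrite /cur_step updN //=; apply/eqP; lia.
Qed.

(** The forward construction divides by the chambers that are closed, which the
    last chamber of the level r0 is not. *)
Lemma solve_forward_labels (L : fieldType) (iota : {rmorphism K -> L}) c r0 :
  (0 < r0 < k)%N -> c N = 1 -> (forall l, l != last_label k n r0 -> c l != 0) ->
  exists A, forall l, (l < N)%N -> mx_eval iota A (X l) = c l.
Proof.
move=> r0k c1 cn.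
have fresh0 := initial_path_fresh k0 v0.
have lev s : s \in w0 -> (0 < s.2 < k)%N by apply: valid_levels v0.
have lastin := initial_path_last e0 r0k.
have [|| A [fA lA]] := @solve_forward _ k c cur start path (perm_start k) valid_path.
- move=> w1 [[b r] l] w2 e /=.
  have rk : (0 < r < k)%N.
    by apply: (lev (b, r)); rewrite -erase_path e /erase map_cat mem_cat /= inE eqxx orbT.
  have lev1 s : s \in erase w1 -> (0 < s.2 < k)%N.
    by move=> sw; apply: lev; rewrite -erase_path e /erase map_cat mem_cat sw.
  have lev2 s : s \in erase w2 -> (0 < s.2 < k)%N.
    by move=> sw; apply: lev; rewrite -erase_path e /erase map_cat mem_cat /= inE sw !orbT.
  set x := end_cur cur w1 r.
  have fr1 : fresh k (end_cur cur w1) (((b, r), l) :: w2).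
    by apply: fresh_catr; rewrite -e.
  have fr2 := fresh_step fr1.
  have [_ nx inj] := fr1.
  have xw2 : x \notin l :: new_labels w2 by apply: nx.
  have xs r' : cur_step (end_cur cur w1) (b, r, l) r' != x.
    rewrite /cur_step; have [->|rr'] := eqVneq r' r.
      by rewrite updE; apply/eqP => /= e'; move: xw2; rewrite -e' mem_head.
    rewrite updN //.
    have inj' r1 : (r1 <= k)%N -> r1 != r -> end_cur cur w1 r1 != x.
      move=> r1k rr; apply/eqP => /inj e'; case/eqP: rr; apply: e' => //.
      by case/andP: rk => _ /ltnW.
    have [rk'|kr'] := leqP r' k; first exact: inj'.
    rewrite (end_cur_high _ lev1 (ltnW kr')) cur_det ?(ltnW kr') //.
    rewrite -(cur_det (leqnn k)) -(end_cur_high cur lev1 (leqnn k)); apply: inj' => //.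
    by apply/eqP; lia.
  have xnew : x \notin new_labels w2 by move: xw2; rewrite inE negb_or => /andP[].
  have xend r' : end_cur cur path r' != x.
    by rewrite e end_cur_cat; exact: (end_cur_out xs xnew).
  by apply: cn; have := xend r0; rewrite (initial_path_end v0 e0) r0k eq_sym.
- apply: flags_base; [exact: perm_start | by rewrite cur_one|] => r rk.
  apply: cn; rewrite cur_level // /last_label; apply/eqP.
  by move: (n) => m; lia.
by exists A => l lN; apply: eval_unique.
Qed.

(** A frozen variable belongs to the initial flag or to the final one.  In the
    first case the backward construction applies, which never divides by it, in
    the second case the forward one. *)
Lemma frozen_zero_point l0 : (n <= l0 < N)%N -> exists A : nat -> nat -> K,
  mx_eval idfun A (X l0) = 0 /\
  forall l, (l < N)%N -> l != l0 -> mx_eval idfun A (X l) = 1.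
Proof.
move=> l0N; pose c := upd (fun _ : nat => 1 : K) l0 0.
have cl0 : c l0 = 0 by rewrite /c updE.
have cl l : l != l0 -> c l = 1 by move=> h; rewrite /c updN.
have c1 : c N = 1 by apply: cl; apply/eqP; lia.
suff [A hA] : exists A, forall l, (l < N)%N -> mx_eval idfun A (X l) = c l.
  exists A; split=> [|l lN ll]; first by rewrite hA ?cl0 //; case/andP: l0N.
  by rewrite hA // cl.
have [l0w|l0w] := boolP (l0 \in new_labels path); last first.
  apply: solve_back_labels => // l lw; rewrite cl ?oner_neq0 //.
  by apply: contraNneq l0w => <-.
have [r rk e] : exists2 r, (0 < r < k)%N & l0 = last_label k n r.
  move: l0w; rewrite initial_path_label => /orP[|/mapP[r /mapP[s /(valid_levels v0) sk ->] ->]].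
    by case/andP: l0N; lia.
  by exists s.2.
by apply: (solve_forward_labels _ rk c1) => l; rewrite -e => /cl ->; apply: oner_neq0.
Qed.

(** The minors with labels below M can take arbitrary nonzero values, in
    particular those of M independent variables, while the others are 1.  The
    polynomial q stands for a value that vanishes on all such points: 0 itself,
    or an element of the ideal generated by the determinant minus 1. *)
Lemma initial_minors_indep M (f : {mpoly K[M]}) (q : P) : (M <= N)%N ->
  (forall (L : fieldType) (iota : {rmorphism K -> L}) A,
     (forall l, (M <= l < N)%N -> mx_eval iota A (X l) = 1) -> mx_eval iota A q = 0) ->
  mmap (@mpolyC (k * k) K) (fun i : 'I_M => X i) f = q -> f = 0.
Proof.
move=> MN q0 fq; pose L := {fraction {mpoly K[M]}}.
pose incL : {rmorphism {mpoly K[M]} -> L} := @tofrac _.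
have incL_inj : injective incL by move=> a b /eqP; rewrite tofrac_eq => /eqP.
(* the generic values of the first M minors, and 1 for the other ones *)
pose c l : L := if insub l is Some i then incL 'X_i else 1.
have cE (i : 'I_M) : c i = incL 'X_i by rewrite /c valK.
have c1 l : (M <= l)%N -> c l = 1 by move=> Ml; rewrite /c insubN // -leqNgt.
have cn l : c l != 0.
  rewrite /c; case: insub => [i|]; last exact: oner_neq0.
  by rewrite -(rmorph0 incL) (inj_eq incL_inj) mpolyX_neq0.
have [|A hA] := @solve_back_labels L (incL \o @mpolyC M K) c _ (fun l _ => cn l).
  exact: c1.
apply: incL_inj; rewrite rmorph0 -(q0 L (incL \o @mpolyC M K) A) => [|l /andP[Ml lN]]; last first.
  by rewrite hA // c1.
rewrite -fq rmorph_mmap -{1}[f]mmap_id rmorph_mmap; apply: mmap_ext => [a|i] /=.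
  by rewrite /mx_eval mmapC.
by rewrite hA ?cE //; apply: leq_trans MN.
Qed.

Definition mx_field := {fraction P}.
Definition tofracP : {rmorphism P -> mx_field} := @tofrac P.
Definition iotaM : {rmorphism K -> mx_field} := tofracP \o @mpolyC (k * k) K.

Lemma tofracP_inj : injective tofracP.
Proof. by move=> a b /eqP; rewrite tofrac_eq => /eqP. Qed.

Definition matrix_seed : labeled_pair mx_field n p.+1 :=
  LabeledPair (fun i => tofracP (X i)) (\matrix_(i, j) quiver cur path i j).

Lemma matrix_seed_indep : alg_independent iotaM (ext_cluster matrix_seed).
Proof.
move=> f f0; apply: (@initial_minors_indep N f 0) => //.
  by move=> L iota A _; rewrite rmorph0.
by apply: tofracP_inj; rewrite rmorph0 -f0 rmorph_mmap; apply: mmap_ext.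
Qed.

Lemma two_neq0 : 2%:R != 0 :> K.
Proof. by rewrite pnatr_eq0. Qed.

Lemma matrix_seed_regular : regular_seed iotaM matrix_seed.
Proof.
split; first exact: matrix_seed_indep.
  by move=> i j; rewrite /= !mxE quiver_skew.
have lev s : s \in erase path -> (0 < s.2 < k)%N.
  by rewrite erase_path; apply: valid_levels v0.
apply: (full_rank_quiver (k := k) (cur := cur) (w := path)) => //.
- by move=> i j; rewrite mxE.
- exact: initial_path_fresh.
- exact: initial_path_frozen.
- by move=> l /(initial_path_range k0 v0); move: (n) => m; lia.
- exact: initial_path_mut.
Qed.

Lemma X_neq0 l : (l < N)%N -> X l != 0.
Proof.
move=> lN; have := indep_neq0 (Ordinal lN) matrix_seed_indep.
by rewrite /= -(rmorph0 tofracP) (inj_eq tofracP_inj).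
Qed.

(** At a point where X i is 2 and X j is 1 the two sides are different. *)
Lemma X_sign_neq i j (b : bool) : (i < N)%N -> (j < N)%N -> i != j -> X i <> (-1) ^+ b * X j.
Proof.
move=> iN jN ij e; pose c := upd (fun _ : nat => 1 : K) i 2%:R.
have [||A hA] := @solve_back_labels K idfun c.
- by rewrite /c updN //; apply/eqP; lia.
- by move=> l _; rewrite /c /upd; case: ifP => _; rewrite ?two_neq0 ?oner_neq0.
have := congr1 (mx_eval idfun A) e; rewrite rmorphM rmorph_sign /= !hA // /c updE updN 1?eq_sym //.
rewrite mulr1; case: b {e} => /eqP; rewrite -subr_eq0 ?expr1 ?expr0.
  by rewrite opprK -[1]/(1%:R) -natrD pnatr_eq0.
by rewrite -[1]/(1%:R) -natrB // pnatr_eq0.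
Qed.

Lemma generic_chamber_neq0 st r : perm_state k st -> (r <= k)%N ->
  chamber (fun i j => tofracP (gmx i j)) st r != 0.
Proof.
move=> ps rk; rewrite /chamber -map_sminor -(rmorph0 tofracP) (inj_eq tofracP_inj).
rewrite /sminor mulf_eq0 signr_eq0 /=; have [inj _ _] := ps.
by apply: gfminor_neq0 => //; apply: perm_below ps rk.
Qed.

Lemma matrix_seed_carries :
  carries k (fun i j => tofracP (gmx i j)) cur start matrix_seed path.
Proof.
exists (fun l => tofracP (X l)); split=> //.
- by move=> i j; rewrite mxE.
- exact: map_flags flX.
- exact: map_labelled lbX.
Qed.

(** Both paths are maximal, so [rewr_final] relates them. *)
Lemma reach_path t : valid k start t -> endst start t = final_st k ->
  exists ls w', [/\ erase w' = t, perm_eq (new_labels w') (new_labels path) &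
    carries k (fun i j => tofracP (gmx i j)) cur start
      (foldl (@mutate mx_field n p.+1) matrix_seed ls) w'].
Proof.
move=> vt et.
have rw : rewr (erase path) t.
  rewrite erase_path; apply: (rewr_final v0) => //.
    by rewrite e0 => -[c r]; apply: final_no.
  by rewrite et => -[c r]; apply: final_no.
have [ls [w' [e' _ pm cw]]] := @carries_rewr _ _ _ n p.+1 generic_chamber_neq0 cur start (perm_start k)
  cur_one (initial_cur_le k0 v0) matrix_seed path t rw (initial_path_fits k0 v0 e0) matrix_seed_carries.
by exists ls, w'.
Qed.

End MatrixSeed.

(** * Regularity of the cluster variables *)

Lemma dvdr_sign (R : comNzRingType) (a c : R) (m : nat) :
  dvdr ((-1) ^+ m * a) c <-> dvdr a c.
Proof.
split=> -[d ->]; first by exists (d * (-1) ^+ m); rewrite mulrA.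
by exists (d * (-1) ^+ m); rewrite !mulrA -[d * _ * _]mulrA -expr2 sqrr_sign mulr1.
Qed.

Lemma dvdr_signr (R : comNzRingType) (a c : R) (m : nat) :
  dvdr a ((-1) ^+ m * c) <-> dvdr a c.
Proof.
split=> -[d e]; last by exists ((-1) ^+ m * d); rewrite e mulrA.
by exists ((-1) ^+ m * d); rewrite -mulrA -e mulrA -expr2 sqrr_sign mul1r.
Qed.

Section Regularity.
Variables (K : numFieldType) (k : nat) (w0 : seq letter).
Hypothesis k0 : (0 < k)%N.
Hypothesis v0 : valid k (start_st k) w0.
Hypothesis e0 : endst (start_st k) w0 = final_st k.
Hypothesis Q0 : forall u v, w0 = u ++ v ->
  endst (start_st k) u true = start_st k true \/ endst (start_st k) u false = final_st k false.

Local Notation P := {mpoly K[k * k]}.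
Local Notation start := (start_st k).
Local Notation n := (mut_number w0).
Local Notation p := (frozen_number k).
Local Notation N := (n + p.+1)%N.
Local Notation path := (initial_path k w0).
Local Notation cur := (initial_cur k w0).
Local Notation gmx := (gmx K k).
Local Notation mx_field := (mx_field K k).
Local Notation inc := (tofracP K k).

Variable X : nat -> P.
Hypothesis flX : flags k gmx X cur start.
Hypothesis lbX : labelled gmx X start path.
Local Notation S0 := (matrix_seed w0 X).

Lemma prime_chamber st r : perm_state k st -> (r <= k)%N -> prime_elt (chamber gmx st r).
Proof.
move=> ps rk b c; rewrite /chamber /sminor => /dvdr_sign.
have [inj _ _] := ps.
move=> /(prime_minor (inj true) (inj false) (perm_below true ps rk) (perm_below false ps rk)).
by case=> h; [left|right]; apply/dvdr_sign.
Qed.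

Lemma chamber_ndvd st r st' r' : perm_state k st -> perm_state k st' ->
  (0 < r <= k)%N -> (r' <= k)%N ->
  ~ (r = r' /\ same_prefix (st' true) (st true) r /\ same_prefix (st' false) (st false) r) ->
  ~ dvdr (chamber gmx st r) (chamber gmx st' r').
Proof.
move=> ps ps' /andP[r0 rk] rk' no; rewrite /chamber /sminor => /dvdr_sign/dvdr_signr.
have [inj _ _] := ps; have [inj' _ _] := ps'.
by apply: gfminor_ndvd => //; apply: perm_below.
Qed.

Lemma mutable_chamber i : (i < n)%N -> exists st r, [/\ perm_state k st, (0 < r < k)%N,
  X i = chamber gmx st r & st true = start true \/ st false = final_st k false].
Proof.
move=> lt; have [u [a [v [e h]]]] := labelled_val lbX (initial_path_mut k lt).
rewrite erase_decorate in e; have vu : valid k start (rcons u a).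
  by move: v0; rewrite e -cat_rcons valid_cat => /andP[].
exists (endst start (rcons u a)), a.2; split=> //.
- by apply: perm_end => //; apply: perm_start.
- by apply: (valid_levels v0); rewrite e mem_cat inE eqxx orbT.
- by apply: (Q0 (v := v)); rewrite cat_rcons.
Qed.

(** The path that changes the rows before the columns.  Each of its
    minors has the columns of the initial flag or the rows of the final flag,
    whereas those of the initial path have the rows of the initial flag or the
    columns of the final flag. *)
Lemma opposite_seed : exists ls (Y : nat -> P), let S1 := foldl (@mutate mx_field n p.+1) S0 ls in
  (forall i, ext_cluster S1 i = inc (Y i)) /\
  forall j, (j < N)%N -> exists st r, [/\ perm_state k st, (0 < r <= k)%N,
    Y j = chamber gmx st r & st false = start false \/ st true = final_st k true].
Proof.
have [t [vt et Q1]] := two_stage_path k true.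
have [ls [w' [e' pm [f [xE _ ff lf]]]]] := reach_path k0 v0 e0 flX lbX vt et.
have [Y [fY lY]] : exists Y, flags k gmx Y cur start /\ labelled gmx Y start w'.
  apply: exists_labelling; have [uq cw inj] := initial_path_fresh k0 v0.
  by split=> //; [rewrite (perm_uniq pm) | move=> r; rewrite (perm_mem pm)].
exists ls, Y; split=> [i|j jN].
  rewrite xE; have [iw|[r /andP[_ rk] ->]] := label_cases k0 v0 e0 (ltn_ord i).
    apply: (labelled_uniq lf (map_labelled inc lY)); by rewrite (perm_mem pm).
  by rewrite ff // -(map_flags inc fY).
have [jw|[r /andP[r0 rk] ->]] := label_cases k0 v0 e0 jN; last first.
  exists start, r; rewrite r0 rk fY //; split=> //; [exact: perm_start|by left].
rewrite -(perm_mem pm) in jw; have [u [a [v [e h]]]] := labelled_val lY jw.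
rewrite e' in e; have vu : valid k start (rcons u a).
  by move: vt; rewrite e -cat_rcons valid_cat => /andP[].
exists (endst start (rcons u a)), a.2; split=> //.
- by apply: perm_end => //; apply: perm_start.
- have /andP[-> /ltnW->] // : (0 < a.2 < k)%N.
  by apply: (valid_levels vt); rewrite e mem_cat inE eqxx orbT.
- by apply: (Q1 _ v); rewrite cat_rcons.
Qed.

Lemma same_prefix_id u r : same_prefix u u r.
Proof. by move=> i ir; exists i. Qed.

Lemma prefix_id_rev r : (0 < r < k)%N ->
  ~ same_prefix (start false) (start true) r /\ ~ same_prefix (start true) (start false) r.
Proof.
move=> /andP[r0 rk]; split=> h.
  have [j jr] := h 0%N r0; rewrite /start_st /= leqNgt (ltn_trans jr rk) /=; lia.
have [j jr] := h 0%N r0; rewrite /start_st /= leqNgt (ltn_trans r0 rk) /=; lia.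
Qed.

Lemma X_last r : (0 < r < k)%N -> X (last_label k n r) = chamber gmx (final_st k) r.
Proof.
move=> rk; have vp : valid k start (erase path) by rewrite erase_decorate.
have := flags_end (perm_start k) vp flX lbX; rewrite erase_decorate e0 => /(_ r).
rewrite (initial_path_end v0 e0) rk; apply; by case/andP: rk => _ /ltnW.
Qed.

(** Otherwise the two minors would have the same rows and columns.  Those of the
    initial flag or those of the final flag belong to a frozen variable, which
    is different from X i; the other combinations of a row set and a column set
    do not exist, as the initial and the final prefixes are different sets. *)
Lemma mutable_ndvd i st' r' : (i < n)%N -> perm_state k st' -> (0 < r' <= k)%N ->
  (st' false = start false \/ st' true = final_st k true) ->
  ~ dvdr (X i) (chamber gmx st' r').
Proof.
move=> lt ps' /andP[r0' rk'] Q'; have [st [r [ps rk XE Q]]] := mutable_chamber lt.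
rewrite XE.
have /andP[r0 /ltnW rk1] := rk.
have [nid nrev] := prefix_id_rev rk.
apply: chamber_ndvd => //; first by rewrite r0.
move=> [_ [st1 st2]].
have iN : (i < N)%N by apply: leq_trans lt (leq_addr _ _).
have bel c : inj_below (st c) r by move=> x y _ _; case: ps => inj _ _; apply: inj.
case: Q Q' => Q [] Q'.
- have sp1 : same_prefix (start true) (st true) r by rewrite Q; apply: same_prefix_id.
  have sp2 : same_prefix (start false) (st false) r by rewrite -Q'.
  have [b h] := sminor_same_prefix gmx (bel true) (bel false) sp1 sp2.
  have cN : (cur r < N)%N by rewrite (cur_level k0 v0 rk) /frozen_number; move: (n) rk => m ?; lia.
  apply: (X_sign_neq k0 v0 e0 flX lbX (b := b) iN cN).
    by rewrite (cur_level k0 v0 rk); move: (n) lt => m ?; apply/eqP; lia.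
  by rewrite XE (flX rk1).
- by move: st1; rewrite Q Q'; apply: nid.
- by move: st2; rewrite Q Q'; apply: nid.
- have sp1 : same_prefix (final_st k true) (st true) r by rewrite -Q'.
  have sp2 : same_prefix (final_st k false) (st false) r by rewrite Q; apply: same_prefix_id.
  have [b h] := sminor_same_prefix gmx (bel true) (bel false) sp1 sp2.
  have lN : (last_label k n r < N)%N by rewrite /last_label /frozen_number; move: (n) rk => m ?; lia.
  apply: (X_sign_neq k0 v0 e0 flX lbX (b := b) iN lN).
    by rewrite /last_label; move: (n) lt => m ?; apply/eqP; lia.
  by rewrite XE X_last.
Qed.

Lemma positive_seed A (i0 : 'I_p.+1) :
  (forall l, (l < N)%N -> l != (n + i0)%N -> 0 < mx_eval idfun A (X l)) ->
  0 <= mx_eval idfun A (X (n + i0)) ->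
  @pos_seed _ _ (mx_eval idfun A) n p.+1 i0 S0.
Proof.
move=> pos nneg; split=> [i ii|].
  have ne : (i : nat) != (n + i0)%N.
    by apply: contra ii => /eqP e; apply/eqP/val_inj.
  have px := pos i (ltn_ord i) ne.
  by exists (X i), 1; rewrite rmorph1 ltr01 mulr1.
by exists (X (n + i0)), 1; rewrite rmorph1 ltr01 mulr1.
Qed.

Lemma X_prime i : (i < N)%N -> prime_elt (X i).
Proof.
move=> iN; have [iw|[r /andP[_ rk] ->]] := label_cases k0 v0 e0 iN; last first.
  by rewrite flX //; apply: prime_chamber rk => //; apply: perm_start.
have [u [a [v [e ->]]]] := labelled_val lbX iw.
rewrite erase_decorate in e; have vu : valid k start (rcons u a).
  by move: v0; rewrite e -cat_rcons valid_cat => /andP[].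
apply: prime_chamber; first by apply: perm_end => //; apply: perm_start.
have /andP[_ /ltnW//] : (0 < a.2 < k)%N.
by apply: (valid_levels v0); rewrite e mem_cat inE eqxx orbT.
Qed.

(** The Laurent phenomenon leaves denominators that are products of initial
    variables, which are prime.  A mutable one is removed with the denominator of
    z in the opposite seed, a frozen one with a denominator that is positive at a
    point where this frozen variable vanishes. *)
Theorem cluster_variable_regular ls i :
  exists r, ext_cluster (foldl (@mutate mx_field n p.+1) S0 ls) i = inc r.
Proof.
have rS0 := matrix_seed_regular k0 v0 e0 flX lbX.
have K2 := two_neq0 K.
have inj := @tofracP_inj K k.
case: (split_ordP i) => j ->; last first.
  exists (X (n + j)); elim/last_ind: ls => // ls l; rewrite foldl_rcons.
  by rewrite mutate_off // eq_rlshift.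
set z := ext_cluster _ _.
have [ls1 [Y [S1E Yc]]] := opposite_seed.
set S1 := foldl _ S0 ls1 in S1E.
have rS1 : regular_seed (iotaM K k) S1 by apply: regular_foldl.
have ji c : iotaM K k c = inc (mpolyC _ c) by [].
have [N0 h0] : exists N0, exists r, z * inc (\prod_(i < N) X i ^+ N0) = inc r.
  have := laurent_phenomenon K2 ls (lshift p.+1 j) rS0.
  apply: (laurent_denominator inj ji) => h; exact: (X_neq0 k0 v0 e0 flX lbX).
have Y0 (h : 'I_N) : Y h != 0.
  have [ind _ _] := rS1; have := indep_neq0 h ind.
  by rewrite S1E -(rmorph0 inc) (inj_eq inj).
have [N1 h1] : exists N1, exists r, z * inc (\prod_(i < N) Y i ^+ N1) = inc r.
  have := laurent_phenomenon K2 (rev ls1 ++ ls) (lshift p.+1 j) rS1.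
  rewrite foldl_cat (foldl_mutateK K2 ls1 rS0) -/z.
  rewrite (_ : ext_cluster S1 = fun i => inc (Y i)); last exact/funext.
  exact: (laurent_denominator inj ji).
(* By h0 a monomial in the initial variables is a denominator of z; it remains to
   find, for each of these variables, a denominator that it does not divide. *)
apply: (@remove_primes _ _ inc inj [seq X i | i : 'I_N] z N0) => [_ /mapP[h _ ->]|]; last first.
  by rewrite big_image.
have hN := ltn_ord h.
split; [exact: (X_neq0 k0 v0 e0 flX lbX) | exact: X_prime |].
have [hn|nh] := ltnP h n.
  exists (\prod_(i < N) Y i ^+ N1) => //.
  have nY (j' : 'I_N) : ~ dvdr (X h) (Y j').
    have [st [r [ps rk -> Q]]] := Yc j' (ltn_ord j').
    exact: mutable_ndvd.
  move=> /prime_elt_prod-/(_ (X_prime hN))[|j' /nY//].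
  move=> [c e]; apply: (nY h); exists (Y h * c); by rewrite -mulrA -e mulr1.
have [|A [A0 A1]] := @frozen_zero_point K k w0 k0 v0 e0 X flX lbX h; first by rewrite nh.
have hp : (h - n < p.+1)%N by rewrite ltn_subLR.
have hE : (n + Ordinal hp)%N = h by rewrite /= subnKC.
have ps0 : @pos_seed _ _ (mx_eval idfun A) n p.+1 (Ordinal hp) S0.
  apply: positive_seed; last by rewrite hE A0.
  by move=> l lN; rewrite hE => /(A1 l lN) ->; apply: ltr01.
have [/(_ (lshift p.+1 j))] := pos_foldl ls ps0.
rewrite eq_sym eq_rlshift => /(_ isT)[a [b [a0 b0 e]]] _.
exists b; last by exists a.
by move=> [c bc]; move: b0; rewrite bc rmorphM /= A0 mulr0 ltxx.
Qed.

End Regularity.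

(** * Every minor is a variable of a seed *)

Section Listing.
Variables (k : nat) (I : {set 'I_k}).

(** The complement follows in order to get a permutation; its prefix of length
    #|I| is I in increasing order. *)
Definition listing : seq nat := [seq val i | i <- enum I ++ enum (~: I)].
Definition listing_fun (i : nat) : nat := if (i < k)%N then nth 0%N listing i else i.

Lemma listing_perm : perm_eq listing (iota 0 k).
Proof.
rewrite -val_enum_ord; apply: perm_map; apply: uniq_perm; rewrite ?enum_uniq //.
  rewrite cat_uniq !enum_uniq andbT; apply/hasPn => i.
  by rewrite !mem_enum inE.
by move=> i; rewrite mem_cat !mem_enum inE orbN.
Qed.

Lemma listing_size : size listing = k.
Proof. by rewrite (perm_size listing_perm) size_iota. Qed.

Lemma listing_lt i : (i < k)%N -> (nth 0%N listing i < k)%N.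
Proof.
move=> ik; have : nth 0%N listing i \in listing by rewrite mem_nth ?listing_size.
by rewrite (perm_mem listing_perm) mem_iota.
Qed.

Lemma listing_inj : injective listing_fun.
Proof.
have un : uniq listing by rewrite (perm_uniq listing_perm) iota_uniq.
move=> i j; rewrite /listing_fun; case: ltnP => ik; case: ltnP => jk.
- by move=> /eqP; rewrite nth_uniq ?listing_size // => /eqP.
- by move=> e; have := listing_lt ik; rewrite e ltnNge jk.
- by move=> e; have := listing_lt jk; rewrite -e ltnNge ik.
- by [].
Qed.

Lemma listing_val (a : 'I_#|I|) : listing_fun a = val (enum_val a).
Proof.
have ak : (a < k)%N by apply: leq_trans (ltn_ord a) _; rewrite -[X in (_ <= X)%N]card_ord max_card.
rewrite /listing_fun ak /listing map_cat nth_cat size_map -cardE ltn_ord.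
by rewrite (nth_map (enum_val a)) -?cardE // -enum_val_nth.
Qed.

Lemma listing_sorted i j : (i < j < #|I|)%N -> (listing_fun i < listing_fun j)%N.
Proof.
move=> /andP[ij jI]; have iI := ltn_trans ij jI.
have Ik : (#|I| <= k)%N by rewrite -[X in (_ <= X)%N]card_ord max_card.
rewrite /listing_fun (leq_trans iI Ik) (leq_trans jI Ik) /listing map_cat !nth_cat.
rewrite size_map -cardE iI jI; set s := map _ _.
have so : sorted ltn s.
  have := iota_ltn_sorted 0 k; rewrite -val_enum_ord enumT /s {1}/enum_mem.
  by rewrite !sorted_map; apply: sorted_filter => ? ? ?; apply: ltn_trans.
by apply: (sorted_ltn_nth ltn_trans 0%N so) => //; rewrite inE size_map -cardE.
Qed.

Lemma listing_pair_count : pair_count gtr listing_fun #|I| = 0%N.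
Proof.
rewrite /pair_count big1 // => j _; rewrite big1 // => i _.
by rewrite /gtr ltnNge ltnW // listing_sorted // !ltn_ord.
Qed.

End Listing.

Lemma listing_state k (I J : {set 'I_k}) :
  perm_state k (fun b => listing_fun (if b then I else J)).
Proof.
split=> b; first exact: listing_inj.
  by move=> i ik; rewrite /listing_fun ik listing_lt.
by move=> i ki; rewrite /listing_fun ltnNge ki.
Qed.

Lemma chamber_listing (K : fieldType) k (I J : {set 'I_k}) (e : #|I| = #|J|) :
  chamber (gmx K k) (fun b => listing_fun (if b then I else J)) #|I| = minor (generic_mx K k) e.
Proof.
have cJ : pair_count gtr (listing_fun J) #|I| = 0%N by rewrite e listing_pair_count.
rewrite /chamber /sminor /= listing_pair_count cJ mul1r /fminor /minor.
congr (\det _); apply/matrixP => a b; rewrite !mxE listing_val.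
have -> : b = cast_ord e b :> nat by [].
by rewrite listing_val gmxE mxE.
Qed.

Lemma map_minor (R S : comNzRingType) (f : {rmorphism R -> S}) k (A : 'M[R]_k)
    (I J : {set 'I_k}) (e : #|I| = #|J|) : f (minor A e) = minor (map_mx f A) e.
Proof. by rewrite /minor -det_map_mx; congr (\det _); apply/matrixP => a b; rewrite !mxE. Qed.

Lemma end_cur_cases cur w r : end_cur cur w r = cur r \/ end_cur cur w r \in new_labels w.
Proof.
elim: w cur => [|[[b s] l] w IH] cur; first by left.
rewrite /= inE; have [->|->] := IH (cur_step cur (b, s, l)); last by right; rewrite orbT.
rewrite /cur_step /upd /=; case: ifP => _; first by right; rewrite eqxx.
by left.
Qed.

Section MinorsInSeeds.
Variables (K : numFieldType) (k : nat) (w0 : seq letter).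
Hypothesis k0 : (0 < k)%N.
Hypothesis v0 : valid k (start_st k) w0.
Hypothesis e0 : endst (start_st k) w0 = final_st k.

Local Notation P := {mpoly K[k * k]}.
Local Notation start := (start_st k).
Local Notation n := (mut_number w0).
Local Notation p := (frozen_number k).
Local Notation N := (n + p.+1)%N.
Local Notation path := (initial_path k w0).
Local Notation cur := (initial_cur k w0).
Local Notation gmx := (gmx K k).
Local Notation mx_field := (mx_field K k).
Local Notation inc := (tofracP K k).

Variable X : nat -> P.
Hypothesis flX : flags k gmx X cur start.
Hypothesis lbX : labelled gmx X start path.
Local Notation S0 := (matrix_seed w0 X).

(** A word that reaches st is continued to a path, whose seed has the minor as the
    chamber that is open at the level r when st is reached. *)
Lemma chamber_in_seed st r : perm_state k st -> (0 < r < k)%N ->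
  exists ls (i : 'I_N), (i < n + p)%N /\
    ext_cluster (foldl (@mutate mx_field n p.+1) S0 ls) i = inc (chamber gmx st r).
Proof.
move=> ps rk; have [w1 v1 e1] := reach ps.
have [w2 [v2 _ no]] := exhaust k predT st.
have vt : valid k start (w1 ++ w2) by rewrite valid_cat v1 e1.
have et : endst start (w1 ++ w2) = final_st k.
  rewrite endst_cat e1; apply: final_stP; first exact: perm_end.
  by move=> a; apply: no.
have [ls [w' [e' pm [f [xE _ ff lf]]]]] := reach_path k0 v0 e0 flX lbX vt et.
pose u := take (size w1) w'.
have eu : erase u = w1 by rewrite /u /erase map_take -/(erase w') e' take_size_cat.
have lu : labelled (fun i j => inc (gmx i j)) f start u.
  by move: lf; rewrite -[w'](cat_take_drop (size w1)) => /labelled_cat[].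
have vu : valid k start (erase u) by rewrite eu.
have := flags_end (perm_start k) vu ff lu => /(_ r); rewrite eu e1.
have rk' : (r <= k)%N by case/andP: rk => _ /ltnW.
move=> /(_ rk'); set l := end_cur cur u r => fl.
have lN : (l < n + p)%N.
  rewrite /l; have [->|] := end_cur_cases cur u r.
    by rewrite (cur_level k0 v0 rk) /frozen_number; move: (n) rk => m ?; lia.
  move=> lu'; apply: (initial_path_range k0 v0); rewrite -(perm_mem pm).
  by move: lu'; rewrite /u /new_labels map_take; apply: mem_take.
have lN' : (l < N)%N by rewrite addnS ltnS ltnW.
exists ls, (Ordinal lN'); split=> //.
by rewrite xE [LHS]fl /chamber map_sminor.
Qed.

(** Exchanges inside the listing of all rows and columns do not change the signed
    minor, so all states give the same value as the identity. *)
Lemma chamber_top st : perm_state k st -> chamber gmx st k = \det (generic_mx K k).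
Proof.
have inv st' : perm_state k st' -> chamber gmx st' k = chamber gmx start k.
  move=> ps'; have [w vw <-] := reach ps'.
  elim/last_ind: w vw => [_|w a IH]; first exact: erefl.
  rewrite -cats1 valid_cat => /andP[vw /=]; rewrite andbT => /andP[ak _].
  transitivity (chamber gmx (endst start w) k); last exact: IH.
  rewrite endst_cat -[endst _ [:: a]]/(move_st (endst start w) a).
  have psw := perm_end vw (perm_start k); case/andP: ak => a0 ak.
  have ne : a.2 != k by rewrite neq_ltn ak.
  exact: (chamber_move gmx psw a0 ne).
move=> ps; rewrite (inv _ ps); have idst : perm_state k (fun _ => id) by split=> [b x y|b i|b i].
rewrite -(inv _ idst) /chamber /sminor /= (_ : pair_count _ _ _ = 0%N) ?mul1r.
  by congr (\det _); apply/matrixP => i j; rewrite mxE gmxE.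
rewrite /pair_count big1 // => j _; rewrite big1 // => i _.
by rewrite /gtr ltnNge ltnW.
Qed.

Lemma X_det : X (n + p) = \det (generic_mx K k).
Proof. by rewrite -(chamber_top (perm_start k)) -flX // (cur_det k0 v0). Qed.

End MinorsInSeeds.

(** * Specialization to determinant one *)

Lemma chamber1 (R : comNzRingType) (A : nat -> nat -> R) st :
  chamber A st 1 = A (st true 0%N) (st false 0%N).
Proof.
rewrite /chamber /sminor /pair_count !big_ord1 !big_ord0 mul1r /fminor.
by rewrite det_mx11 mxE.
Qed.

Lemma listing1 k (i : 'I_k) : listing_fun [set i] 0 = i.
Proof.
have c0 : (0 < #|[set i]|)%N by rewrite cards1.
rewrite -[0%N]/(nat_of_ord (Ordinal c0)) listing_val.
by have := enum_valP (Ordinal c0); rewrite inE => /eqP ->.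
Qed.

Section Specialization.
Variables (K : numFieldType) (k : nat) (w0 : seq letter).
Hypothesis k0 : (0 < k)%N.
Hypothesis v0 : valid k (start_st k) w0.
Hypothesis e0 : endst (start_st k) w0 = final_st k.
Hypothesis Q0 : forall u v, w0 = u ++ v ->
  endst (start_st k) u true = start_st k true \/ endst (start_st k) u false = final_st k false.

Local Notation P := {mpoly K[k * k]}.
Local Notation start := (start_st k).
Local Notation n := (mut_number w0).
Local Notation p := (frozen_number k).
Local Notation N := (n + p.+1)%N.
Local Notation path := (initial_path k w0).
Local Notation cur := (initial_cur k w0).
Local Notation gmx := (gmx K k).
Local Notation mx_field := (mx_field K k).
Local Notation inc := (tofracP K k).
Local Notation det := (\det (generic_mx K k)).

Variable X : nat -> P.
Hypothesis flX : flags k gmx X cur start.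
Hypothesis lbX : labelled gmx X start path.
Local Notation S0 := (matrix_seed w0 X).

Variables (T : fieldType) (iota : {rmorphism K -> T}) (rho : {rmorphism P -> T}).
Hypothesis rho_scalar : forall c, iota c = rho c%:MP.
Hypothesis rho_det : rho det = 1.
Hypothesis rho_ker : forall a, rho a = 0 -> exists q, a = q * (det - 1).
Hypothesis rho_frac : forall z : T, exists a b, rho b != 0 /\ z = rho a / rho b.

Definition sl_seed : labeled_pair T n p :=
  LabeledPair (fun i => rho (X i)) (\matrix_(i, j) quiver cur path i j).

Let Xdet : X (n + p) = det := X_det k0 v0 flX.

(** The determinant being one of these minors, this is a point of the special
    linear group. *)
Lemma ones_point : exists A : nat -> nat -> K,
  forall l, (l < N)%N -> mx_eval idfun A (X l) = 1.
Proof.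
have [|A hA] := @solve_back_labels K k w0 k0 v0 e0 X flX lbX K idfun (fun=> 1) erefl.
  by move=> l _; apply: oner_neq0.
by exists A.
Qed.

Lemma rho_eval A : mx_eval idfun A (X (n + p)) = 1 :> K ->
  forall a, mx_eval idfun A a != 0 -> rho a != 0.
Proof.
move=> A1 a; apply: contraNneq => /rho_ker[q ->].
by rewrite rmorphM rmorphB rmorph1 /= -Xdet A1 subrr mulr0.
Qed.

(** All cluster variables are positive at a point of the special linear group. *)
Lemma cluster_value ls (i : 'I_n) (y : P) :
  ext_cluster (foldl (@mutate mx_field n p.+1) S0 ls) (lshift p.+1 i) = inc y -> rho y != 0.
Proof.
have [A hA] := ones_point; move=> e; apply: (rho_eval (A := A)).
  by apply: hA; rewrite addnS.
have ps0 : @pos_seed _ _ (mx_eval idfun A) n p.+1 ord_max S0.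
  apply: positive_seed => [l lN _|]; first by rewrite hA ?ltr01.
  by rewrite hA ?ler01 //= addnS.
have [/(_ (lshift p.+1 i))] := pos_foldl ls ps0.
rewrite eq_sym eq_rlshift => /(_ isT)[a [b [a1 b1]]]; rewrite e => h _.
have yb : y * b = a by apply: (@tofracP_inj K k); rewrite rmorphM.
by move: a1; rewrite -yb rmorphM /=; apply: contraTneq => ->; rewrite mul0r ltxx.
Qed.

(** The last variable is the determinant, whose image is 1. *)
Lemma prod_rho (Y : nat -> P) (f : nat -> nat) : rho (Y (n + p)%N) = 1 ->
  rho (\prod_(h < N) Y h ^+ f h) = \prod_(h < (n + p)%N) rho (Y h) ^+ f h.
Proof.
move=> Y1; rewrite rmorph_prod /=.
under eq_bigr do rewrite rmorphXn /=.
rewrite -(big_mkord predT (fun h => rho (Y h) ^+ f h)) addnS big_nat_recr //=.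
by rewrite Y1 expr1n mulr1 big_mkord.
Qed.

(** Mutations of the two seeds correspond to each other: the exchange relation
    holds between polynomials, by regularity, and its image can be solved for the
    new variable, since the image of the old one is not 0. *)
Lemma transfer ls : exists (Y : nat -> P) (B : nat -> nat -> int),
  let SM := foldl (@mutate mx_field n p.+1) S0 ls in
  let SL := foldl (@mutate T n p) sl_seed ls in
  [/\ forall i, ext_cluster SM i = inc (Y i), forall i, ext_cluster SL i = rho (Y i),
      forall i j, ext_mx SM i j = B i j, forall i j, ext_mx SL i j = B i j &
      Y (n + p) = det].
Proof.
elim/last_ind: ls => [|ls l [Y [B [xM xL bM bL Yd]]]].
  by exists X, (quiver cur path); split=> // i j; rewrite mxE.
have := cluster_value (i := l) (ls := ls); rewrite xM => /(_ _ erefl) yl0.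
have [y] := cluster_variable_regular k0 v0 e0 Q0 flX lbX (rcons ls l) (lshift p.+1 l).
rewrite !foldl_rcons; move: xM xL bM bL yl0.
set SM := foldl _ _ _; set SL := foldl _ _ _ => xM xL bM bL yl0.
rewrite mutate_at xM => ye.
have Yl0 : Y l != 0 by apply: contraNneq yl0 => /= ->; rewrite rmorph0.
have yE : y * Y l = \prod_(h < N) Y h ^+ pos_part (B h l) + \prod_(h < N) Y h ^+ pos_part (- B h l).
  apply: (@tofracP_inj K k); rewrite rmorphM rmorphD /= -ye divfK; last first.
    by rewrite -(rmorph0 inc) (inj_eq (@tofracP_inj K k)).
  rewrite /col_plus /col_minus !rmorph_prod.
  by congr (_ + _); apply: eq_bigr => h _; rewrite xM bM rmorphXn.
have rYd : rho (Y (n + p)%N) = 1 by rewrite Yd.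
exists (upd Y l y), (mutate_fun B l); split.
- move=> i; have [->|il] := eqVneq i (lshift p.+1 l).
    by rewrite mutate_at updE xM ye.
  by rewrite mutate_off // xM updN.
- move=> i; have [->|il] := eqVneq i (lshift p l); last by rewrite mutate_off // xL updN.
  rewrite mutate_at updE xL; apply: (mulIf yl0); rewrite divfK // -rmorphM yE rmorphD /=.
  rewrite (prod_rho (fun h => pos_part (B h l)) rYd) (prod_rho (fun h => pos_part (- B h l)) rYd).
  by congr (_ + _); apply: eq_bigr => h _; rewrite xL bL.
- by move=> i j; rewrite mutate_mxE !bM.
- by move=> i j; rewrite mutate_mxE !bL.
- by rewrite updN //; have := ltn_ord l; move: (n) l {xM xL bM bL yl0 ye Yl0 yE rYd SM SL} => m l ?; apply/eqP; lia.
Qed.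

Lemma sl_frozen ls j : ext_cluster (foldl (@mutate T n p) sl_seed ls) (rshift n j) = rho (X (n + j)).
Proof.
elim/last_ind: ls => // ls l; rewrite foldl_rcons.
by rewrite mutate_off // eq_rlshift.
Qed.

Lemma sl_cluster_regular ls i : exists a, ext_cluster (foldl (@mutate T n p) sl_seed ls) i = rho a.
Proof. by have [Y [B [_ xL _ _ _]]] := transfer ls; exists (Y i). Qed.

Lemma chamber_in_sl st r : perm_state k st -> (0 < r < k)%N ->
  is_frozen_variable sl_seed (rho (chamber gmx st r)) \/
  is_cluster_variable sl_seed (rho (chamber gmx st r)).
Proof.
move=> ps rk; have [ls [i [lt e]]] := chamber_in_seed k0 v0 e0 flX lbX ps rk.
have [Y [B [xM xL _ _ _]]] := transfer ls.
have Yi : Y i = chamber gmx st r by apply: (@tofracP_inj K k); rewrite -xM.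
rewrite -Yi -[nat_of_ord i]/(nat_of_ord (Ordinal lt)) -xL.
case: (split_ordP (Ordinal lt)) => j ->; last by left; exists j; rewrite !sl_frozen.
by right; exists ls, j.
Qed.

(** For k = 1 the only entry is the determinant. *)
Lemma entry_chamber (l : 'I_(k * k)) : rho 'X_l = 1 \/
  exists st, [/\ perm_state k st, (1 < k)%N & 'X_l = chamber gmx st 1].
Proof.
case/mxvec_indexP: l => i j.
pose st b := listing_fun (if b then [set i] else [set j]).
have ps : perm_state k st := listing_state [set i] [set j].
have -> : 'X_(mxvec_index i j) = chamber gmx st 1.
  by rewrite chamber1 /st /= !listing1 gmxE mxE.
have [k1|k1] := leqP k 1; last by right; exists st.
have top m : m = k -> chamber gmx st m = det by move=> ->; apply: chamber_top.
by left; rewrite top //; lia.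
Qed.

Lemma sl_cluster_algebra z : cluster_algebra iota sl_seed z <-> exists a, z = rho a.
Proof.
split=> [|[a ->]].
  elim=> {z} [c|z [ls [j ->]]|z [j ->]|y z _ [a ->] _ [b ->]|y z _ [a ->] _ [b ->]].
  - by exists c%:MP.
  - exact: sl_cluster_regular.
  - by exists (X (n + j)).
  - by exists (a + b); rewrite rmorphD.
  - by exists (a * b); rewrite rmorphM.
elim/mpoly_closure: a => [c|l|a b ha hb|a b ha hb].
- by rewrite -rho_scalar; apply: ca_scalar.
- have [->|[st [ps k1 ->]]] := entry_chamber l.
    by rewrite -(rmorph1 iota); apply: ca_scalar.
  have [//|h|h] := chamber_in_sl (r := 1) ps; [exact: ca_frozen|exact: ca_cluster].
- by rewrite rmorphD; apply: ca_add.
- by rewrite rmorphM; apply: ca_mul.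
Qed.

Lemma sl_indep : alg_independent iota (ext_cluster sl_seed).
Proof.
move=> f f0; have : rho (mmap (@mpolyC (k * k) K) (fun i : 'I_(n + p) => X i) f) = 0.
  by rewrite rmorph_mmap -f0; apply: mmap_ext => [c|i] //=; rewrite rho_scalar.
move=> /rho_ker[q e]; apply: (initial_minors_indep k0 v0 e0 flX lbX _ _ e).
  by rewrite addnS.
move=> L j A h; rewrite rmorphM rmorphB rmorph1 /= -Xdet h ?subrr ?mulr0 //.
by rewrite leqnn /= addnS.
Qed.

Definition generated (z : T) := exists f g : {mpoly K[n + p]},
  mmap iota (ext_cluster sl_seed) g != 0 /\
  z = mmap iota (ext_cluster sl_seed) f / mmap iota (ext_cluster sl_seed) g.

Lemma generated_scalar c : generated (iota c).
Proof.
exists c%:MP, 1; rewrite rmorph1 oner_neq0; split=> //.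
by rewrite mmapC divr1.
Qed.

Lemma generated_var i : generated (ext_cluster sl_seed i).
Proof.
exists 'X_i, 1; rewrite rmorph1 oner_neq0; split=> //.
by rewrite mmapX mmap1U divr1.
Qed.

Lemma generatedD a b : generated a -> generated b -> generated (a + b).
Proof.
move=> [f [g [g0 ->]]] [f' [g' [g0' ->]]]; exists (f * g' + f' * g), (g * g').
by rewrite rmorphD !rmorphM /= mulf_neq0 // addf_div.
Qed.

Lemma generatedM a b : generated a -> generated b -> generated (a * b).
Proof.
move=> [f [g [g0 ->]]] [f' [g' [g0' ->]]]; exists (f * f'), (g * g').
by rewrite !rmorphM /= mulf_neq0 // mulf_div.
Qed.

Lemma generatedV a : generated a -> generated a^-1.
Proof.
move=> [f [g [g0 ->]]]; have [f0|f0] := eqVneq (mmap iota (ext_cluster sl_seed) f) 0.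
  by rewrite f0 mul0r invr0 -(rmorph0 iota); apply: generated_scalar.
by exists g, f; rewrite invf_div.
Qed.

Lemma generated1 : generated 1.
Proof. by rewrite -(rmorph1 iota); apply: generated_scalar. Qed.

Lemma generated_X l : (l < N)%N -> generated (rho (X l)).
Proof.
rewrite addnS ltnS leq_eqVlt => /predU1P[->|lt]; last exact: (generated_var (Ordinal lt)).
by rewrite Xdet rho_det; apply: generated1.
Qed.

(** The denominators are monomials in the initial variables, which are not 0 on
    the special linear group, so fractions can be specialized. *)
Lemma generated_laurent z : laurent (iotaM K k) (ext_cluster S0) z ->
  exists a b, [/\ z * inc b = inc a, rho b != 0, generated (rho a) & generated (rho b)].
Proof.
have [A hA] := ones_point; have A1 : mx_eval idfun A (X (n + p)) = 1 by apply: hA; rewrite addnS.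
elim=> [c|i|i|x y _ [a [b [e b0 ga gb]]] _ [a' [b' [e' b0' ga' gb']]]
        |x y _ [a [b [e b0 ga gb]]] _ [a' [b' [e' b0' ga' gb']]]].
- exists c%:MP, 1; rewrite !rmorph1 mulr1 oner_neq0 -rho_scalar; split=> //.
    exact: generated_scalar.
  exact: generated1.
- exists (X i), 1; rewrite !rmorph1 mulr1 oner_neq0; split=> //.
    exact: generated_X.
  exact: generated1.
- exists 1, (X i); rewrite !rmorph1; split.
  + rewrite mulVf // -(rmorph0 inc) (inj_eq (@tofracP_inj K k)).
    exact: (X_neq0 k0 v0 e0 flX lbX).
  + by apply: (rho_eval A1); rewrite hA // oner_neq0.
  + exact: generated1.
  + exact: generated_X.
- exists (a * b' + a' * b), (b * b'); rewrite !rmorphD !rmorphM /= mulf_neq0 //; split=> //.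
  + by rewrite -e -e' mulrDl [y * _ * _]mulrAC mulrA; congr (_ + _); rewrite mulrA.
  + by apply: generatedD; apply: generatedM.
  + exact: generatedM.
- exists (a * a'), (b * b'); rewrite !rmorphM /= mulf_neq0 //; split=> //.
  + by rewrite mulrACA e e'.
  + exact: generatedM.
  + exact: generatedM.
Qed.

Lemma generated_chamber st r : perm_state k st -> (0 < r < k)%N ->
  generated (rho (chamber gmx st r)).
Proof.
move=> ps rk; have [ls [i [_ e]]] := chamber_in_seed k0 v0 e0 flX lbX ps rk.
have := laurent_phenomenon (two_neq0 K) ls i (matrix_seed_regular k0 v0 e0 flX lbX).
rewrite e => /generated_laurent[a [b [h b0 ga gb]]].
have -> : rho (chamber gmx st r) = rho a / rho b.
  apply: (mulIf b0); rewrite divfK // -rmorphM; congr (rho _).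
  by apply: (@tofracP_inj K k); rewrite rmorphM.
by apply: generatedM => //; apply: generatedV.
Qed.

Lemma sl_generates : generates_field iota (ext_cluster sl_seed).
Proof.
have gen a : generated (rho a).
  elim/mpoly_closure: a => [c|l|a b ha hb|a b ha hb].
  - by rewrite -rho_scalar; apply: generated_scalar.
  - have [->|[st [ps k1 ->]]] := entry_chamber l; first exact: generated1.
    exact: generated_chamber.
  - by rewrite rmorphD; apply: generatedD.
  - by rewrite rmorphM; apply: generatedM.
move=> z; have [a [b [_ ->]]] := rho_frac z.
by apply: generatedM; last apply: generatedV.
Qed.

Lemma sl_is_seed : is_seed iota sl_seed.
Proof.
split; [exact: sl_indep | exact: sl_generates |].
by exists (fun=> 1); split=> // i j; rewrite !mul1r !mxE quiver_skew.
Qed.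

End Specialization.

Lemma fraction_split (R : idomainType) (z : {fraction R}) :
  exists a b : R, b != 0 /\ z = tofrac a / tofrac b.
Proof.
elim/quotW: z => x; exists x.1, x.2; have b0 := denom_ratioP x; split=> //.
apply: (mulIf (_ : tofrac x.2 != 0)); first by rewrite tofrac_eq0.
rewrite divfK ?tofrac_eq0 //.
unlock tofrac; rewrite -[LHS]FracField.pi_mul.
apply/eqmodP; rewrite /= FracField.equivfE /FracField.mulf.
rewrite !numden_Ratio ?mulf_neq0 ?oner_eq0 //.
by rewrite !mulr1 mulrC.
Qed.

Section SL.
Variables (K : numFieldType) (k : nat).
Local Notation P := {mpoly K[k * k]}.
Local Notation det := (\det (generic_mx K k)).

(** Restriction of polynomial functions on matrices to the special linear group. *)
Definition sl_rho : {rmorphism P -> sl_field K k} := @tofrac (sl_ring K k) \o @sl_pi K k.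

Lemma sl_piP (x : sl_ring K k) : exists a, x = sl_pi a.
Proof. by exists (repr x); rewrite /sl_pi reprK. Qed.

Lemma sl_rho_det : sl_rho det = 1.
Proof. by rewrite /sl_rho /= -det_map_mx -/(sl_coord K k) det_sl_coord rmorph1. Qed.

Lemma sl_rho_ker a : sl_rho a = 0 -> exists q, a = q * (det - 1).
Proof.
move=> /eqP; rewrite /= tofrac_eq0 -(rmorph0 (@sl_pi K k)) /sl_pi.
by rewrite -Quotient.idealrBE subr0 => /sl_idealP.
Qed.

Lemma sl_rho_frac z : exists a b, sl_rho b != 0 /\ z = sl_rho a / sl_rho b.
Proof.
have [x [y [y0 ->]]] := fraction_split z.
have [[a xa] [b yb]] := (sl_piP x, sl_piP y).
by exists a, b; rewrite /= -xa -yb tofrac_eq0.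
Qed.

End SL.

From mathcomp Require Import reals complex.

Theorem theorem6p6p2 (R : realType) (k : nat) (hk : (0 < k)%N) :
  exists (n p : nat) (S : labeled_pair (sl_field R[i] k) n p),
    [/\ is_seed (sl_scalar R[i] k) S,
        forall z : sl_field R[i] k,
          cluster_algebra (sl_scalar R[i] k) S z <->
          exists f : sl_ring R[i] k, z = tofrac f
      & forall (I J : {set 'I_k}) (eqIJ : #|I| = #|J|),
          (1 <= #|I|)%N -> (#|I| <= k - 1)%N ->
          let z : sl_field R[i] k :=
            tofrac (minor (sl_coord R[i] k) eqIJ) in
          is_frozen_variable S z \/ is_cluster_variable S z].
Proof.
have [w0 [v0 e0 Q0]] := two_stage_path k false.
have [X [flX lbX]] := exists_labelling (gmx R[i] k) (start_st k) (initial_path_fresh hk v0).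
have scal c : sl_scalar R[i] k c = sl_rho R[i] k c%:MP by [].
have hdet := sl_rho_det R[i] k.
have hker := @sl_rho_ker R[i] k.
have hfrac := @sl_rho_frac R[i] k.
exists (mut_number w0), (frozen_number k), (sl_seed w0 X (sl_rho R[i] k)); split.
- exact: sl_is_seed.
- move=> z; rewrite (sl_cluster_algebra hk v0 e0 Q0 flX lbX scal hdet hker).
  split=> [[a ->]|[x ->]]; first by exists (sl_pi a).
  by have [a ->] := sl_piP x; exists a.
move=> I J eqIJ I0 Ik z.
have ps := listing_state I J.
have rk : (0 < #|I| < k)%N by lia.
have := chamber_in_sl hk v0 e0 Q0 flX lbX hdet hker ps rk.
by rewrite chamber_listing /sl_rho /= map_minor.
Qed.
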